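(* Let $B,L$ be any finite positive numbers and $\mathcal{D}=(0,L)\times(-B,B)$. Consider the problem $$u_t+uu_x+u_{xxx}+u_{xyy}=0\quad\text{for }(x,y)\in\mathcal{D},\ t>0,$$ $$u(x,-B,t)=u(x,B,t)=0,\quad x\in(0,L),\ t>0,$$ $$u(0,y,t)=u(L,y,t)=u_x(L,y,t)=0,\quad y\in(-B,B),\ t>0,$$ $$u(x,y,0)=u_0(x,y),\quad (x,y)\in\mathcal{D}.$$ If $$\left((1+x),u_0^2\right)<\frac{9}{32}\,\frac{(12B^2+L^2)^2}{L^2B^2(4B^2+L^2)},$$ then regular solutions $u$ of this problem satisfy, for all $t>0$, the inequality $$\|u\|^2(t)\le\left((1+x),u^2\right)(t)\le e^{-\sigma t}\left((1+x),u_0^2\right)$$ with $\sigma=\dfrac{12B^2+L^2}{B^2L^2(1+L)}$.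
   Context: Subscripts denote partial derivatives. $(\cdot,\cdot)$ and $\|\cdot\|$ are the inner product and the norm of $L^2(\mathcal{D})$; thus $\left((1+x),u^2\right)(t)=\int_{\mathcal{D}}(1+x)u^2(x,y,t)\,dx\,dy$ and $\|u\|^2(t)=\int_{\mathcal{D}}u^2(x,y,t)\,dx\,dy$. A regular solution is a real-valued function $u$ satisfying the equation almost everywhere and the boundary and initial conditions in the sense of traces, and such that for every finite $T>0$: $u\in L^\infty(0,T;H^2(\mathcal{D}))\cap L^2(0,T;H^3(\mathcal{D}))$, $\Delta u_x\in L^\infty(0,T;L^2(\mathcal{D}))\cap L^2(0,T;H^1(\mathcal{D}))$ and $u_t\in L^\infty(0,T;L^2(\mathcal{D}))\cap L^2(0,T;H^1(\mathcal{D}))$, where $\Delta=\partial_x^2+\partial_y^2$. *)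

(* Defs.v *)
From HB Require Import structures.
From mathcomp Require Import all_boot all_order all_algebra.
From mathcomp Require Import all_classical all_reals all_analysis.

Set Implicit Arguments.
Unset Strict Implicit.
Unset Printing Implicit Defensive.

Import Order.TTheory GRing.Theory Num.Theory.
Import numFieldNormedType.Exports.

Local Open Scope classical_set_scope.
Local Open Scope ring_scope.

Section Smooth.
Context {R : realType} {V : normedModType R}.

Definition iter_deriv (vs : seq V) (f : V -> R) : V -> R :=
  foldr (fun v g => 'D_v g) f vs.

(* On a finite-dimensional V this is C^oo. *)
Definition smooth (f : V -> R) : Prop :=
  forall vs : seq V, continuous (iter_deriv vs f) /\
    forall v x, derivable (iter_deriv vs f) x v.

Definition test_function (O : set V) (phi : V -> R) : Prop :=
  smooth phi /\
  exists K : set V, [/\ compact K, K `<=` O & forall x, ~ K x -> phi x = 0].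

End Smooth.

Section Spaces.
Context {R : realType}.
Implicit Types (D : set (R * R)) (f g v : R * R -> R) (w : R * R * R -> R).

Definition leb1 := @lebesgue_measure R.
Definition leb2 := (leb1 \x leb1)%E.
Definition leb3 := (leb2 \x leb1)%E.

Definition Rpos : set R := `]0, +oo[.

Definition ex : R * R := (1, 0).
Definition ey : R * R := (0, 1).

Definition locally_integrable_on D f : Prop :=
  forall K, compact K -> K `<=` D -> leb2.-integrable K (EFin \o f).

(* The list [vs] of directions encodes the differential operator. *)
Definition weak_deriv D (vs : seq (R * R)) f g : Prop :=
  [/\ locally_integrable_on D f, locally_integrable_on D g &
    forall phi, test_function D phi ->
      \int[leb2]_(z in D) (f z * iter_deriv vs phi z) =
      (-1) ^+ size vs * \int[leb2]_(z in D) (g z * phi z)].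

Definition L2norm D f : \bar R := Lnorm leb2 2%:E (EFin \o (f \_ D)).

Definition L2norm1 (I : set R) (h : R -> R) : \bar R :=
  Lnorm leb1 2%:E (EFin \o (h \_ I)).

(* [g] is the trace of [v \in H^1(D)] on the curve [gamma @` I]: the trace
   operator is the extension by density in H^1(D) of the restriction of
   functions smooth up to the boundary.  The curves used below are
   parametrized by arc length. *)
Definition has_trace D (gamma : R -> R * R) (I : set R) v (g : R -> R) : Prop :=
  exists (phi : nat -> R * R -> R) (vx vy : R * R -> R),
    [/\ forall n, smooth (phi n), weak_deriv D [:: ex] v vx &
        weak_deriv D [:: ey] v vy] /\
    [/\ L2norm D (phi n \- v) @[n --> \oo] --> 0%E,
        L2norm D ('D_ex (phi n) \- vx) @[n --> \oo] --> 0%E,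
        L2norm D ('D_ey (phi n) \- vy) @[n --> \oo] --> 0%E &
        L2norm1 I ((phi n \o gamma) \- g) @[n --> \oo] --> 0%E].

(* A function of (x, y, t) is seen as a function of t valued in functions on
   the plane. *)
Definition slice w (t : R) : R * R -> R := fun z => w (z, t).

Definition mixed_norm D (p : \bar R) (T : R) w : \bar R :=
  Lnorm leb1 p ((fun t => L2norm D (slice w t)) \_ `]0, T[).

(* L^p(0, T; L^2(D)) *)
Definition LpL2 D (p : \bar R) (T : R) w : Prop :=
  measurable_fun (D `*` `]0, T[) w /\
  (mixed_norm D p T w < +oo)%E.

(* L^p(0, T; H^k(D)): every space derivative of order at most k lies in
   L^p(0, T; L^2(D)). *)
Definition LpHk D (p : \bar R) (T : R) (k : nat) w : Prop :=
  measurable_fun (D `*` `]0, T[) w /\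
  forall i j : nat, (i + j <= k)%N ->
    exists g : R * R * R -> R, LpL2 D p T g /\
      {ae leb1, forall t, 0 < t < T ->
        weak_deriv D (nseq i ex ++ nseq j ey) (slice w t) (slice g t)}.

Definition space_deriv D (vs : seq (R * R)) w (g : R * R * R -> R) : Prop :=
  measurable_fun (D `*` Rpos) g /\
  {ae leb1, forall t, 0 < t -> weak_deriv D vs (slice w t) (slice g t)}.

(* Weak derivative of an L^2(D)-valued function: the equality of the
   L^2(D)-valued integrals holds almost everywhere on D. *)
Definition time_deriv D w (g : R * R * R -> R) : Prop :=
  measurable_fun (D `*` Rpos) g /\
  forall eta : R -> R, test_function Rpos eta ->
    {ae leb2, forall z, D z ->
      \int[leb1]_(t in Rpos) (w (z, t) * 'D_1 eta t) =
      - \int[leb1]_(t in Rpos) (g (z, t) * eta t)}.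

End Spaces.

Section Problem.
Context {R : realType}.
Variables B L : R.

Definition rect : set (R * R) := `]0, L[ `*` `]-B, B[.

Definition inner (f g : R * R -> R) : \bar R :=
  (\int[leb2]_(z in rect) (f z * g z)%:E)%E.

Section Solution.
Variables (u0 : R * R -> R) (u : R * R * R -> R).

Record regular_solution_with (ut ux uxxx uxyy : R * R * R -> R) : Prop := {
  rs_meas : measurable_fun (rect `*` Rpos) u ;
  rs_ut : time_deriv rect u ut ;
  rs_ux : space_deriv rect [:: ex] u ux ;
  rs_uxxx : space_deriv rect [:: ex; ex; ex] u uxxx ;
  rs_uxyy : space_deriv rect [:: ex; ey; ey] u uxyy ;
  rs_reg_u : forall T, 0 < T ->
    LpHk rect +oo%E T 2 u /\ LpHk rect 2%:E T 3 u ;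
  rs_reg_lap : forall T, 0 < T ->
    LpL2 rect +oo%E T (uxxx \+ uxyy) /\ LpHk rect 2%:E T 1 (uxxx \+ uxyy) ;
  rs_reg_ut : forall T, 0 < T ->
    LpL2 rect +oo%E T ut /\ LpHk rect 2%:E T 1 ut ;
  rs_eqn : {ae leb3, forall q, (rect `*` Rpos) q ->
    ut q + u q * ux q + uxxx q + uxyy q = 0} ;
  rs_bottom : {ae leb1, forall t, 0 < t ->
    has_trace rect (fun x => (x, - B)) `]0, L[ (slice u t) (cst 0)} ;
  rs_top : {ae leb1, forall t, 0 < t ->
    has_trace rect (fun x => (x, B)) `]0, L[ (slice u t) (cst 0)} ;
  rs_left : {ae leb1, forall t, 0 < t ->
    has_trace rect (fun y => (0, y)) `]-B, B[ (slice u t) (cst 0)} ;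
  rs_right : {ae leb1, forall t, 0 < t ->
    has_trace rect (fun y => (L, y)) `]-B, B[ (slice u t) (cst 0)} ;
  rs_right_x : {ae leb1, forall t, 0 < t ->
    has_trace rect (fun y => (L, y)) `]-B, B[ (slice ux t) (cst 0)} ;
  (* Since u and u_t are in L^2(0, T; L^2), the class u has a unique
     representative continuous in time with values in L^2; it gives u(t) a
     meaning for every t, and its value at t = 0 is the trace of u there. *)
  rs_cont : forall t, 0 < t ->
    L2norm rect (slice u s \- slice u t) @[s --> t] --> 0%E ;
  rs_meas0 : measurable_fun rect u0 ;
  rs_init : L2norm rect (slice u s \- u0) @[s --> 0^'+] --> 0%E
}.

Definition regular_solution : Prop :=
  exists ut ux uxxx uxyy, regular_solution_with ut ux uxxx uxyy.

End Solution.
End Problem.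

(* Main.v *)
Require Import Defs.
From HB Require Import structures.
From mathcomp Require Import all_boot all_order all_algebra.
From mathcomp Require Import all_classical all_reals all_analysis.
From mathcomp Require Import measurable_realfun.
From mathcomp Require Import ring lra.
Set Implicit Arguments.
Unset Strict Implicit.
Unset Printing Implicit Defensive.
Import Order.TTheory GRing.Theory Num.Theory.
Import numFieldNormedType.Exports.
Local Open Scope classical_set_scope.
Local Open Scope ring_scope.

(* On almost every line parallel to an axis, and for almost every t, the weak
   derivatives are genuine ones and the traces are boundary values: v = u(t)
   becomes absolutely continuous with the prescribed endpoint values.  Testing
   the equation with w v, w = al + be x, then gives, one line at a time,
     d/dt int w v^2 <= - be (3 |v_x|^2 + |v_y|^2 - (2/3) int v^3).
   With w = 1 the mass is nonincreasing, hence stays below the threshold.  By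
   int v^4 <= (int |v v_x|) (int |v v_y|) and Poincare's inequality with
   constant 6 / length^2, the cubic term is then at most a third of the
   dissipation, so that w = 1 + x yields d/dt E <= - sigma E.  The continuity
   of t |-> u(t) in L^2 transfers these almost everywhere statements to every
   t and to t = 0. *)

(** * Smooth functions and bump functions *)

Section SmoothLine.
Context {R : realType}.
Implicit Types f g : R -> R.

(** Null sets are the obstacle to working line by line: an identity tested against k(x) l(y) gives,
    for each k, an exceptional set of lines that depends on k. Hence bumps with rational endpoints,
    a countable family for which a single null set suffices. Of the boundary values needed, those of
    v_y at x = 0 and x = L are not hypotheses; they come from differentiating v = int v_x in y under
    the integral sign. The value of v_x at x = 0 is unknown, but it enters only through a square of
    favourable sign. For the constant weight the cubic term is a pure boundary term and vanishes, so
    the mass decreases without any smallness, and smallness persists in time without a continuity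
    argument. With p = 1/L^2 and q = 1/(2B)^2, Poincare gives 3 int v_x^2 + int v_y^2 >= 6 (3p + q)
    int v^2. Giving up a third leaves 4 (3p + q), and the bound 1 + x <= 1 + L turns this into
    sigma. The smallness hypothesis reads ((1 + x), u0^2) < (9/8) (3p + q)^2 / (p + q). *)

Fixpoint nderivable (n : nat) f : Prop :=
  if n is m.+1 then (forall x, derivable f x 1) /\ nderivable m (f^`())%classic
  else True.

Lemma nderivableW n f : nderivable n.+1 f -> nderivable n f.
Proof.
by elim: n f => [//|n IH] f [df Df]; split => //; exact: IH.
Qed.

Lemma nderivableD n f g : nderivable n f -> nderivable n g ->
  nderivable n (f \+ g).
Proof.
elim: n f g => [//|n IH] f g [df Df] [dg Dg]; split.
  by move=> x; apply: derivableD.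
rewrite (_ : (f \+ g)^`()%classic = f^`()%classic \+ g^`()%classic); first exact: IH.
by apply/funext => x; rewrite derive1E deriveD// /= !derive1E.
Qed.

Lemma nderivableM n f g : nderivable n f -> nderivable n g ->
  nderivable n (f \* g).
Proof.
elim: n f g => [//|n IH] f g Hf Hg; have [df Df] := Hf; have [dg Dg] := Hg; split.
  by move=> x; apply: derivableM.
rewrite (_ : (f \* g)^`()%classic =
    (f \* g^`()%classic) \+ (g \* f^`()%classic)).
  by apply: nderivableD; apply: IH => //; exact: nderivableW.
by apply/funext => x; rewrite derive1E deriveM// /= !derive1E.
Qed.

Lemma nderivable_cst n (c : R) : nderivable n (cst c).
Proof.
elim: n c => [//|n IH] c; split; first by move=> x; exact: derivable_cst.
rewrite (_ : _^`()%classic = cst 0) //.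
by apply/funext => x; rewrite derive1E derive_cst.
Qed.

Lemma nderivable_affine n f (a b : R) : nderivable n f ->
  nderivable n (fun x => f (a * x + b)).
Proof.
elim: n f => [//|n IH] f [df Df].
have der x : is_derive x (1:R) (fun x => f (a * x + b)) (a * f^`()%classic (a * x + b)).
  have h1 : is_derive x (1:R) (fun x => a * x + b) a.
    have -> : (fun x => a * x + b) = (a \*: id) \+ cst b by [].
    apply: is_derive_eq.
    by rewrite addr0 /GRing.scale /= mulr1.
  have h2 : is_derive (a * x + b) (1:R) f (f^`()%classic (a * x + b)).
    by rewrite derive1E; apply: derivableP.
  by rewrite mulrC; exact: (is_derive1_comp (g := fun x => a * x + b) h2 h1).
split; first by move=> x; exact: ex_derive.
rewrite (_ : (fun x : R => f (a * x + b))^`()%classic =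
    cst a \* (fun x => f^`()%classic (a * x + b))).
  by apply: nderivableM; [exact: nderivable_cst|exact: IH].
by apply/funext => x; rewrite derive1E derive_val.
Qed.

(** On the line the single derivative f' decides smoothness: the derivative in the direction v is v
    f', so the iterated directional derivatives of [smooth] stay in this class. Finite orders make
    closure under products and primitives an induction. *)
Definition line_smooth f := forall n, nderivable n f.

Lemma line_smooth_derivable f : line_smooth f -> forall x, derivable f x 1.
Proof. by case/(_ 1%N). Qed.

Lemma line_smooth_derive f : line_smooth f -> line_smooth (f^`())%classic.
Proof. by move=> sf n; case: (sf n.+1). Qed.

Lemma line_smooth_continuous f : line_smooth f -> continuous f.
Proof.
by move=> sf x; apply: differentiable_continuous; apply/derivable1_diffP;
  exact: line_smooth_derivable.
Qed.

Lemma line_smoothD f g : line_smooth f -> line_smooth g -> line_smooth (f \+ g).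
Proof. by move=> sf sg n; exact: nderivableD. Qed.

Lemma line_smoothM f g : line_smooth f -> line_smooth g -> line_smooth (f \* g).
Proof. by move=> sf sg n; exact: nderivableM. Qed.

Lemma line_smooth_cst c : line_smooth (cst c).
Proof. by move=> n; exact: nderivable_cst. Qed.

Lemma line_smooth_primitive f g : (forall x, is_derive x (1 : R) f (g x)) ->
  line_smooth g -> line_smooth f.
Proof.
move=> fg sg [//|n]; split; first by move=> x; exact: ex_derive.
rewrite (_ : _^`()%classic = g) //.
by apply/funext => x; rewrite derive1E derive_val.
Qed.

Lemma derive_dirE f (v : R) x : derivable f x 1 ->
  is_derive x v f (v * f^`()%classic x).
Proof.
move=> df; have /derivable1_diffP df' := df.
apply: DeriveDef; first exact: diff_derivable.
by rewrite deriveE// derive1E deriveE// -[v in LHS]mulr1 -[v * 1]/(v *: 1) linearZ.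
Qed.

Lemma line_smooth_smooth f : line_smooth f -> smooth f.
Proof.
move=> sf.
suff H vs : exists2 g, line_smooth g & iter_deriv vs f = g.
  move=> vs; have [g sg ->] := H vs; split; first exact: line_smooth_continuous.
  by move=> v x; have Dg := derive_dirE v (line_smooth_derivable (x:=x) sg); by case: Dg.
elim: vs => [|v vs [g sg E]]; first by exists f.
exists (cst v \* (g^`())%classic).
  by apply: line_smoothM; [exact: line_smooth_cst|exact: line_smooth_derive].
rewrite /= E; apply/funext => x.
by have Dg := derive_dirE v (line_smooth_derivable (x:=x) sg); case: Dg => _ ->.
Qed.

End SmoothLine.

Section SmoothPlane.
Context {R : realType}.

(** The span of the products f(x) g(y) of smooth functions. It is stable under every directional
    derivative, which is what makes its members [smooth]; products are the only test functions on
    the plane that are ever used. *)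
Inductive plane_smooth : (R * R -> R) -> Prop :=
| plane_smooth_tensor (f g : R -> R) of line_smooth f & line_smooth g :
    plane_smooth (fun z => f z.1 * g z.2)
| plane_smoothD (f g : R * R -> R) of plane_smooth f & plane_smooth g :
    plane_smooth (f \+ g)
| plane_smoothZ (c : R) (f : R * R -> R) of plane_smooth f :
    plane_smooth (fun z => c * f z).

Lemma is_derive_tensor (f g : R -> R) (z v : R * R) : derivable f z.1 1 ->
  derivable g z.2 1 ->
  is_derive z v (fun z => f z.1 * g z.2)
    (v.1 * (f^`()%classic z.1 * g z.2) + v.2 * (f z.1 * g^`()%classic z.2)).
Proof.
move=> df dg.
(* Restriction to the line through z with direction v: the directional derivative at z is the
   ordinary derivative of [k] at 0, given by the product and chain rules. *)
pose k (h : R) := f (v.1 * h + z.1) * g (v.2 * h + z.2).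
have L (u : R -> R) (a b : R) : derivable u b 1 ->
    is_derive (0 : R) (1:R) (fun h => u (a * h + b)) (a * u^`()%classic b).
  move=> du.
  have h1 : is_derive (0:R) (1:R) (fun x => a * x + b) a.
    have -> : (fun x => a * x + b) = (a \*: id) \+ cst b by [].
    apply: is_derive_eq.
    by rewrite addr0 /GRing.scale /= mulr1.
  have h2 : is_derive (a * 0 + b) (1:R) u (u^`()%classic b).
    by rewrite mulr0 add0r derive1E; apply: derivableP.
  by rewrite mulrC; exact: (is_derive1_comp (g := fun x => a * x + b) h2 h1).
have kd : is_derive (0 : R) (1:R) k
   (f z.1 * (v.2 * g^`()%classic z.2) + g z.2 * (v.1 * f^`()%classic z.1)).
  have := is_deriveM (L f v.1 z.1 df) (L g v.2 z.2 dg).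
  by rewrite /= !mulr0 !add0r.
have E : (fun h => h^-1 *: (((fun z => f z.1 * g z.2) \o shift z) (h *: v) - f z.1 * g z.2)) =
   (fun h => h^-1 *: ((k \o shift 0) (h *: (1:R)) - k 0)).
  apply/funext => h /=; rewrite /k /GRing.scale /=.
  by rewrite !mulr0 !add0r addr0 mulr1 [v.1 * h]mulrC [v.2 * h]mulrC.
case: kd => dk vk.
apply: DeriveDef; first by rewrite /derivable E.
rewrite /derive E -[LHS]/('D_1 k 0) vk; ring.
Qed.

Lemma plane_smooth_closed (f : R * R -> R) : plane_smooth f ->
  [/\ continuous f, forall z v, derivable f z v &
      forall v, plane_smooth ('D_v f)].
Proof.
elim=> [{}f g sf sg|{}f g sf [cf df Sf] sg [cg dg Sg]|c {}f sf [cf df Sf]].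
- split.
  + move=> z; apply: continuousM.
      by apply: continuous_comp; [exact: cvg_fst|exact: line_smooth_continuous].
    by apply: continuous_comp; [exact: cvg_snd|exact: line_smooth_continuous].
  + move=> z v; have Dfg := is_derive_tensor v (line_smooth_derivable (x:=z.1) sf)
      (line_smooth_derivable (x:=z.2) sg); by case: Dfg.
  + move=> v; rewrite (_ : 'D_v _ =
      (fun z => v.1 * (f^`()%classic z.1 * g z.2)) \+
      (fun z => v.2 * (f z.1 * g^`()%classic z.2))).
      by apply: plane_smoothD; apply: plane_smoothZ; apply: plane_smooth_tensor => //;
        exact: line_smooth_derive.
    apply/funext => z.
    have Dfg := is_derive_tensor v (line_smooth_derivable (x:=z.1) sf)
      (line_smooth_derivable (x:=z.2) sg); by case: Dfg => _ ->.
- split.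
  + by move=> z; apply: continuousD; [exact: cf|exact: cg].
  + by move=> z v; apply: derivableD; [exact: df|exact: dg].
  + move=> v; rewrite (_ : 'D_v _ = 'D_v f \+ 'D_v g); first exact: plane_smoothD.
    apply/funext => z; exact: (deriveD (df z v) (dg z v)).
- split.
  + by move=> z; apply: continuousM; [exact: cst_continuous|exact: cf].
  + by move=> z v; apply: (@derivableZ _ _ _ f c); exact: df.
  + move=> v; rewrite (_ : 'D_v _ = (fun z => c * 'D_v f z)); first exact: plane_smoothZ.
    apply/funext => z; exact: (@deriveZ _ _ _ f c _ _ (df z v)).
Qed.

Lemma plane_smooth_smooth (f : R * R -> R) : plane_smooth f -> smooth f.
Proof.
move=> sf vs.
suff /plane_smooth_closed[? ? _] : plane_smooth (iter_deriv vs f) by [].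
by elim: vs => //= v vs /plane_smooth_closed[].
Qed.

End SmoothPlane.

Section Bump.
Context {R : realType}.

(* The family is closed under differentiation: flat k' = flat (k+2) - k flat (k+1). *)
Definition flat (k : nat) (x : R) : R :=
  if 0 < x then x^-1 ^+ k * expR (- x^-1) else 0.

(** This is x/m <= 1 + x/m <= exp(x/m), raised to the power m. *)
Lemma exprn_le_expR (x : R) (m : nat) : 0 <= x -> (0 < m)%N ->
  x ^+ m <= m%:R ^+ m * expR x.
Proof.
move=> x0 m0; have mR : (0:R) < m%:R by rewrite ltr0n.
have -> : expR x = expR (x / m%:R) ^+ m.
  by rewrite -expRM_natl; congr expR; field; rewrite gt_eqF.
rewrite -exprMn; apply: lerXn2r; rewrite ?nnegrE// ?mulr_ge0 ?expR_ge0 ?ler0n//.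
rewrite -ler_pdivrMl// mulrC; apply: le_trans (expR_ge1Dx _).
by rewrite lerDr ler01.
Qed.

Lemma flat_ge0 k x : 0 <= flat k x.
Proof.
rewrite /flat; case: ifPn => // x0.
by rewrite mulr_ge0 ?expR_ge0 ?exprn_ge0// invr_ge0 ltW.
Qed.

(** The exponential bound is used at 1/x with exponent k + 1, one more than the power present, and
    so leaves a factor x: [flat k] tends to 0 at the origin. *)
Lemma flat_le k x : flat k x <= k.+1%:R ^+ k.+1 * `|x|.
Proof.
rewrite /flat; case: ifPn => x0; last by rewrite mulr_ge0// exprn_ge0.
have y0 : 0 < x^-1 by rewrite invr_gt0.
have := @exprn_le_expR x^-1 k.+1 (ltW y0) isT.
rewrite exprS gtr0_norm// expRN ler_pdivrMr ?expR_gt0// => H.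
rewrite -(ler_pM2l y0) (le_trans H)//.
rewrite [leRHS](_ : _ = k.+1%:R ^+ k.+1 * expR x^-1 * (x^-1 * x)); last by ring.
by rewrite mulVf ?mulr1// gt_eqF.
Qed.

Lemma is_derive_flat k (x : R) :
  is_derive x 1 (flat k) (- k%:R * flat k.+1 x + flat k.+2 x).
Proof.
case: (ltgtP 0 x) => [x0|x0|x0].
- have xn0 : x != 0 by rewrite gt_eqF.
  have dinv : is_derive x (1:R) (fun y : R => y^-1) (- x ^- 2).
    apply: DeriveDef; first exact: derivableV.
    by rewrite (@deriveV _ _ id)// derive_id /GRing.scale /= mulr1 expr2 invfM.
  have d1 : is_derive x (1:R) (fun y : R => y^-1 ^+ k * expR (- y^-1))
      (- k%:R * flat k.+1 x + flat k.+2 x).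
    have d2 : is_derive x (1:R) (fun y : R => - y^-1) (x ^- 2).
      by rewrite -[x ^- 2]opprK; exact: is_deriveN.
    have d3 := is_derive1_comp (g := fun y : R => - y^-1) (is_derive_expR (- x^-1)) d2.
    have d4 := is_deriveM (is_deriveX k dinv) d3.
    rewrite exprfctE in d4.
    apply: (is_derive_eq d4).
    rewrite /flat x0 /GRing.scale /=.
    case: k {d4} => [|k]; first by rewrite !expr0 /=; field.
    rewrite -![_ ^- 2]exprVn /= !exprS.
    move: (expR (- x^-1)) => E; move: (x^-1) => y; move: (y ^+ k) (k.+1%:R : R) => z c.
    by ring.
  apply: near_eq_is_derive d1.
  near=> y; rewrite /flat ifT//; near: y.
  by apply: lt_nbhsr.
- have d1 : is_derive x (1:R) (cst (0:R)) 0 by apply: is_derive_cst.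
  rewrite /flat ltNge (ltW x0)/= mulr0 addr0.
  apply: near_eq_is_derive d1.
  near=> y; rewrite ltNge ifF//; apply/negbTE; rewrite negbK; apply: ltW; near: y.
  exact: lt_nbhsl.
- rewrite -{x}x0; have -> : - k%:R * flat k.+1 0 + flat k.+2 0 = 0 :> R.
    by rewrite /flat ltxx mulr0 addr0.
  suff C : h^-1 *: ((flat k \o shift (0:R)) (h *: (1:R)) - flat k (0:R)) @[h --> (0:R)^'] --> (0 : R).
    apply: DeriveDef; first by apply/cvg_ex; exists 0.
    exact/cvg_lim.
  apply/cvgr0Pnorm_le => e e0.
  pose C : R := k.+2%:R ^+ k.+2.
  have C0 : 0 < C by rewrite exprn_gt0.
  near=> h.
  rewrite /= addr0 {2}/flat ltxx subr0 /GRing.scale /= mulr1.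
  (* The difference quotient at 0 is again a member of the family, and [flat_le] makes it tend to
     0. *)
  have -> : h^-1 * flat k h = flat k.+1 h.
    by rewrite /flat; case: ifPn => _; rewrite ?mulr0// exprS mulrA.
  rewrite ger0_norm ?flat_ge0//; apply: (le_trans (flat_le _ _)).
  rewrite -/C mulrC -ler_pdivlMr//; near: h.
  apply: (@dnbhs0_le _ R^o); exact: divr_gt0.
Unshelve. all: by end_near. Qed.

Lemma flat_smooth k : line_smooth (flat k).
Proof.
move=> n; elim: n k => [//|n IH] k; split.
  by move=> x; have D := is_derive_flat k x; by case: D.
rewrite (_ : _^`()%classic = (cst (- k%:R) \* flat k.+1) \+ flat k.+2).
  apply: nderivableD => //; apply: nderivableM => //; exact: nderivable_cst.
by apply/funext => x; rewrite derive1E; have D := is_derive_flat k x; case: D => _ ->.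
Qed.

(* As n grows, these smooth functions converge to the indicator of ]a, b[. *)
Definition bump (a b : R) (n : nat) (x : R) : R :=
  flat 0 (n.+1%:R * x + - n.+1%:R * a) * flat 0 (- n.+1%:R * x + n.+1%:R * b).

Lemma bump_smooth a b n : line_smooth (bump a b n).
Proof.
by move=> m; apply: nderivableM; apply: nderivable_affine; exact: flat_smooth.
Qed.

Lemma flat0_le1 x : flat 0 x <= 1.
Proof.
rewrite /flat; case: ifPn => // x0; rewrite expr0 mul1r -expR0 ler_expR oppr_le0.
by rewrite invr_ge0 ltW.
Qed.

Lemma bump_ge0 a b n x : 0 <= bump a b n x.
Proof. by rewrite mulr_ge0// flat_ge0. Qed.

Lemma bump_le1 a b n x : bump a b n x <= 1.
Proof. by rewrite -[leRHS]mulr1 ler_pM// ?flat_ge0// flat0_le1. Qed.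

Lemma bump_gt0 a b n x : a < x < b -> 0 < bump a b n x.
Proof.
move=> /andP[ax xb]; have n0 : (0:R) < n.+1%:R by [].
rewrite /bump /flat !expr0 !mul1r.
rewrite ifT; last by rewrite mulNr -mulrBr mulr_gt0// subr_gt0.
rewrite ifT; first by rewrite mulr_gt0// expR_gt0.
by rewrite addrC mulNr -mulrBr mulr_gt0// subr_gt0.
Qed.

Lemma bump_out a b n x : ~~ (a < x < b) -> bump a b n x = 0.
Proof.
have n0 : (0:R) < n.+1%:R by [].
rewrite negb_and -!leNgt => /orP[h|h]; rewrite /bump /flat.
  rewrite ifF ?mul0r//; apply/negbTE; rewrite -leNgt.
  by rewrite mulNr -mulrBr pmulr_rle0// subr_le0.
rewrite [X in _ * X]ifF ?mulr0//; apply/negbTE; rewrite -leNgt.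
by rewrite addrC mulNr -mulrBr pmulr_rle0// subr_le0.
Qed.

Lemma bump_test (O : set R) a b n : `[a, b] `<=` O -> test_function O (bump a b n).
Proof.
move=> abO; split; first by apply: line_smooth_smooth; exact: bump_smooth.
exists `[a, b]%classic; split => //; first exact: segment_compact.
move=> x /negP; rewrite in_itv /= => H; apply: bump_out; apply: contra H.
by move=> /andP[? ?]; rewrite !ltW.
Qed.

Lemma tensor_test (I J : set R) (f g : R -> R) : line_smooth f -> line_smooth g ->
  test_function I f -> test_function J g ->
  test_function (I `*` J) (fun z : R * R => f z.1 * g z.2).
Proof.
move=> sf sg [_ [K [cK KI K0]]] [_ [K' [cK' KJ K0']]]; split.
  by apply: plane_smooth_smooth; exact: plane_smooth_tensor.
exists (K `*` K'); split.
- exact: compact_setX.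
- by move=> z [? ?]; split; [exact: KI|exact: KJ].
- move=> [x y] /= /not_andP[h|h]; first by rewrite K0// mul0r.
  by rewrite K0' ?mulr0.
Qed.

End Bump.

(** * Integrals and product measures *)

Section Integrals.
Context d (T : measurableType d) (R : realType) (mu : {measure set T -> \bar R}).
Implicit Types (D : set T) (f g h : T -> R).

Lemma EFin_patch D f : EFin \o (f \_ D) = (EFin \o f) \_ D.
Proof. by apply/funext => x; rewrite /= /patch; case: ifP. Qed.

Lemma integrable_patch D f : measurable D ->
  mu.-integrable D (EFin \o f) <-> mu.-integrable setT (EFin \o (f \_ D)).
Proof. by move=> mD; rewrite EFin_patch; exact: integrable_mkcond. Qed.

Lemma integrable_domination D f g : measurable D -> measurable_fun D f ->
  (forall x, D x -> `|f x| <= g x) -> mu.-integrable D (EFin \o g) ->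
  mu.-integrable D (EFin \o f).
Proof.
move=> mD mf fg ig; apply: le_integrable ig => //; first exact/measurable_EFinP.
by move=> x Dx /=; rewrite !lee_fin (le_trans (fg x Dx))// ler_norm.
Qed.

Lemma integrable_measurable D f : mu.-integrable D (EFin \o f) -> measurable_fun D f.
Proof. by move=> /measurable_int/measurable_EFinP. Qed.

Lemma integrableRD D f g : measurable D -> mu.-integrable D (EFin \o f) ->
  mu.-integrable D (EFin \o g) -> mu.-integrable D (EFin \o (fun x => f x + g x)).
Proof.
move=> mD fi gi; rewrite (_ : EFin \o _ = (EFin \o f) \+ (EFin \o g))%E//.
exact: integrableD.
Qed.

Lemma integrableRZ D f c : measurable D -> mu.-integrable D (EFin \o f) ->
  mu.-integrable D (EFin \o (fun x => c * f x)).
Proof.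
move=> mD fi; rewrite (_ : EFin \o _ = (fun x => c%:E * (EFin \o f) x))%E//.
exact: integrableZl.
Qed.

Lemma integrableRN D f : measurable D -> mu.-integrable D (EFin \o f) ->
  mu.-integrable D (EFin \o (fun x => - f x)).
Proof.
move=> mD /(integrableRZ (-1) mD); apply: eq_integrable => // x _ /=.
by rewrite mulN1r.
Qed.

Lemma integrableRB D f g : measurable D -> mu.-integrable D (EFin \o f) ->
  mu.-integrable D (EFin \o g) -> mu.-integrable D (EFin \o (fun x => f x - g x)).
Proof. by move=> mD fi gi; apply: integrableRD => //; exact: integrableRN. Qed.

Lemma integrableR_abs D f : measurable D -> mu.-integrable D (EFin \o f) ->
  mu.-integrable D (EFin \o (fun x => `|f x|)).
Proof. by move=> mD /integrable_abse. Qed.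

Lemma RintegralN D f : measurable D -> mu.-integrable D (EFin \o f) ->
  \int[mu]_(x in D) (- f x) = - \int[mu]_(x in D) f x.
Proof.
move=> mD fi; rewrite -mulN1r -RintegralZl//.
by apply: eq_Rintegral => x _; rewrite mulN1r.
Qed.

Lemma ae_eq_RintegralP D f g : measurable D -> measurable_fun D f ->
  measurable_fun D g -> {ae mu, forall x, D x -> f x = g x} ->
  \int[mu]_(x in D) f x = \int[mu]_(x in D) g x.
Proof.
move=> mD mf mg fg; rewrite /Rintegral; congr fine; apply: ae_eq_integral => //.
- exact/measurable_EFinP.
- exact/measurable_EFinP.
- by apply: filterS fg => x fg Dx; rewrite /= fg.
Qed.

Lemma ae_integrable D f g : measurable D -> measurable_fun D g ->
  {ae mu, forall x, D x -> f x = g x} ->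
  mu.-integrable D (EFin \o f) -> mu.-integrable D (EFin \o g).
Proof.
move=> mD mg fg fi; apply/integrableP; split; first exact/measurable_EFinP.
move/integrableP : fi => [mf]; rewrite (_ : (\int[mu]_(x in D) `|(EFin \o g) x| = \int[mu]_(x in D) `|(EFin \o f) x|)%E)//.
apply: ae_eq_integral => //.
- by apply: measurableT_comp => //; exact/measurable_EFinP.
- by apply: measurableT_comp.
- by apply: filterS fg => x fg Dx; rewrite /= fg.
Qed.

Lemma le_ae_Rintegral D f g : measurable D -> mu.-integrable D (EFin \o f) ->
  mu.-integrable D (EFin \o g) -> {ae mu, forall x, D x -> f x <= g x} ->
  \int[mu]_(x in D) f x <= \int[mu]_(x in D) g x.
Proof.
move=> mD fi gi fg; rewrite -subr_ge0 -RintegralB//.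
have mgf : measurable_fun D (fun x => g x - f x).
  by apply: measurable_funB; exact: integrable_measurable.
rewrite (@ae_eq_RintegralP D _ (fun x => `|g x - f x|))//.
- exact: Rintegral_ge0.
- exact: measurableT_comp.
- by apply: filterS fg => x fg Dx; rewrite ger0_norm// subr_ge0 fg.
Qed.

Lemma Rintegral0_ae D f : measurable D -> mu.-integrable D (EFin \o f) ->
  \int[mu]_(x in D) `|f x| = 0 -> {ae mu, forall x, D x -> f x = 0}.
Proof.
move=> mD fi f0.
have H : (\int[mu]_(x in D) `|(EFin \o f) x| = 0)%E.
  have /fineK <- : (\int[mu]_(x in D) `|(EFin \o f) x|)%E \is a fin_num.
    by apply: integrable_fin_num => //; exact: integrableR_abs.
  by congr EFin; rewrite -f0.
have /ae_eq_integral_abs : measurable_fun D (EFin \o f).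
  by apply/measurable_EFinP; exact: integrable_measurable.
move=> /(_ mu mD)[/(_ H) + _]; apply: filterS => x fx Dx.
by have := fx Dx => /= -[].
Qed.

Lemma ae_imp (P Q : T -> Prop) : (forall x, P x -> Q x) ->
  {ae mu, forall x, P x} -> {ae mu, forall x, Q x}.
Proof. by move=> PQ; apply: filterS. Qed.

Lemma ae_and (P Q : T -> Prop) : {ae mu, forall x, P x} -> {ae mu, forall x, Q x} ->
  {ae mu, forall x, P x /\ Q x}.
Proof. by move=> p q; apply: filterS2 p q => x; split. Qed.

(** A countable union of null sets is null; codes that decode to no index carry the trivial
    property. *)
Lemma ae_countable (I : countType) (P : I -> T -> Prop) :
  (forall i, {ae mu, forall x, P i x}) -> {ae mu, forall x, forall i, P i x}.
Proof.
move=> H; have : {ae mu, forall x, forall n : nat,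
    if @unpickle I n is Some i then P i x else True}.
  apply: ae_foralln => n; case: unpickle => [i|]; first exact: H.
  exact: aeW.
by apply: filterS => x Px i; have := Px (pickle i); rewrite pickleK.
Qed.

Definition L2 D f := measurable_fun D f /\ mu.-integrable D (EFin \o (fun x => f x ^+ 2)).

Lemma L2M D f g : measurable D -> L2 D f -> L2 D g ->
  mu.-integrable D (EFin \o (fun x => f x * g x)).
Proof.
move=> mD [mf fi] [mg gi].
apply: (@integrable_domination D _ (fun x => f x ^+ 2 + g x ^+ 2)) => //.
- exact: measurable_funM.
- move=> x _; rewrite normrM -(real_normK (num_real (f x))) -(real_normK (num_real (g x))).
  have := sqr_ge0 (`|f x| - `|g x|); have := normr_ge0 (f x); have := normr_ge0 (g x).
  nra.
- exact: integrableRD.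
Qed.

Lemma L2_cst D c : measurable D -> (mu D < +oo)%E -> L2 D (cst c).
Proof.
move=> mD Dfin; split; first exact: measurable_cst.
by apply/integrableP; split; [exact: (@measurable_cst _ _ _ _ D (c ^+ 2)%:E)|rewrite /= integral_cst// lte_mul_pinfty].
Qed.

Lemma L2_integrable D f : measurable D -> (mu D < +oo)%E -> L2 D f ->
  mu.-integrable D (EFin \o f).
Proof.
move=> mD Dfin f2; have := L2M mD f2 (L2_cst 1 mD Dfin).
by apply: eq_integrable => // x _ /=; rewrite mulr1.
Qed.

Lemma L2D D f g : measurable D -> L2 D f -> L2 D g -> L2 D (fun x => f x + g x).
Proof.
move=> mD f2 g2; have [mf fi] := f2; have [mg gi] := g2.
split; first exact: measurable_funD.
have := integrableRD mD (integrableRD mD fi (integrableRZ 2 mD (L2M mD f2 g2))) gi.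
by apply: eq_integrable => // x _ /=; congr EFin; ring.
Qed.

Lemma L2_bounded D f (k : T -> R) (M : R) : measurable D -> measurable_fun D k ->
  (forall x, D x -> `|k x| <= M) -> L2 D f -> L2 D (fun x => k x * f x).
Proof.
move=> mD mk kM [mf fi]; split; first exact: measurable_funM.
apply: (@integrable_domination D _ (fun x => M ^+ 2 * f x ^+ 2)) => //.
- by apply: measurable_funX; exact: measurable_funM.
- move=> x Dx; rewrite normrX normrM exprMn -(real_normK (num_real (f x))).
  apply: ler_wpM2r; first exact: exprn_ge0.
  by apply: lerXn2r; rewrite ?nnegrE//; [exact: le_trans (kM x Dx)|exact: kM].
- exact: integrableRZ.
Qed.

Lemma L2Z D f c : measurable D -> L2 D f -> L2 D (fun x => c * f x).
Proof.
move=> mD f2; apply: (@L2_bounded D f (cst c) `|c|) => //; exact: measurable_cst.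
Qed.

Lemma L2B D f g : measurable D -> L2 D f -> L2 D g -> L2 D (fun x => f x - g x).
Proof.
move=> mD f2 g2; have := L2D mD f2 (L2Z (-1) mD g2).
by under eq_fun do rewrite mulN1r.
Qed.

Lemma L2_ae D f g : measurable D -> measurable_fun D g ->
  {ae mu, forall x, D x -> f x = g x} -> L2 D f -> L2 D g.
Proof.
move=> mD mg fg [mf fi]; split => //.
apply: ae_integrable fi => //; first exact: measurable_funX.
by apply: filterS fg => x fg Dx; rewrite fg.
Qed.

Lemma L2_abs D f : measurable D -> L2 D f -> L2 D (fun x => `|f x|).
Proof.
move=> mD [mf fi]; split; first exact: measurableT_comp.
by apply: eq_integrable fi => // x _ /=; rewrite real_normK ?num_real.
Qed.

(** The quadratic form int (s f + t g)^2 is nonnegative; evaluated at (s, t) = (-c, a) it equals a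
    (a b - c^2). *)
Lemma cauchy_schwarz D f g : measurable D -> L2 D f -> L2 D g ->
  (\int[mu]_(x in D) (f x * g x)) ^+ 2 <=
  (\int[mu]_(x in D) f x ^+ 2) * (\int[mu]_(x in D) g x ^+ 2).
Proof.
move=> mD f2 g2; have [mf fi] := f2; have [mg gi] := g2; have fgi := L2M mD f2 g2.
set a := \int[mu]_(x in D) f x ^+ 2; set b := \int[mu]_(x in D) g x ^+ 2.
set c := \int[mu]_(x in D) (f x * g x).
have Q (s t : R) : 0 <= s ^+ 2 * a + 2 * (s * t) * c + t ^+ 2 * b.
  rewrite -!RintegralZl// -!RintegralD//; first by apply: Rintegral_ge0 => x _;
      rewrite (_ : _ + _ = (s * f x + t * g x) ^+ 2) ?sqr_ge0//; ring.
  - by apply: integrableRD => //; exact: integrableRZ.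
  - exact: integrableRZ.
  - exact: integrableRZ.
  - exact: integrableRZ.
have a0 : 0 <= a by apply: Rintegral_ge0 => x _; exact: sqr_ge0.
have b0 : 0 <= b by apply: Rintegral_ge0 => x _; exact: sqr_ge0.
have [a_eq0|a_neq0] := eqVneq a 0.
  rewrite a_eq0 mul0r.
  have [->|c0] := eqVneq c 0; first by rewrite expr0n.
  (* When a = 0 the form is affine in s for t = 1; this s would give it the value -(b + 1) + b =
     -1. *)
  have := Q (- (b + 1) / (2 * c)) 1.
  rewrite a_eq0 mulr0 add0r mulr1 expr1n mul1r.
  rewrite (_ : 2 * (- (b + 1) / (2 * c)) * c = - (b + 1)); first by lra.
  by field.
have ap : 0 < a by rewrite lt_neqAle eq_sym a_neq0.
have := Q (- c) a; rewrite (_ : _ + _ = a * (a * b - c ^+ 2)); last by ring.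
by rewrite pmulr_rge0// subr_ge0.
Qed.

End Integrals.

Arguments L2 {d T R} mu D f.

(** * Fubini's theorem on products of measurable sets *)

Section Fubini.
Context d1 d2 (T1 : measurableType d1) (T2 : measurableType d2) (R : realType).

Section order12.
Variables (m1 : {sigma_finite_measure set T1 -> \bar R})
  (m2 : {sigma_finite_measure set T2 -> \bar R}).
Implicit Types (f : T1 * T2 -> R).
Variables (D1 : set T1) (D2 : set T2) (mD1 : measurable D1) (mD2 : measurable D2).

Let mD : measurable (D1 `*` D2). Proof. exact: measurableX. Qed.

(** Extension by zero, to which Fubini's theorem on the whole product applies. *)
Let F f := EFin \o (f \_ (D1 `*` D2)).

Let FE f x : (fun y => F f (x, y)) =
  if x \in D1 then (EFin \o (fun y => f (x, y))) \_ D2 else cst 0%E.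
Proof.
apply/funext => y; rewrite /F /= /patch; case: ifPn.
  rewrite inE => -[/= xD yD]; rewrite mem_set// /patch mem_set//.
rewrite notin_setE /= => xy; case: ifPn => //; rewrite inE => xD.
by rewrite /patch memNset// => yD; apply: xy.
Qed.

Lemma integrable_prod (f : T1 -> R) (g : T2 -> R) : m1.-integrable D1 (EFin \o f) ->
  m2.-integrable D2 (EFin \o g) ->
  (m1 \x m2)%E.-integrable (D1 `*` D2) (EFin \o (fun z => f z.1 * g z.2)).
Proof.
move=> fi gi; apply: (integrable_patch _ _ _).2 => //.
have E z : ((fun z => f z.1 * g z.2) \_ (D1 `*` D2)) z = (f \_ D1) z.1 * (g \_ D2) z.2.
  rewrite /patch; case: z => x y /=.
  have [xD|xD] := boolP (x \in D1); last first.
    by rewrite mul0r memNset// => -[/= /mem_set]; rewrite (negbTE xD).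
  have [yD|yD] := boolP (y \in D2); first by rewrite mem_set//; split; rewrite -inE.
  by rewrite mulr0 memNset// => -[/= _ /mem_set]; rewrite (negbTE yD).
have mf : measurable_fun setT (f \_ D1).
  by apply/(measurable_restrictT f mD1); exact: integrable_measurable fi.
have mg : measurable_fun setT (g \_ D2).
  by apply/(measurable_restrictT g mD2); exact: integrable_measurable gi.
apply/integrable12ltyP.
  apply/measurable_EFinP; rewrite (funext E).
  by apply: measurable_funM; apply: measurableT_comp.
have i1 : m1.-integrable setT (EFin \o f \_ D1).
  by apply: (integrable_patch _ _ _).1.
have i2 : m2.-integrable setT (EFin \o g \_ D2).
  by apply: (integrable_patch _ _ _).1.
under eq_integral => x _.
  under eq_integral => y _ do rewrite /= E /= normrM EFinM.
  rewrite ge0_integralZl_EFin//; last first.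
    by apply: measurableT_comp => //; apply: measurableT_comp.
  over.
rewrite /=.
have /integrableP[_ f_lty] := i1; have /integrableP[mge g_lty] := i2.
rewrite ge0_integralZr//.
- by apply: lte_mul_pinfty => //; [exact: integral_ge0|rewrite ge0_fin_numE//; exact: integral_ge0].
- by apply: measurableT_comp => //; apply: measurableT_comp.
- exact: integral_ge0.
Qed.

Lemma Rfubini f : (m1 \x m2)%E.-integrable (D1 `*` D2) (EFin \o f) ->
  [/\ {ae m1, forall x, D1 x -> m2.-integrable D2 (EFin \o (fun y => f (x, y)))},
      m1.-integrable D1 (EFin \o (fun x => \int[m2]_(y in D2) f (x, y))) &
      \int[m1]_(x in D1) (\int[m2]_(y in D2) f (x, y)) =
      \int[(m1 \x m2)%E]_(z in D1 `*` D2) f z].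
Proof.
move=> fi; have iF : (m1 \x m2)%E.-integrable setT (F f).
  by apply: (integrable_patch _ _ _).1.
have ae1 : {ae m1, forall x, D1 x -> m2.-integrable D2 (EFin \o (fun y => f (x, y)))}.
  have := ae_integrable1 iF; apply: filterS => x + xD.
  by rewrite FE mem_set// => ?; apply/integrable_mkcond.
(* The real and the extended inner integrals are compared where the section is integrable, hence
   finite, that is for almost every x. *)
have FG : {ae m1, forall x, setT x -> ((fun x => \int[m2]_(y in D2) f (x, y)) \_ D1 x)%:E =
    fubini_F m2 (F f) x}.
  apply: filterS ae1 => x ix _; rewrite /fubini_F FE /patch.
  case: ifPn => xD; last by rewrite integral0.
  rewrite -integral_mkcond /Rintegral fineK//.
  by apply: integrable_fin_num => //; apply: ix; rewrite -inE.
have mF := integrable_fubini_F iF; have mF' := mF.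
have iG : m1.-integrable setT (EFin \o ((fun x => \int[m2]_(y in D2) f (x, y)) \_ D1)).
  have E : EFin \o ((fun x => \int[m2]_(y in D2) f (x, y)) \_ D1) =
      EFin \o (fine \o fubini_F m2 (F f)).
    apply/funext => x; rewrite /= /fubini_F FE /patch; congr EFin.
    by case: ifPn => xD; rewrite ?integral0// -integral_mkcond.
  rewrite E; apply: le_integrable mF => //.
    apply/measurable_EFinP; apply: measurableT_comp => //.
    exact: measurable_int mF'.
  by move=> x _ /=; case: (fubini_F m2 (F f) x) => [r||] //=; rewrite ?lee_fin ?normr0 ?leey.
split => //.
  by apply: (integrable_patch _ _ _).2 => //.
rewrite Rintegral_mkcond [RHS]Rintegral_mkcond /Rintegral; congr fine.
rewrite -[RHS](integral12_prod_meas1 iF).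
apply: ae_eq_integral => //; [exact: measurable_int iG|exact: measurable_int mF'].
Qed.

(** The measures of the sections of a null set are nonnegative and integrate to 0, so almost all of
    them vanish. *)
Lemma ae_prodP (P : T1 * T2 -> Prop) : {ae (m1 \x m2)%E, forall z, P z} ->
  {ae m1, forall x, {ae m2, forall y, P (x, y)}}.
Proof.
move=> [A [mA A0 PA]].
have [_ H] := ae_eq_integral_abs m1 measurableT (measurable_fun_xsection m2 mA).
have {H} : (\int[m1]_x `|(m2 \o xsection A) x| = 0)%E.
  by rewrite -A0; apply: eq_integral => x _; rewrite gee0_abs.
have [H _] := ae_eq_integral_abs m1 measurableT (measurable_fun_xsection m2 mA).
move=> /H; apply: filterS => x /(_ I) /= Ax0.
exists (xsection A x); split => //; first exact: measurable_xsection.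
by move=> y /= Pxy; rewrite /xsection /= inE; apply: PA.
Qed.

(** The measurability of [A] is what allows its measure to be computed as the integral of the
    measures of its sections. *)
Lemma prod_ae (A : set (T1 * T2)) : measurable A ->
  {ae m1, forall x, {ae m2, forall y, ~ A (x, y)}} ->
  {ae (m1 \x m2)%E, forall z, ~ A z}.
Proof.
move=> mA H; exists A; split => //; last by move=> z /= /contrapT.
have [_ ] := ae_eq_integral_abs m1 measurableT (measurable_fun_xsection m2 mA).
have -> : (m1 \x m2)%E A = (\int[m1]_x `|(m2 \o xsection A) x|)%E.
  by apply: eq_integral => x _; rewrite gee0_abs.
apply; apply: filterS H => x [N [mN N0 AN]] _ /=.
apply: (subset_measure0 _ mN _ N0); first exact: measurable_xsection.
by move=> y; rewrite /xsection /= inE => Axy; apply: AN => /=; exact.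
Qed.

(** The set where two measurable functions differ is measurable, so that [prod_ae] applies. Followed
    by [ae_prod_swap], this passes from almost every line in one direction to almost every line in
    the other. *)
Lemma prod_ae_eq f g : measurable_fun (D1 `*` D2) f -> measurable_fun (D1 `*` D2) g ->
  {ae m1, forall x, D1 x -> {ae m2, forall y, D2 y -> f (x, y) = g (x, y)}} ->
  {ae (m1 \x m2)%E, forall z, (D1 `*` D2) z -> f z = g z}.
Proof.
move=> mf mg H.
pose A := (D1 `*` D2) `&` [set z | f z != g z].
have mA : measurable A.
  have mB := measurable_funB mf mg.
  rewrite (_ : A = (D1 `*` D2) `&` (f \- g) @^-1` ~` [set 0]).
    by apply: mB => //; apply: measurableC; exact: measurable_set1.
  apply/seteqP; split => z [zD /=] fg; split => //=.
    by move=> /eqP; rewrite subr_eq0; exact/negP.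
  by apply/eqP => fg'; apply: fg; rewrite fg' subrr.
have : {ae m1, forall x, {ae m2, forall y, ~ A (x, y)}}.
  apply: filterS H => x H.
  have [xD|xD] := pselect (D1 x); last by apply: aeW => y [[/= ]].
  by apply: filterS (H xD) => y E [[/= _ yD]]; rewrite E// eqxx.
move=> /(prod_ae mA); apply: filterS => z nA zD.
by apply/eqP/negPn/negP => fg; apply: nA.
Qed.

End order12.

Section swap.
Variables (m1 : {sigma_finite_measure set T1 -> \bar R})
  (m2 : {sigma_finite_measure set T2 -> \bar R}).
Implicit Types (f : T1 * T2 -> R).

Lemma product_measure_swap (A : set (T1 * T2)) : measurable A ->
  (m1 \x m2)%E A = (m2 \x m1)%E (@unstable.swap T2 T1 @^-1` A).
Proof.
move=> mA; rewrite (@product_measure_unique _ _ _ _ _ m1 m2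
  (pushforward (m2 \x m1)%E (@unstable.swap T2 T1)))//.
  exact: measurable_swap.
move=> ms A1 A2 mA1 mA2.
have E : @unstable.swap T2 T1 @^-1` (A1 `*` A2) = A2 `*` A1.
  by apply/seteqP; split => -[y x] [].
change ((m2 \x m1)%E (@unstable.swap T2 T1 @^-1` (A1 `*` A2)) = (m1 A1 * m2 A2)%E).
by rewrite E product_measure1E// muleC.
Qed.

Lemma integrable_swap D1 D2 f : measurable D1 -> measurable D2 ->
  (m1 \x m2)%E.-integrable (D1 `*` D2) (EFin \o f) ->
  (m2 \x m1)%E.-integrable (D2 `*` D1) (EFin \o (fun z => f (z.2, z.1))).
Proof.
move=> mD1 mD2 fi.
have mD12 : measurable (D1 `*` D2) by exact: measurableX.
have mD21 : measurable (D2 `*` D1) by exact: measurableX.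
have iF : (m1 \x m2)%E.-integrable setT (EFin \o (f \_ (D1 `*` D2))).
  by apply: (integrable_patch _ _ _).1.
apply/integrable_mkcond => //.
rewrite (_ : _ \_ _ = (EFin \o (f \_ (D1 `*` D2))) \o @unstable.swap T2 T1); last first.
  apply/funext => -[y x]; rewrite /= /unstable.swap /= /patch.
  have [[yD xD]|n] := pselect ((D2 `*` D1) (y, x)).
    by rewrite !mem_set//; split.
  by rewrite !memNset// => -[? ?]; apply: n; split.
have mF := measurable_int _ iF.
apply/integrable12ltyP.
  by apply: measurableT_comp mF _; exact: measurable_swap.
have /integrable12ltyP := iF; move=> /(_ mF) ?.
rewrite -(fubini_tonelli (fun z => `|(EFin \o f \_ (D1 `*` D2)) z|)%E)//.
by apply: measurableT_comp.
Qed.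

End swap.

End Fubini.

Section FubiniSwap.
Context d1 d2 (T1 : measurableType d1) (T2 : measurableType d2) (R : realType).
Variables (m1 : {sigma_finite_measure set T1 -> \bar R})
  (m2 : {sigma_finite_measure set T2 -> \bar R}).
Variables (D1 : set T1) (D2 : set T2) (mD1 : measurable D1) (mD2 : measurable D2).
Implicit Types (f : T1 * T2 -> R).

Lemma Rfubini_swap f : (m1 \x m2)%E.-integrable (D1 `*` D2) (EFin \o f) ->
  [/\ {ae m2, forall y, D2 y -> m1.-integrable D1 (EFin \o (fun x => f (x, y)))},
      m2.-integrable D2 (EFin \o (fun y => \int[m1]_(x in D1) f (x, y))) &
      \int[m2]_(y in D2) (\int[m1]_(x in D1) f (x, y)) =
      \int[(m1 \x m2)%E]_(z in D1 `*` D2) f z].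
Proof.
move=> fi; have fi' := integrable_swap mD1 mD2 fi.
have [h1 h2 h3] := Rfubini mD2 mD1 fi'; split => //.
rewrite h3.
have mD12 : measurable (D1 `*` D2) by exact: measurableX.
have mD21 : measurable (D2 `*` D1) by exact: measurableX.
have iF : (m1 \x m2)%E.-integrable setT (EFin \o (f \_ (D1 `*` D2))).
  by apply: (integrable_patch _ _ _).1.
have iF' : (m2 \x m1)%E.-integrable setT (EFin \o ((fun z => f (z.2, z.1)) \_ (D2 `*` D1))).
  by apply: (integrable_patch _ _ _).1.
rewrite [LHS]Rintegral_mkcond [RHS]Rintegral_mkcond /Rintegral; congr fine.
rewrite -(integral12_prod_meas1 iF') -(integral21_prod_meas1 iF).
apply: eq_integral => y _; rewrite /fubini_F /fubini_G; apply: eq_integral => x _ /=.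
congr EFin; rewrite /patch.
have [[yD xD]|n] := pselect ((D2 `*` D1) (y, x)).
  by rewrite !mem_set//; split.
by rewrite !memNset// => -[? ?]; apply: n; split.
Qed.

Lemma ae_prod_swap (P : T1 * T2 -> Prop) : {ae (m1 \x m2)%E, forall z, P z} ->
  {ae m2, forall y, {ae m1, forall x, P (x, y)}}.
Proof.
move=> [A [mA A0 PA]]; apply: (@ae_prodP _ _ _ _ _ m2 m1 (fun z => P (z.2, z.1))).
exists (@unstable.swap T2 T1 @^-1` A); split.
- by rewrite -[_ @^-1` _]setTI; apply: measurable_swap.
- by rewrite -product_measure_swap.
- by move=> [y x] /= nP; apply: PA.
Qed.

End FubiniSwap.

(** * Absolutely continuous functions *)

Section Segments.
Context {R : realType}.
Notation mu := (@lebesgue_measure R).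
Notation RM := (measurableTypeR R).
Implicit Types (a b x : R) (f g h F G : R -> R).

Lemma measurable_RM (i : interval R) : @measurable _ RM [set` i].
Proof. exact: measurable_itv. Qed.

Lemma integrable_oo_cc a b f :
  mu.-integrable `]a, b[ (EFin \o f) <-> mu.-integrable `[a, b] (EFin \o f).
Proof.
split; last by apply: integrableS => //; exact: subset_itv_oo_cc.
move=> fi; have mf := integrable_measurable fi.
have mf' : measurable_fun `[a, b] f by exact: measurable_fun_itv_cc mf.
apply/integrableP; split; first exact/measurable_EFinP.
have mfe : measurable_fun `]a, b[ (fun x => `|(EFin \o f) x|)%E.
  by apply: measurableT_comp => //; exact/measurable_EFinP.
have mfe' : measurable_fun `[a, b[ (fun x => `|(EFin \o f) x|)%E.
  by apply/emeasurable_fun_itv_obnd_cbndP.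
rewrite -integral_itv_bndo_bndc//.
by rewrite -integral_itv_obnd_cbnd//; case/integrableP : fi.
Qed.

Lemma Rintegral_oo_cc a b f : measurable_fun `]a, b[ f ->
  \int[mu]_(x in `]a, b[) f x = \int[mu]_(x in `[a, b]) f x.
Proof.
move=> mf; have mfe : measurable_fun `]a, b[ (EFin \o f) by exact/measurable_EFinP.
have mfe' : measurable_fun `[a, b[ (EFin \o f).
  by apply/emeasurable_fun_itv_obnd_cbndP.
by rewrite /Rintegral -integral_itv_bndo_bndc// -integral_itv_obnd_cbnd.
Qed.

Lemma integrable_suboo a b c d f : a <= c -> d <= b ->
  mu.-integrable `]a, b[ (EFin \o f) -> mu.-integrable `]c, d[ (EFin \o f).
Proof.
move=> ac db; apply: integrableS => //; apply: subset_itv; by rewrite bnd_simp.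
Qed.

Lemma Rintegral_split a x b f : a <= x <= b ->
  mu.-integrable `]a, b[ (EFin \o f) ->
  \int[mu]_(s in `]a, b[) f s = \int[mu]_(s in `]a, x[) f s + \int[mu]_(s in `]x, b[) f s.
Proof.
move=> /andP[ax xb] fi.
have f1 := integrable_suboo (lexx a) xb fi.
have f2 := integrable_suboo ax (lexx b) fi.
rewrite !Rintegral_oo_cc; [|exact: integrable_measurable f2|exact: integrable_measurable f1|exact: integrable_measurable fi].
apply/esym/eqP; rewrite eq_sym addrC -subr_eq; apply/eqP.
rewrite Rintegral_itvB.
- rewrite Rintegral_itv_obnd_cbnd//.
  by apply: integrableS ((integrable_oo_cc x b f).1 f2) => //; apply: subset_itvr; rewrite bnd_simp.
- exact/integrable_oo_cc.
- by rewrite bnd_simp.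
- by rewrite bnd_simp.
Qed.

Lemma Rintegral_oo_eq0 a f : \int[mu]_(s in `]a, a[) f s = 0.
Proof. by rewrite set_itvoo0 Rintegral_set0. Qed.

(** Absolute continuity in integral form, with the density [f] as part of the data. The identity is
    required at every point of the closed interval, so [F a] and [F b] are genuine boundary
    values. *)
Definition AC a b F f := mu.-integrable `]a, b[ (EFin \o f) /\
  forall x, a <= x <= b -> F x = F a + \int[mu]_(s in `]a, x[) f s.

Lemma AC_increment a b F f : a <= b -> AC a b F f ->
  \int[mu]_(s in `]a, b[) f s = F b - F a.
Proof. by move=> ab [_ H]; rewrite (H b) ?ab ?lexx// addrAC subrr add0r. Qed.

Lemma AC_primitive a b f : mu.-integrable `]a, b[ (EFin \o f) ->
  AC a b (fun x => \int[mu]_(s in `]a, x[) f s) f.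
Proof. by move=> fi; split => // x _; rewrite Rintegral_oo_eq0 add0r. Qed.

Lemma AC_bounded a b F f : AC a b F f ->
  exists M : R, forall x, a <= x <= b -> `|F x| <= M.
Proof.
move=> [fi FE]; exists (`|F a| + \int[mu]_(s in `]a, b[) `|f s|) => x axb.
have /andP[ax xb] := axb.
rewrite FE//; apply: le_trans (ler_normD _ _) _; rewrite lerD2l.
have fi' := integrable_suboo (lexx a) xb fi.
apply: (le_trans (le_normr_Rintegral _ fi')) => //.
rewrite (@Rintegral_split a x b)//; last exact: integrableR_abs.
by rewrite lerDl Rintegral_ge0.
Qed.

Lemma AC_continuous a b F f : a <= b -> AC a b F f -> {within `[a, b], continuous F}.
Proof.
move=> ab [fi FE].
have fi' := (integrable_oo_cc a b f).1 fi.
have := parameterized_integral_continuous ab fi' => C.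
have C1 : {within `[a, b], continuous (fun x => F a + parameterized_integral mu a x f)}.
  by move=> x; apply: cvgD; [exact: cvg_cst|exact: C].
apply: subspace_eq_continuous C1 => x; rewrite inE /= in_itv/= => axb.
change (F a + parameterized_integral mu a x f = F x).
rewrite (FE x axb) /parameterized_integral Rintegral_oo_cc//.
have /andP[_ xb] := axb.
exact: integrable_measurable (integrable_suboo (lexx a) xb fi).
Qed.

Lemma AC_measurable a b F f : AC a b F f -> measurable_fun `]a, b[ F.
Proof.
move=> FA; have [ab|ba] := leP a b; last first.
  by rewrite set_itv_ge// -?leNgt ?bnd_simp ?ltW//; exact: measurable_fun_set0.
apply: (@measurable_funS _ _ _ _ `[a, b]) => //; first exact: subset_itv_oo_cc.
by apply: subspace_continuous_measurable_fun => //; exact: AC_continuous FA.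
Qed.

Lemma AC_mul_integrable a b F f g : AC a b F f ->
  mu.-integrable `]a, b[ (EFin \o g) ->
  mu.-integrable `]a, b[ (EFin \o (fun x => F x * g x)).
Proof.
move=> FA gi; have [M FM] := AC_bounded FA.
apply: (@integrable_domination _ _ _ mu _ _ (fun x => M * `|g x|)) => //.
- by apply: measurable_funM; [exact: AC_measurable FA|exact: integrable_measurable gi].
- move=> x /=; rewrite in_itv/= => /andP[ax xb].
  by rewrite normrM ler_wpM2r// FM// !ltW.
- by apply: integrableRZ => //; exact: integrableR_abs.
Qed.

Lemma AC_integrable a b F f : AC a b F f -> mu.-integrable `]a, b[ (EFin \o F).
Proof.
move=> FA.
have c1 : mu.-integrable `]a, b[ (EFin \o cst (1 : R)).
  apply/integrableP; split; first exact: (@measurable_cst _ _ _ _ _ 1%:E).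
  have -> : (fun x => `|(EFin \o cst (1%R : R)) x|)%E = cst 1%E.
    by apply/funext => x /=; rewrite normr1.
  rewrite integral_cst// mul1e /= lebesgue_measure_itv/=; by case: ifP; rewrite ?ltry.
have := AC_mul_integrable FA c1; apply: eq_integrable => // x _ /=.
by rewrite mulr1.
Qed.

Lemma AC_D a b F f G g : AC a b F f -> AC a b G g ->
  AC a b (fun x => F x + G x) (fun x => f x + g x).
Proof.
move=> [fi FE] [gi GE]; split; first exact: integrableRD.
move=> x axb; have /andP[ax xb] := axb.
rewrite RintegralD//; [|exact: integrable_suboo fi|exact: integrable_suboo gi].
by rewrite FE// GE//; ring.
Qed.

Lemma AC_Z a b F f c : AC a b F f -> AC a b (fun x => c * F x) (fun x => c * f x).
Proof.
move=> [fi FE]; split; first exact: integrableRZ.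
move=> x axb; have /andP[ax xb] := axb.
by rewrite RintegralZl//; [rewrite FE// mulrDr|exact: integrable_suboo fi].
Qed.

Lemma AC_cst a b c : AC a b (cst c) (cst 0).
Proof.
split; last first.
  by move=> x _; rewrite /Rintegral integral0_eq//= ?addr0.
by apply/integrableP; split; [exact: (@measurable_cst _ _ _ _ _ 0%E)|rewrite integral0_eq//= => x _; rewrite normr0].
Qed.

Let triangle : set (RM * RM) := [set z | z.1 < z.2].

Let measurable_triangle : measurable triangle.
Proof.
have : measurable_fun setT (fun z : RM * RM => z.2 - z.1 : RM).
  by apply: measurable_funB; [exact: measurable_snd|exact: measurable_fst].
move=> /(_ measurableT `]0, +oo[%classic (measurable_itv _)); rewrite setTI.
congr measurable; apply/seteqP; split => z /=; rewrite in_itv/= andbT subr_gt0//.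
Qed.

(** Fubini on the square cut along its diagonal: on one triangle the inner integral is a primitive
    of [f], on the other a primitive of [g]. This yields integration by parts for densities that are
    merely integrable. *)
Lemma primitiveM a b f g : a <= b -> mu.-integrable `]a, b[ (EFin \o f) ->
  mu.-integrable `]a, b[ (EFin \o g) ->
  (\int[mu]_(s in `]a, b[) f s) * (\int[mu]_(s in `]a, b[) g s) =
  \int[mu]_(x in `]a, b[) ((\int[mu]_(s in `]a, x[) f s) * g x +
                            f x * \int[mu]_(s in `]a, x[) g s).
Proof.
move=> ab fi gi; set D : set R := `]a, b[%classic.
have mD : @measurable _ RM D by exact: measurable_itv.
have Pf := AC_primitive fi; have Pg := AC_primitive gi.
have hi := integrable_prod mD mD fi gi.
pose h1 (z : RM * RM) := \1_triangle z * (f z.1 * g z.2).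
pose h2 (z : RM * RM) := \1_(~` triangle) z * (f z.1 * g z.2).
have mDD : measurable (D `*` D : set (RM * RM)) by exact: measurableX.
have mh := integrable_measurable hi.
have h1i : (mu \x mu)%E.-integrable (D `*` D) (EFin \o h1).
  apply: (integrable_domination mDD _ _ (integrableR_abs mDD hi)).
    by apply: measurable_funM => //; exact: measurable_indic.
  move=> z _ /=; rewrite normrM ler_piMl// indicE; case: (_ \in _) => /=; by rewrite ?normr1 ?normr0.
have h2i : (mu \x mu)%E.-integrable (D `*` D) (EFin \o h2).
  apply: (integrable_domination mDD _ _ (integrableR_abs mDD hi)).
    by apply: measurable_funM => //; apply: measurable_indic; exact: measurableC.
  move=> z _ /=; rewrite normrM ler_piMl// indicE; case: (_ \in _) => /=; by rewrite ?normr1 ?normr0.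
have sub x : D x -> `]a, x[ `<=` D.
  by rewrite /D /= in_itv/= => /andP[_ xb]; apply: subset_itvl; rewrite bnd_simp ltW.
rewrite RintegralD//; last 2 first.
  exact: AC_mul_integrable Pf gi.
  by have := AC_mul_integrable Pg fi; apply: eq_integrable => // x _ /=; rewrite mulrC.
have [_ _ E0] := Rfubini mD mD hi.
have -> : (\int[mu]_(s in D) f s) * (\int[mu]_(s in D) g s) =
    \int[(mu \x mu)%E]_(z in D `*` D) (f z.1 * g z.2).
  rewrite -E0 -RintegralZr//; apply: eq_Rintegral => x _.
  by rewrite /= RintegralZl.
have -> : \int[(mu \x mu)%E]_(z in D `*` D) (f z.1 * g z.2) =
   \int[(mu \x mu)%E]_(z in D `*` D) h1 z + \int[(mu \x mu)%E]_(z in D `*` D) h2 z.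
  rewrite -RintegralD//; apply: eq_Rintegral => z _.
  by rewrite /h1 /h2 !indicE in_setC -mulrDl; case: (_ \in _); rewrite /= ?addr0 ?add0r mul1r.
have [_ _ <-] := Rfubini_swap mD mD h1i.
have [_ _ <-] := Rfubini mD mD h2i.
congr (_ + _); apply: eq_Rintegral => x; rewrite inE => xD.
- have -> : \int[mu]_(s in `]a, x[) f s = \int[mu]_(s in D) (f \_ [set s | s < x]) s.
    rewrite -Rintegral_mkcondr; congr Rintegral; apply/seteqP; split => s /=.
      by move=> sx; split; [exact: sub sx|move: sx; rewrite in_itv/= => /andP[]].
    by move=> []; rewrite /D /= !in_itv/= => /andP[-> _].
  rewrite -RintegralZr//; last first.
    have m : measurable [set s : R | s < x].
      by rewrite (_ : mkset _ = `]-oo, x[%classic)//; apply/seteqP; split => s /=; rewrite in_itv.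
    apply: (integrable_domination mD _ _ (integrableR_abs mD fi)).
      by apply/measurable_restrict => //; apply: measurable_funS (integrable_measurable fi).
    by move=> s _ /=; rewrite /patch; case: ifP; rewrite ?normr0.
  apply: eq_Rintegral => s _; rewrite /h1 indicE /patch /= mulrA; congr (_ * _).
  have [sx|sx] := boolP (s < x); first by rewrite !mem_set//= mul1r.
  by rewrite !memNset//= ?mul0r//; exact/negP.
(* The complement of the strict triangle contains the diagonal, hence the large inequality; the
   extra endpoint is null. *)
- have m : measurable [set s : R | s <= x].
    by rewrite (_ : mkset _ = `]-oo, x]%classic)//; apply/seteqP; split => s /=; rewrite in_itv.
  have -> : \int[mu]_(s in `]a, x[) g s = \int[mu]_(s in D) (g \_ [set s | s <= x]) s.
    have gi' : mu.-integrable `]a, x[ (EFin \o g) by apply: integrableS gi => //; exact: sub.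
    rewrite -Rintegral_mkcondr (@Rintegral_itv_bndo_bndc _ (BRight a))//.
    congr Rintegral; apply/seteqP; split => s /=.
      rewrite /D /= !in_itv/= => /andP[as_ sx]; rewrite as_ sx; split => //.
      by move: xD; rewrite /D /= in_itv/= => /andP[_]; exact: le_lt_trans.
    by move=> []; rewrite /D /= !in_itv/= => /andP[-> _].
  rewrite -RintegralZl//; last first.
    apply: (integrable_domination mD _ _ (integrableR_abs mD gi)).
      by apply/measurable_restrict => //; apply: measurable_funS (integrable_measurable gi).
    by move=> s _ /=; rewrite /patch; case: ifP; rewrite ?normr0.
  apply: eq_Rintegral => s _; rewrite /h2 indicE /patch /= mulrCA; congr (_ * _).
  have [sx|sx] := boolP (s <= x).
    by rewrite !mem_set//= ?mul1r//; apply/negP; rewrite -leNgt.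
  have xs : x < s by rewrite ltNge.
  rewrite (@memNset _ (~` triangle)) ?mul0r; last by move=> /=; apply.
  by rewrite memNset ?mulr0//; exact/negP.
Qed.

Lemma AC_M a b F f G g : AC a b F f -> AC a b G g ->
  AC a b (fun x => F x * G x) (fun x => F x * g x + G x * f x).
Proof.
move=> FA GA; have [fi FE] := FA; have [gi GE] := GA.
have Fgi := AC_mul_integrable FA gi; have Gfi := AC_mul_integrable GA fi.
split; first exact: integrableRD.
move=> x axb; have /andP[ax xb] := axb.
have fi' := integrable_suboo (lexx a) xb fi.
have gi' := integrable_suboo (lexx a) xb gi.
have M := primitiveM ax fi' gi'.
have Pf := AC_primitive fi'; have Pg := AC_primitive gi'.
rewrite (FE x)// (GE x)// mulrDl !mulrDr M -!addrA; congr (_ + _).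
have -> : \int[mu]_(s in `]a, x[) (F s * g s + G s * f s) =
   \int[mu]_(s in `]a, x[) (F a * g s + G a * f s +
     ((\int[mu]_(r in `]a, s[) f r) * g s + f s * \int[mu]_(r in `]a, s[) g r)).
  apply: eq_Rintegral => s; rewrite inE /= in_itv/= => /andP[as_ sx].
  have asb : a <= s <= b by rewrite (ltW as_) (le_trans (ltW sx) xb).
  rewrite (FE s asb) (GE s asb).
  move: (\int[mu]_(r in `]a, s[) f r) (\int[mu]_(r in `]a, s[) g r) => P Q.
  by ring.
have i1 := integrableRZ (F a) (measurable_RM _) gi'.
have i2 := integrableRZ (G a) (measurable_RM _) fi'.
have i3 := AC_mul_integrable Pf gi'.
have i4 : mu.-integrable `]a, x[ (EFin \o (fun s => f s * \int[mu]_(r in `]a, s[) g r)).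
  by have := AC_mul_integrable Pg fi'; apply: eq_integrable => // s _ /=; rewrite mulrC.
rewrite [RHS]RintegralD//; last 2 first.
  exact: (integrableRD (measurable_RM _) i1 i2).
  exact: (integrableRD (measurable_RM _) i3 i4).
rewrite [X in _ = X + _]RintegralD// !RintegralZl//.
set P := \int[mu]_(s in `]a, x[) f s; set Q := \int[mu]_(s in `]a, x[) g s.
set I := Rintegral _ _ _.
by rewrite addrA [P * _]mulrC.
Qed.

Lemma AC_derive a b F f : a <= b -> (forall x, a <= x <= b -> is_derive x (1 : R) F (f x)) ->
  {within `[a, b], continuous f} -> AC a b F f.
Proof.
move=> ab dF cf.
have fi' : mu.-integrable `[a, b] (EFin \o f).
  by apply: continuous_compact_integrable => //; exact: segment_compact.
split; first exact/integrable_oo_cc.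
move=> x /andP[ax xb].
move: ax; rewrite le_eqVlt => /predU1P[<-|ax]; first by rewrite Rintegral_oo_eq0 addr0.
have sub : `[a, x] `<=` `[a, b] by apply: subset_itvl; rewrite bnd_simp.
have mf : measurable_fun `]a, x[ f.
  by apply: measurable_funS (integrable_measurable fi') => //; apply: subset_trans sub; exact: subset_itv_oo_cc.
have cF y : a <= y <= b -> {for y, continuous F}.
  by move=> /dF[dy _]; apply: differentiable_continuous; apply/derivable1_diffP.
rewrite Rintegral_oo_cc// /Rintegral (@continuous_FTC2 _ f F)//=.
- by rewrite addrCA subrr addr0.
- exact: continuous_subspaceW cf.
- split.
  + move=> y; rewrite in_itv/= => /andP[ay yx].
    by have [|] := dF y; rewrite ?(ltW ay) ?(le_trans (ltW yx)).
  + by apply: cvg_at_right_filter; apply: cF; rewrite lexx.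
  + by apply: cvg_at_left_filter; apply: cF; rewrite xb ltW.
- move=> y; rewrite in_itv/= => /andP[ay yx].
  by rewrite derive1E; have [|_ ->] := dF y; rewrite ?(ltW ay) ?(le_trans (ltW yx)).
Qed.

End Segments.

(** * Weak derivatives on a line *)

Section Fundamental.
Context {R : realType}.
Notation mu := (@lebesgue_measure R).
Notation RM := (measurableTypeR R).
Implicit Types (a b c x : R) (f g h F G : R -> R).

(** At a Lebesgue point of [h] extended by zero the primitive has derivative [h x], while by
    hypothesis this primitive is 0 in a neighbourhood. *)
Lemma primitive_eq0_ae a b h : mu.-integrable `]a, b[ (EFin \o h) ->
  (forall x, a < x < b -> \int[mu]_(s in `]a, x[) h s = 0) ->
  {ae mu, forall x, `]a, b[%classic x -> h x = 0}.
Proof.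
move=> hi H; set D : set R := `]a, b[%classic.
have hl : locally_integrable setT (h \_ D) by apply: integrable_locally hi; exact: measurable_itv.
move: (lebesgue_differentiation hl); apply: (@ae_imp _ _ _ mu) => x lx.
rewrite /D /= in_itv/= => /andP[ax xb].
have hDi : mu.-integrable [set` Interval (BRight a) (BRight b)] (EFin \o (h \_ D)).
  apply: (@integrableS _ _ _ mu setT) => //.
  exact: ((integrable_patch mu h (measurable_RM `]a, b[)).1 hi).
have axB : (BRight a < BRight x :> itv_bound R)%O by rewrite bnd_simp.
have [dF vF] := FTC1_lebesgue_pt xb hDi axB lx.
have -> : h x = (h \_ D) x by rewrite patchE mem_set// /D /= in_itv/= ax.
rewrite -vF derive1E.
set Fh := fun y : R => _.
suff D0 : is_derive x (1 : R) Fh 0 by case: D0.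
apply: near_eq_is_derive (is_derive_cst (0 : R) x (1 : R)).
near=> y; apply/esym; rewrite /Fh /=.
have ay : a < y by near: y; exact: lt_nbhsr.
have yb : y < b by near: y; exact: lt_nbhsl.
transitivity (\int[mu]_(s in `]a, y[) h s); last by apply: H; rewrite ay.
rewrite (@Rintegral_itv_bndo_bndc _ (BRight a) y h); last first.
  by apply: integrable_suboo hi => //; exact: ltW.
apply: eq_Rintegral => s; rewrite inE /= in_itv/= => /andP[as_ sy].
by rewrite patchE mem_set// /D /= in_itv/= as_ (le_lt_trans sy).
Unshelve. all: by end_near. Qed.

Lemma flat0_ge (u : R) : 0 < u -> 1 - u^-1 <= flat 0 u.
Proof. by move=> u0; rewrite /flat u0 expr0 mul1r; exact: expR_ge1Dx. Qed.

Lemma flat0_seq_cvg (k : nat -> R) (u : R) : 0 < u ->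
  (\forall n \near \oo, n.+1%:R * u <= k n) -> flat 0 (k n) @[n --> \oo] --> (1 : R).
Proof.
move=> u0 H.
apply: (@squeeze_cvgr _ _ _ _ (fun n => 1 - harmonic n * u^-1) (cst 1)).
- near=> n.
  have kn : n.+1%:R * u <= k n by near: n.
  have nu : 0 < n.+1%:R * u by rewrite mulr_gt0.
  rewrite flat0_le1 andbT; apply: le_trans (flat0_ge (lt_le_trans nu kn)).
  rewrite lerD2l lerN2 -invfM; by rewrite lef_pV2 ?posrE// (lt_le_trans nu).
- rewrite -[X in _ --> X]subr0 -(mul0r u^-1).
  by apply: cvgB; [exact: cvg_cst|apply: cvgM; [exact: cvg_harmonic|exact: cvg_cst]].
- exact: cvg_cst.
Unshelve. all: by end_near. Qed.

Lemma bump_seq_cvg (p q : nat -> R) c x t : p n @[n --> \oo] --> c -> q n @[n --> \oo] --> x ->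
  c < t < x -> bump (p n) (q n) n t @[n --> \oo] --> (1 : R).
Proof.
move=> pc qx /andP[ct tx]; rewrite -[X in _ --> X]mulr1; apply: cvgM.
- apply: (@flat0_seq_cvg _ ((t - c) / 2)); first by rewrite divr_gt0// subr_gt0.
  near=> n; rewrite mulNr -mulrBr ler_pM2l//.
  have : p n < (c + t) / 2.
    by near: n; apply: (cvgr_lt c) => //; rewrite ltr_pdivlMr//; lra.
  lra.
- apply: (@flat0_seq_cvg _ ((x - t) / 2)); first by rewrite divr_gt0// subr_gt0.
  near=> n; rewrite [leRHS]addrC mulNr -mulrBr ler_pM2l//.
  have : (x + t) / 2 < q n.
    by near: n; apply: (cvgr_gt x) => //; rewrite ltr_pdivrMr//; lra.
  lra.
Unshelve. all: by end_near. Qed.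

(** Arbitrary intervals are reached from inside by rational ones, so that testing on rational
    endpoints loses nothing. *)
Lemma rational_sandwich a b : a < b -> exists pq : nat -> rat * rat,
  [/\ forall n, [/\ a < ratr (pq n).1, (ratr (pq n).1 : R) < ratr (pq n).2 & ratr (pq n).2 < b],
    (ratr (pq n).1 : R) @[n --> \oo] --> a & (ratr (pq n).2 : R) @[n --> \oo] --> b].
Proof.
move=> ab; pose e (n : nat) : R := harmonic n * ((b - a) / 2).
have e0 n : 0 < e n by rewrite mulr_gt0 ?invr_gt0 ?divr_gt0// subr_gt0.
have e1 n : e n <= (b - a) / 2.
  rewrite ler_piMl//; first by rewrite divr_ge0// subr_ge0 ltW.
  by rewrite invf_le1// ler1n.
have ex n : exists pq : rat * rat, (a < ratr pq.1 < a + e n) && (b - e n < ratr pq.2 < b).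
  have [|p] := @rat_in_itvoo R a (a + e n); first by rewrite ltrDl.
  have [|q] := @rat_in_itvoo R (b - e n) b; first by rewrite ltrBlDr ltrDl.
  by rewrite !in_itv/= => hq hp; exists (p, q); rewrite hp hq.
have [pq Hpq] := choice ex; exists pq.
have ecvg : e n @[n --> \oo] --> (0 : R).
  by rewrite -(mul0r ((b - a) / 2)); apply: cvgM; [exact: cvg_harmonic|exact: cvg_cst].
split.
- move=> n; have := Hpq n => /andP[/andP[? ?] /andP[? ?]]; split => //.
  have := e1 n; lra.
- apply: (@squeeze_cvgr _ _ _ _ (cst a) (fun n => a + e n)).
  + by apply: nearW => n; have := Hpq n => /andP[/andP[? ?] _]; rewrite !ltW.
  + exact: cvg_cst.
  + by rewrite -[X in _ --> X]addr0; apply: cvgD => //; exact: cvg_cst.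
- apply: (@squeeze_cvgr _ _ _ _ (fun n => b - e n) (cst b)).
  + by apply: nearW => n; have := Hpq n => /andP[_ /andP[? ?]]; rewrite !ltW.
  + by rewrite -[X in _ --> X]subr0; apply: cvgB => //; exact: cvg_cst.
  + exact: cvg_cst.
Qed.

Lemma measurable_line_smooth f (D : set R) : @measurable _ RM D -> line_smooth f ->
  measurable_fun D f.
Proof.
move=> mD sf; apply: measurable_funTS; apply: continuous_measurable_fun.
exact: line_smooth_continuous.
Qed.

(** Rational bumps squeezed inside ]a, x[ converge to its indicator and are bounded by 1; dominated
    convergence then makes every primitive of [h] from a vanish. The hypothesis involves countably
    many test functions only. *)
Lemma fundamental_lemma a b h : mu.-integrable `]a, b[ (EFin \o h) ->
  (forall (p q : rat) n, a < ratr p -> (ratr p : R) < ratr q -> ratr q < b ->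
    \int[mu]_(s in `]a, b[) (h s * bump (ratr p) (ratr q) n s) = 0) ->
  {ae mu, forall x, `]a, b[%classic x -> h x = 0}.
Proof.
move=> hi H; apply: (primitive_eq0_ae hi) => x /andP[ax xb].
have [pq [Hpq pc qc]] := rational_sandwich ax.
pose k n (s : RM) : \bar R := (h s * bump (ratr (pq n).1) (ratr (pq n).2) n s)%:E.
have mD := measurable_RM `]a, b[.
have mh := integrable_measurable hi.
have mk n : measurable_fun (`]a, b[ : set RM) (k n).
  apply/measurable_EFinP; apply: measurable_funM => //.
  by apply: measurable_line_smooth => //; exact: bump_smooth.
have subx : `]a, x[ `<=` `]a, b[ by apply: subset_itvl; rewrite bnd_simp ltW.
have ml : measurable_fun (`]a, b[ : set RM) (EFin \o (h \_ `]a, x[)).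
  apply/measurable_EFinP; apply/measurable_restrict => //.
  by apply: measurable_funS mh => //; exact: subIsetl.
have kl : {ae mu, forall s, `]a, b[%classic s -> k n s @[n --> \oo] --> (EFin \o (h \_ `]a, x[)) s}.
  apply: aeW => s sD; apply: cvg_EFin; first exact: nearW.
  rewrite /=; have -> : (h \_ `]a, x[) s = h s * \1_(`]a, x[) s.
    by rewrite patchE indicE; case: ifP; rewrite ?mulr1 ?mulr0.
  apply: cvgM; first exact: cvg_cst.
  have [asx|asx] := boolP (a < s < x).
    have -> : \1_(`]a, x[) s = 1 :> R by rewrite indicE mem_set//= in_itv.
    exact: bump_seq_cvg pc qc asx.
  have -> : \1_(`]a, x[) s = 0 :> R.
    by rewrite indicE memNset//= in_itv/=; exact/negP.
  rewrite (_ : (fun n => _) = cst 0); first exact: cvg_cst.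
  apply/funext => n; apply: bump_out; apply: contra asx => /andP[ps sq].
  by have [pa _ qx] := Hpq n; rewrite (lt_trans pa ps) (lt_trans sq qx).
have kd : {ae mu, forall s, forall n, `]a, b[%classic s -> (`|k n s| <= (fun s => `|h s|%:E) s)%E}.
  apply: aeW => s n _ /=; rewrite lee_fin normrM ler_piMr//.
  by rewrite ger0_norm ?bump_ge0// bump_le1.
have ih : mu.-integrable `]a, b[ (fun s => `|h s|%:E) by exact: integrableR_abs.
have [_ _ C] := dominated_convergence mD mk ml kl ih kd.
have k0 n : (\int[mu]_(s in `]a, b[) k n s)%E = 0%E.
  have [pa pq' qx] := Hpq n.
  have := H (pq n).1 (pq n).2 n pa pq' (lt_trans qx xb).
  rewrite /Rintegral => E; rewrite -[LHS]fineK ?E//.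
  apply: integrable_fin_num => //.
  apply: (@le_integrable _ _ _ mu _ mD (k n) (fun s => `|h s|%:E) (mk n) _ ih) => s _.
  by rewrite /= normr_id lee_fin normrM ler_piMr// ger0_norm ?bump_ge0// bump_le1.
have {}C : (\int[mu]_(s in `]a, b[) (EFin \o (h \_ `]a, x[)) s)%E = 0%E.
  apply: (cvg_unique _ C) => //.
  rewrite (_ : (fun n => _) = cst 0%E); first exact: cvg_cst.
  by apply/funext => n; exact: k0.
rewrite (_ : `]a, x[%classic = `]a, b[ `&` `]a, x[).
  by rewrite Rintegral_mkcondr /Rintegral C.
by apply/esym/setIidPr.
Qed.

(** The integral starts at -oo so that the function is defined and differentiable on the whole line,
    as a test function must be. *)
Definition test_primitive (k : R -> R) x := \int[mu]_(s in `]-oo, x]) k s.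

(** Left of a nothing has been integrated yet; right of b the whole mean has, and the mean is 0. *)
Lemma test_primitive_test a b k : line_smooth k -> (forall x, ~~ (a < x < b) -> k x = 0) ->
  \int[mu]_(s in `]a, b[) k s = 0 -> a < b ->
  [/\ line_smooth (test_primitive k),
      (forall x, (test_primitive k)^`()%classic x = k x) &
      forall x, ~~ (a < x < b) -> test_primitive k x = 0].
Proof.
move=> sk k0 ik ab.
have ck := line_smooth_continuous sk.
have ki0 : mu.-integrable `]a, b[ (EFin \o k).
  apply/integrable_oo_cc; apply: continuous_compact_integrable; first exact: segment_compact.
  exact: continuous_subspaceT.
have ki : mu.-integrable setT (EFin \o k).
  have := (integrable_patch mu k (measurable_RM `]a, b[)).1 ki0.
  apply: eq_integrable => // s _ /=; congr EFin; rewrite patchE; case: ifPn => //.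
  by rewrite notin_setE /= in_itv/= => /negP/k0.
have Dk x : is_derive x (1 : R) (test_primitive k) (k x).
  have kx : mu.-integrable [set` Interval -oo%O (BRight (x + 1))] (EFin \o k).
    by apply: integrableS ki => //; exact: measurable_RM.
  have x1 : x < x + 1 by rewrite ltrDl.
  have [|dF vF] := continuous_FTC1 x1 kx _ (ck x); first exact: ltNyr.
  by rewrite derive1E in vF; exact: (DeriveDef dF vF).
split.
- exact: line_smooth_primitive Dk sk.
- by move=> x; rewrite derive1E; case: (Dk x).
- move=> x; rewrite negb_and -!leNgt => /orP[xa|bx].
    rewrite /test_primitive /Rintegral integral0_eq// => s /=; rewrite in_itv/= => sx.
    by rewrite k0// negb_and -!leNgt (le_trans sx xa).
  have E : k \_ `]-oo, x] = k \_ `]a, b[.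
    apply/funext => s; rewrite !patchE.
    have [asb|asb] := boolP (a < s < b).
      rewrite !mem_set //= in_itv//=.
      by have /andP[_ sb] := asb; rewrite ltW// (lt_le_trans sb).
    by rewrite (k0 _ asb) !if_same.
  by rewrite /test_primitive Rintegral_mkcond E -Rintegral_mkcond.
Qed.

End Fundamental.

(** * Traces on almost every line *)

Section Tonelli.
Context d1 d2 (T1 : measurableType d1) (T2 : measurableType d2) (R : realType).
Variables (m1 : {sigma_finite_measure set T1 -> \bar R})
  (m2 : {sigma_finite_measure set T2 -> \bar R}).
Variables (D1 : set T1) (D2 : set T2) (mD1 : measurable D1) (mD2 : measurable D2).

Let mD : measurable (D1 `*` D2). Proof. exact: measurableX. Qed.

Lemma measurable_section (f : T1 * T2 -> R) x : D1 x -> measurable_fun (D1 `*` D2) f ->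
  measurable_fun D2 (fun y => f (x, y)).
Proof.
move=> xD mf; apply/(measurable_restrictT _ mD2).
have : measurable_fun setT (fun y => (f \_ (D1 `*` D2)) (x, y)).
  by apply: measurable_fun_pair2; apply/(measurable_restrictT f mD).
congr measurable_fun; apply/funext => y; rewrite !patchE.
have [yD|yD] := boolP (y \in D2).
  by rewrite mem_set//; split => //; rewrite -inE.
by rewrite memNset// => -[_ /mem_set]; rewrite (negbTE yD).
Qed.

Lemma L2_section (f : T1 * T2 -> R) : L2 (m1 \x m2)%E (D1 `*` D2) f ->
  {ae m1, forall x, D1 x -> L2 m2 D2 (fun y => f (x, y))}.
Proof.
move=> [mf fi]; have [H _ _] := Rfubini mD1 mD2 fi.
apply: filterS H => x H xD; split; first exact: measurable_section.
exact: H.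
Qed.

Section nonneg.
Variable F : T1 * T2 -> \bar R.
Hypotheses (mF : measurable_fun (D1 `*` D2) F) (F0 : forall z, (0 <= F z)%E).

Let mF0 : measurable_fun setT (F \_ (D1 `*` D2)).
Proof. exact/(measurable_restrictT F mD). Qed.

Let F00 z : (0 <= (F \_ (D1 `*` D2)) z)%E.
Proof. by rewrite patchE; case: ifP. Qed.

Let sectionE : (fun x => \int[m2]_y (F \_ (D1 `*` D2)) (x, y))%E =
  ((fun x => \int[m2]_(y in D2) F (x, y)) \_ D1)%E.
Proof.
apply/funext => x; rewrite patchE; case: ifPn => xD.
  rewrite [RHS]integral_mkcond; apply: eq_integral => y _; rewrite !patchE.
  have [yD|yD] := boolP (y \in D2).
    by rewrite mem_set//; split; rewrite -inE.
  by rewrite memNset// => -[_ /mem_set]; rewrite (negbTE yD).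
rewrite integral0_eq// => y _; rewrite patchE memNset// => -[/mem_set].
by rewrite (negbTE xD).
Qed.

Lemma tonelli_measurable : measurable_fun D1 (fun x => \int[m2]_(y in D2) F (x, y))%E.
Proof.
apply/(measurable_restrictT _ mD1); rewrite -sectionE.
exact: (measurable_fun_fubini_tonelli_F _ mF0).
Qed.

Lemma tonelli_rect : (\int[(m1 \x m2)%E]_(z in D1 `*` D2) F z =
  \int[m1]_(x in D1) \int[m2]_(y in D2) F (x, y))%E.
Proof.
rewrite integral_mkcond fubini_tonelli1// [RHS]integral_mkcond -sectionE.
exact: eq_integral.
Qed.

Lemma tonelli_rect_swap : (\int[(m1 \x m2)%E]_(z in D1 `*` D2) F z =
  \int[m2]_(y in D2) \int[m1]_(x in D1) F (x, y))%E.
Proof.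
rewrite integral_mkcond fubini_tonelli1// (fubini_tonelli (F \_ (D1 `*` D2)))//.
rewrite [RHS]integral_mkcond; apply: eq_integral => y _; rewrite patchE.
case: ifPn => yD.
  rewrite [RHS]integral_mkcond; apply: eq_integral => x _; rewrite !patchE.
  have [xD|xD] := boolP (x \in D1).
    by rewrite mem_set//; split; rewrite -inE.
  by rewrite memNset// => -[/mem_set]; rewrite (negbTE xD).
rewrite integral0_eq// => x _; rewrite patchE memNset// => -[_ /mem_set].
by rewrite (negbTE yD).
Qed.

End nonneg.

End Tonelli.

(** The pointwise infimum of the [G n] lies below each of them, so its integral is 0 and it vanishes
    almost everywhere. The index may depend on the point, which is enough for the approximation
    argument on a line. *)
Lemma integral_cvg0_ae d (T : measurableType d) (R : realType)
    (mu : {measure set T -> \bar R}) (D : set T) (G : nat -> T -> \bar R) :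
  measurable D -> (forall n, measurable_fun D (G n)) -> (forall n x, (0 <= G n x)%E) ->
  (\int[mu]_(x in D) G n x)%E @[n --> \oo] --> 0%E ->
  {ae mu, forall x, D x -> forall e : R, 0 < e -> exists n, (G n x < e%:E)%E}.
Proof.
move=> mD mG G0 cG; pose g x := einfs (fun n => G n x) 0.
have mg : measurable_fun D g by exact: measurable_fun_einfs.
have g0 x : (0 <= g x)%E by apply: le_ereal_inf_tmp => _ [n _ <-].
have gG n x : (g x <= G n x)%E by apply: ereal_inf_lbound; exists n.
have ig : (\int[mu]_(x in D) g x = 0)%E.
  apply/eqP; rewrite eq_le integral_ge0// andbT.
  rewrite -(cvg_lim (@ereal_hausdorff R) cG); apply: lime_ge; first exact: cvgP cG.
  apply: nearW => n.
  by apply: ge0_le_integral => // x _; exact: gG.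
have [H _] := ae_eq_integral_abs mu mD mg.
have {}ig : (\int[mu]_(x in D) `|g x| = 0)%E.
  by rewrite -ig; apply: eq_integral => x _; rewrite gee0_abs.
have := H ig; apply: filterS => x gx xD e e0.
have : (ereal_inf (sdrop (fun n => G n x) 0) < e%:E)%E.
  by change (g x < e%:E)%E; rewrite gx// lte_fin.
by move=> /ereal_inf_lt[_ [n _ <-] ?]; exists n.
Qed.

Section TraceLine.
Context {R : realType}.
Notation mu := (@lebesgue_measure R).
Notation RM := (measurableTypeR R).

Lemma Rintegral_itv_cst a b (c : R) : a <= b -> \int[mu]_(x in `]a, b[) c = c * (b - a).
Proof.
move=> ab; rewrite (@Rintegral_cst _ _ _ mu _ (measurable_RM `]a, b[)).
congr (_ * _); rewrite /= lebesgue_measure_itv/= lte_fin.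
by case: ltP => //= ba; apply/esym/eqP; rewrite subr_eq0 eq_le ab ba.
Qed.

Lemma itv_finite (a b : R) : (mu `]a, b[ < +oo)%E.
Proof. by rewrite lebesgue_measure_itv/=; case: ifP; rewrite ?ltry. Qed.

Lemma L1_le_L2 a b (h : R -> R) : a <= b -> L2 mu `]a, b[ h ->
  \int[mu]_(x in `]a, b[) `|h x| <=
  Num.sqrt (b - a) * Num.sqrt (\int[mu]_(x in `]a, b[) h x ^+ 2).
Proof.
move=> ab h2; have mD := measurable_RM `]a, b[.
have h2' := L2_abs mD h2; have c2 := L2_cst 1 mD (itv_finite a b).
have := cauchy_schwarz mD h2' c2.
have -> : \int[mu]_(x in `]a, b[) (`|h x| * cst 1 x) = \int[mu]_(x in `]a, b[) `|h x|.
  by apply: eq_Rintegral => x _; rewrite mulr1.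
have -> : \int[mu]_(x in `]a, b[) `|h x| ^+ 2 = \int[mu]_(x in `]a, b[) h x ^+ 2.
  by apply: eq_Rintegral => x _; rewrite real_normK ?num_real.
have -> : \int[mu]_(x in `]a, b[) (cst 1 x) ^+ 2 = b - a.
  by rewrite -[RHS]mul1r -Rintegral_itv_cst//; apply: eq_Rintegral => x _; rewrite expr1n.
move=> H; rewrite -sqrtrM ?subr_ge0// mulrC.
rewrite -[leLHS]ger0_norm; last exact: Rintegral_ge0.
by rewrite -sqrtr_sqr; exact: ler_wsqrtr.
Qed.

Let trace_line_arith (A1 A2 s sb w : R) : A1 <= sb * s -> A2 <= sb * s -> 0 <= w ->
  A1 + (s + 2 * A2) * w <= (sb * (1 + 2 * w) + w) * s.
Proof. by move=> h1 h2 w0; have := ler_wpM2r w0 h2; lra. Qed.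

(** Let [F] be the primitive of [v'] that vanishes at e. Then phi n - F is phi n e plus two
    integrals of phi' n - v', so |v - F| is at most |v - phi n| + |phi n e| + 2 int |v' - phi' n|.
    Integrating in x bounds the L^1 distance from v to F by quantities as small as desired. *)
Lemma trace_line a b e (v v' : R -> R) (phi phi' : nat -> R -> R) :
  a < b -> a <= e <= b -> L2 mu `]a, b[ v -> L2 mu `]a, b[ v' ->
  (forall n, L2 mu `]a, b[ (phi n)) -> (forall n, L2 mu `]a, b[ (phi' n)) ->
  (forall n, AC a b (phi n) (phi' n)) ->
  (forall d, 0 < d -> exists n,
     \int[mu]_(x in `]a, b[) (v x - phi n x) ^+ 2 +
     \int[mu]_(x in `]a, b[) (v' x - phi' n x) ^+ 2 + phi n e ^+ 2 < d) ->
  {ae mu, forall x, `]a, b[%classic x ->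
     v x = \int[mu]_(s in `]a, x[) v' s - \int[mu]_(s in `]a, e[) v' s}.
Proof.
move=> ab /andP[ae eb] v2 v'2 p2 p'2 pAC H.
have mD := measurable_RM `]a, b[; have fD := itv_finite a b.
have vi := L2_integrable mD fD v2; have v'i := L2_integrable mD fD v'2.
pose F x := \int[mu]_(s in `]a, x[) v' s - \int[mu]_(s in `]a, e[) v' s.
have FA : AC a b F v'.
  have := AC_D (AC_primitive v'i) (AC_cst a b (- \int[mu]_(s in `]a, e[) v' s)).
  by congr AC; apply/funext => x; rewrite ?addr0.
have Fi := AC_integrable FA.
have Hi := integrableRB mD vi Fi.
suff H0 : \int[mu]_(x in `]a, b[) `|v x - F x| = 0.
  move: (Rintegral0_ae mD Hi H0); apply: (@ae_imp _ _ _ mu) => x vx xD.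
  by apply/eqP; rewrite -subr_eq0 vx.
have ba0 : 0 <= b - a by rewrite subr_ge0 ltW.
(* The factors sqrt(b - a) come from passing from L^1 to L^2 norms, the factors b - a from
   integrating constants over the interval. *)
pose C := Num.sqrt (b - a) * (1 + 2 * (b - a)) + (b - a).
have C0 : 0 <= C by rewrite addr_ge0// mulr_ge0 ?sqrtr_ge0// addr_ge0// mulr_ge0.
apply/eqP; rewrite eq_le Rintegral_ge0 ?andbT//; apply/ler_addgt0Pr => d d0; rewrite add0r.
(* Squared, because the bound is C sqrt(G); dividing by C + 1 keeps the denominator positive. *)
have [|n Gn] := H ((d / (C + 1)) ^+ 2).
  by rewrite exprn_gt0// divr_gt0// ltr_wpDl.
set G := (X in X < _) in Gn.
have w2 := L2B mD v2 (p2 n); have w'2 := L2B mD v'2 (p'2 n).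
have wi := L2_integrable mD fD w2; have w'i := L2_integrable mD fD w'2.
have G1 : 0 <= \int[mu]_(x in `]a, b[) (v x - phi n x) ^+ 2.
  by apply: Rintegral_ge0 => x _; exact: sqr_ge0.
have G2 : 0 <= \int[mu]_(x in `]a, b[) (v' x - phi' n x) ^+ 2.
  by apply: Rintegral_ge0 => x _; exact: sqr_ge0.
have G3 := sqr_ge0 (phi n e).
have sG : Num.sqrt G <= d / (C + 1).
  rewrite -[leRHS]ger0_norm; last by rewrite divr_ge0 ?ltW// ltr_wpDl.
  by rewrite -sqrtr_sqr; apply: ler_wsqrtr; exact: ltW.
have B1 : \int[mu]_(x in `]a, b[) `|v x - phi n x| <= Num.sqrt (b - a) * Num.sqrt G.
  apply: (le_trans (L1_le_L2 (ltW ab) w2)); apply: ler_wpM2l; first exact: sqrtr_ge0.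
  by apply: ler_wsqrtr; rewrite /G -addrA lerDl addr_ge0.
set A2 := \int[mu]_(x in `]a, b[) `|v' x - phi' n x|.
have B2 : A2 <= Num.sqrt (b - a) * Num.sqrt G.
  apply: (le_trans (L1_le_L2 (ltW ab) w'2)); apply: ler_wpM2l; first exact: sqrtr_ge0.
  by apply: ler_wsqrtr; rewrite /G addrAC lerDr addr_ge0.
have B3 : `|phi n e| <= Num.sqrt G by rewrite -sqrtr_sqr; apply: ler_wsqrtr; rewrite /G lerDr addr_ge0.
have [p'i pE] := pAC n.
have bnd y : a <= y <= b -> `|\int[mu]_(s in `]a, y[) (phi' n s - v' s)| <= A2.
  move=> /andP[ay yb].
  have i1 := integrable_suboo (lexx a) yb (integrableRB mD p'i v'i).
  apply: (le_trans (le_normr_Rintegral (measurable_RM _) i1)).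
  rewrite /A2 (@Rintegral_split _ a y b) ?ay ?yb//; last exact: integrableR_abs.
  rewrite ler_wpDr ?Rintegral_ge0//.
  by under eq_Rintegral do rewrite distrC.
have pt x : `]a, b[%classic x -> `|v x - F x| <= `|v x - phi n x| + (Num.sqrt G + 2 * A2).
  rewrite /= in_itv/= => /andP[/ltW ax /ltW xb].
  have split y : a <= y <= b -> \int[mu]_(s in `]a, y[) (phi' n s - v' s) =
      \int[mu]_(s in `]a, y[) phi' n s - \int[mu]_(s in `]a, y[) v' s.
    move=> /andP[ay yb].
    by rewrite (RintegralB (measurable_RM _) (integrable_suboo (lexx a) yb p'i) (integrable_suboo (lexx a) yb v'i)).
  have E : phi n x - F x = phi n e + \int[mu]_(s in `]a, x[) (phi' n s - v' s)
      - \int[mu]_(s in `]a, e[) (phi' n s - v' s).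
    rewrite !split ?ax ?ae// (pE x) ?ax// (pE e) ?ae// /F.
    move: (phi n a) (\int[mu]_(s in `]a, x[) phi' n s) (\int[mu]_(s in `]a, x[) v' s) (\int[mu]_(s in `]a, e[) phi' n s) (\int[mu]_(s in `]a, e[) v' s) => u1 u2 u3 u4 u5.
    by ring.
  have -> : v x - F x = (v x - phi n x) + (phi n x - F x) by ring.
  apply: (le_trans (ler_normD _ _)); rewrite lerD2l E.
  apply: (le_trans (ler_normB _ _)).
  rewrite mulr_natl mulr2n addrA; apply: lerD; last by apply: bnd; rewrite ae eb.
  apply: (le_trans (ler_normD _ _)); apply: lerD => //.
  by apply: bnd; rewrite ax xb.
have ci : mu.-integrable `]a, b[ (EFin \o cst (Num.sqrt G + 2 * A2)).
  exact: (L2_integrable mD fD (L2_cst _ mD fD)).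
have iabs := integrableR_abs mD wi.
apply: (@le_trans _ _ (\int[mu]_(x in `]a, b[) (`|v x - phi n x| + (Num.sqrt G + 2 * A2)))).
  apply: (le_Rintegral mD) => //; first exact: integrableR_abs.
  exact: (integrableRD mD iabs ci).
rewrite (RintegralD mD iabs ci) (Rintegral_itv_cst _ (ltW ab)).
have s0 := sqrtr_ge0 G; have sb0 := sqrtr_ge0 (b - a).
have CG : C * Num.sqrt G <= d.
  apply: (@le_trans _ _ (C * (d / (C + 1)))); first exact: ler_wpM2l.
  rewrite mulrA ler_pdivrMr ?ltr_wpDl// mulrDr mulr1 [C * d]mulrC lerDl ltW//.
apply: le_trans CG; rewrite /C.
exact: trace_line_arith.
Qed.

End TraceLine.

Section TraceParam.
Context {R : realType} d (T : measurableType d).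
Notation mu := (@lebesgue_measure R).
Notation RM := (measurableTypeR R).
Variables (m : {sigma_finite_measure set T -> \bar R}) (D : set T) (mD : measurable D).
Variables (a b e : R) (v v' : T * RM -> R) (phi phi' : nat -> T * RM -> R).
Let Q : set (T * RM) := D `*` `]a, b[.

(* Along a subsequence the three L^2 distances tend to 0 on almost every line,
   which fixes the constant of integration. *)
Lemma trace_param : a < b -> a <= e <= b -> L2 (m \x mu)%E Q v -> L2 (m \x mu)%E Q v' ->
  (forall n, L2 (m \x mu)%E Q (phi n)) -> (forall n, L2 (m \x mu)%E Q (phi' n)) ->
  (forall n z, D z -> AC a b (fun x => phi n (z, x)) (fun x => phi' n (z, x))) ->
  (forall n, measurable_fun D (fun z => phi n (z, e))) ->
  (\int[(m \x mu)%E]_(z in Q) ((v z - phi n z) ^+ 2)%:E)%E @[n --> \oo] --> 0%E ->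
  (\int[(m \x mu)%E]_(z in Q) ((v' z - phi' n z) ^+ 2)%:E)%E @[n --> \oo] --> 0%E ->
  (\int[m]_(z in D) ((phi n (z, e)) ^+ 2)%:E)%E @[n --> \oo] --> 0%E ->
  {ae m, forall z, D z -> {ae mu, forall x, `]a, b[%classic x ->
     v (z, x) = \int[mu]_(s in `]a, x[) v' (z, s) - \int[mu]_(s in `]a, e[) v' (z, s)}}.
Proof.
move=> ab aeb v2 v'2 p2 p'2 pAC mp c1 c2 c3.
have mI := measurable_RM `]a, b[.
pose F1 n (z : T * RM) := ((v z - phi n z) ^+ 2)%:E.
pose F2 n (z : T * RM) := ((v' z - phi' n z) ^+ 2)%:E.
have F1_ge0 n z : (0 <= F1 n z)%E by rewrite lee_fin sqr_ge0.
have F2_ge0 n z : (0 <= F2 n z)%E by rewrite lee_fin sqr_ge0.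
have mF1 n : measurable_fun Q (F1 n).
  by apply/measurable_EFinP; apply: measurable_funX; apply: measurable_funB;
    [case: v2|case: (p2 n)].
have mF2 n : measurable_fun Q (F2 n).
  by apply/measurable_EFinP; apply: measurable_funX; apply: measurable_funB;
    [case: v'2|case: (p'2 n)].
(* The three distances on the line over z, added up so that one index makes all of them small at
   once. *)
pose G n z := (\int[mu]_(x in `]a, b[) F1 n (z, x) + \int[mu]_(x in `]a, b[) F2 n (z, x)
   + (phi n (z, e) ^+ 2)%:E)%E.
have mG1 n := tonelli_measurable mu mD mI (mF1 n) (F1_ge0 n).
have mG2 n := tonelli_measurable mu mD mI (mF2 n) (F2_ge0 n).
have mG3 n : measurable_fun D (fun z => (phi n (z, e) ^+ 2)%:E).
  by apply/measurable_EFinP; exact: measurable_funX.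
have G1_ge0 n z : (0 <= \int[mu]_(x in `]a, b[) F1 n (z, x))%E by exact: integral_ge0.
have G2_ge0 n z : (0 <= \int[mu]_(x in `]a, b[) F2 n (z, x))%E by exact: integral_ge0.
have mG n : measurable_fun D (G n).
  by apply: emeasurable_funD => //; apply: emeasurable_funD.
have G_ge0 n z : (0 <= G n z)%E by apply: adde_ge0; [exact: adde_ge0|rewrite lee_fin sqr_ge0].
have cG : (\int[m]_(z in D) G n z)%E @[n --> \oo] --> 0%E.
  have -> : (fun n => \int[m]_(z in D) G n z)%E = (fun n =>
      (\int[(m \x mu)%E]_(z in Q) F1 n z + \int[(m \x mu)%E]_(z in Q) F2 n z
      + \int[m]_(z in D) ((phi n (z, e)) ^+ 2)%:E)%E).
    apply/funext => n.
    have h1 z : D z -> (0 <= \int[mu]_(x in `]a, b[) F1 n (z, x) +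
        \int[mu]_(x in `]a, b[) F2 n (z, x))%E by move=> _; exact: adde_ge0.
    have h2 := emeasurable_funD (mG1 n) (mG2 n).
    have h3 z : D z -> (0 <= (phi n (z, e) ^+ 2)%:E)%E by rewrite lee_fin sqr_ge0.
    rewrite /G ge0_integralD//.
    rewrite ge0_integralD// -(tonelli_rect m mu mD mI (mF1 n) (F1_ge0 n)).
    by rewrite -(tonelli_rect m mu mD mI (mF2 n) (F2_ge0 n)).
  rewrite -[X in _ --> X]adde0 -[X in _ --> (X + _)%E]adde0.
  by apply: cvgeD => //; apply: cvgeD.
have P := integral_cvg0_ae mD mG G_ge0 cG.
have Sv := L2_section mD mI v2; have Sv' := L2_section mD mI v'2.
have Sp : {ae m, forall z, forall n, D z -> L2 mu `]a, b[ (fun x => phi n (z, x))}.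
  by apply: ae_foralln => n; have h := L2_section mD mI (p2 n); exact: h.
have Sp' : {ae m, forall z, forall n, D z -> L2 mu `]a, b[ (fun x => phi' n (z, x))}.
  by apply: ae_foralln => n; have h := L2_section mD mI (p'2 n); exact: h.
have := ae_and P (ae_and (ae_and Sv Sv') (ae_and Sp Sp')).
apply: ae_imp => z [Pz [[Svz Sv'z] [Spz Sp'z]]] zD.
have {}Svz := Svz zD; have {}Sv'z := Sv'z zD.
have {}Spz n := Spz n zD; have {}Sp'z n := Sp'z n zD.
apply: (trace_line ab aeb Svz Sv'z Spz Sp'z) => [n|r r0]; first exact: pAC.
have [n Gn] := Pz zD r r0; exists n.
have i1 := L2B mI Svz (Spz n); have i2 := L2B mI Sv'z (Sp'z n).
rewrite -lte_fin !EFinD /Rintegral !fineK//.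
- by apply: integrable_fin_num => //; case: i2.
- by apply: integrable_fin_num => //; case: i1.
Qed.

End TraceParam.

(** * Absolute continuity from weak derivatives *)

Section WeakLine.
Context {R : realType}.
Notation mu := (@lebesgue_measure R).
Notation RM := (measurableTypeR R).

Lemma ae_itv_exists a b (P : R -> Prop) : a < b -> {ae mu, forall x, P x} ->
  exists2 x, a < x < b & P x.
Proof.
move=> ab [A [mA A0 PA]]; apply: contrapT => nP.
have sub : `]a, b[ `<=` A.
  move=> x; rewrite /= in_itv/= => axb; apply: PA => /= Px.
  by apply: nP; exists x.
have : (mu `]a, b[ <= mu A)%E.
  by apply: le_measure => //; rewrite inE//; exact: measurable_RM.
by rewrite A0 lebesgue_measure_itv/= lte_fin ab -EFinD lee_fin subr_le0 leNgt ab.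
Qed.

Lemma integrable_line_smooth a b k : line_smooth k -> mu.-integrable `]a, b[ (EFin \o k).
Proof.
move=> sk; apply/integrable_oo_cc; apply: continuous_compact_integrable.
  exact: segment_compact.
apply: continuous_subspaceT; exact: line_smooth_continuous.
Qed.

Lemma bounded_line_smooth a b k : line_smooth k ->
  exists M : R, forall x, a <= x <= b -> `|k x| <= M.
Proof.
move=> sk; have [ba|ab] := ltP b a.
  by exists 0 => x /andP[ax xb]; have := lt_le_trans ba (le_trans ax xb); rewrite ltxx.
apply: (@AC_bounded _ a b k (k^`())%classic); apply: AC_derive => //.
- move=> x _; apply: DeriveDef; first exact: line_smooth_derivable.
  by rewrite derive1E.
- apply: continuous_subspaceT; apply: line_smooth_continuous.
  exact: line_smooth_derive.
Qed.

Lemma integrable_mul_smooth a b f k : mu.-integrable `]a, b[ (EFin \o f) -> line_smooth k ->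
  mu.-integrable `]a, b[ (EFin \o (fun x => f x * k x)).
Proof.
move=> fi sk; have [M kM] := bounded_line_smooth a b sk.
have mD := measurable_RM `]a, b[.
apply: (integrable_domination mD (g := fun x => M * `|f x|)).
- by apply: measurable_funM; [exact: integrable_measurable fi|exact: measurable_line_smooth].
- move=> x /=; rewrite in_itv/= => /andP[ax xb].
  by rewrite normrM mulrC ler_wpM2r// kM// !ltW.
- by apply: integrableRZ => //; exact: integrableR_abs.
Qed.

Lemma Rintegral_support a b a' b' h : a <= a' -> b' <= b ->
  (forall x, ~~ (a' < x < b') -> h x = 0) ->
  \int[mu]_(x in `]a, b[) h x = \int[mu]_(x in `]a', b'[) h x.
Proof.
move=> aa' bb' h0; rewrite Rintegral_mkcond [RHS]Rintegral_mkcond; congr Rintegral.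
apply/funext => x; rewrite !patchE.
have [axb|/h0 ->] := boolP (a' < x < b'); last by rewrite !if_same.
by rewrite !mem_set//= in_itv//=; have /andP[? ?] := axb;
  rewrite (le_lt_trans aa')// (lt_le_trans _ bb').
Qed.

(** Living on the middle third, it has compact support inside ]a, b[. *)
Definition base_bump a b : R -> R := bump ((2 * a + b) / 3) ((a + 2 * b) / 3) 0.

(* The correction gives the bump zero mean, so that its primitive is again a
   test function. *)
Definition test_kernel a b p q n (s : R) : R := bump p q n s -
  (\int[mu]_(x in `]a, b[) bump p q n x) / (\int[mu]_(x in `]a, b[) base_bump a b x)
  * base_bump a b s.

Let thirds (a b : R) : a < b -> [/\ a < (2 * a + b) / 3, (2 * a + b) / 3 < (a + 2 * b) / 3
  & (a + 2 * b) / 3 < b].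
Proof. by move=> ab; split; lra. Qed.

Lemma base_bump_gt0 a b : a < b -> 0 < \int[mu]_(x in `]a, b[) base_bump a b x.
Proof.
move=> ab; have [h1 h2 h3] := thirds ab.
have mD := measurable_RM `]a, b[.
have ib : mu.-integrable `]a, b[ (EFin \o base_bump a b).
  by apply: integrable_line_smooth; exact: bump_smooth.
rewrite lt_neqAle Rintegral_ge0 ?andbT; last by move=> x _; exact: bump_ge0.
apply/eqP => /esym b0.
have : \int[mu]_(x in `]a, b[) `|base_bump a b x| = 0.
  by rewrite -b0; apply: eq_Rintegral => x _; rewrite ger0_norm// bump_ge0.
move=> /(Rintegral0_ae mD ib)/(ae_itv_exists h2)[x /[dup] xab /andP[x1 x2]] /(_ _).
have : `]a, b[%classic x by rewrite /= in_itv/= (lt_trans h1 x1) (lt_trans x2 h3).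
by move=> xD /(_ xD) /eqP; rewrite gt_eqF// bump_gt0.
Qed.

Lemma test_kernel_smooth a b p q n : line_smooth (test_kernel a b p q n).
Proof.
rewrite /test_kernel; set c := _ / _.
have -> : (fun s => bump p q n s - c * base_bump a b s) =
    bump p q n \+ (cst (- c) \* base_bump a b).
  by apply/funext => s /=; rewrite mulNr.
apply: line_smoothD; first exact: bump_smooth.
by apply: line_smoothM; [exact: line_smooth_cst|exact: bump_smooth].
Qed.

Lemma test_kernel_primitive a b p q n : a < p -> p < q -> q < b ->
  [/\ line_smooth (test_primitive (test_kernel a b p q n)),
      test_function `]a, b[ (test_primitive (test_kernel a b p q n)),
      (forall x, (test_primitive (test_kernel a b p q n))^`()%classic x = test_kernel a b p q n x)
    & forall x, ~~ (a < x < b) -> test_primitive (test_kernel a b p q n) x = 0].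
Proof.
move=> ap pq qb; have ab : a < b by rewrite (lt_trans ap) ?(lt_trans pq).
have [h1 h2 h3] := thirds ab.
(* The smallest interval containing the supports of both bumps; it stays strictly inside ]a, b[, so
   the primitive has compact support there. *)
set a' := Num.min p ((2 * a + b) / 3); set b' := Num.max q ((a + 2 * b) / 3).
have aa' : a < a' by rewrite lt_min ap h1.
have bb' : b' < b by rewrite gt_max qb h3.
have a'p : a' <= p by rewrite ge_min lexx.
have a'h : a' <= (2 * a + b) / 3 by rewrite ge_min lexx orbT.
have b'q : q <= b' by rewrite le_max lexx.
have b'h : (a + 2 * b) / 3 <= b' by rewrite le_max lexx orbT.
have a'b' : a' < b' by rewrite (le_lt_trans a'p)// (lt_le_trans pq).
have k0 x : ~~ (a' < x < b') -> test_kernel a b p q n x = 0.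
  move=> xab; rewrite /test_kernel /base_bump !bump_out ?mulr0 ?subr0//.
    by apply: contra xab => /andP[? ?]; rewrite (le_lt_trans a'h)// (lt_le_trans _ b'h).
  by apply: contra xab => /andP[? ?]; rewrite (le_lt_trans a'p)// (lt_le_trans _ b'q).
have ik : \int[mu]_(x in `]a', b'[) test_kernel a b p q n x = 0.
  rewrite -(Rintegral_support (ltW aa') (ltW bb') k0) /test_kernel.
  have i1 : mu.-integrable `]a, b[ (EFin \o bump p q n).
    by apply: integrable_line_smooth; exact: bump_smooth.
  have i2 : mu.-integrable `]a, b[ (EFin \o base_bump a b).
    by apply: integrable_line_smooth; exact: bump_smooth.
  have mD := measurable_RM `]a, b[.
  rewrite (RintegralB mD i1 (integrableRZ _ mD i2)) (RintegralZl _ mD i2) divfK ?subrr//.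
  by rewrite gt_eqF// base_bump_gt0.
have [s1 s2 s3] := test_primitive_test (test_kernel_smooth a b p q n) k0 ik a'b'.
split => //.
- split; first exact: line_smooth_smooth.
  exists `[a', b']%classic; split.
  + exact: segment_compact.
  + move=> x /=; rewrite !in_itv/= => /andP[? ?].
    by rewrite (lt_le_trans aa')// (le_lt_trans _ bb').
  + move=> x /negP; rewrite in_itv/= => H; apply: s3; apply: contra H => /andP[? ?].
    by rewrite !ltW.
- move=> x xab; apply: s3; apply: contra xab => /andP[? ?].
  by rewrite (lt_trans aa')// (lt_trans _ bb').
Qed.

(** The du Bois-Reymond argument: with G a primitive of g, f - G is orthogonal to all zero-mean
    kernels. Its integral against any bump is thus proportional to the mean of the bump, the factor
    c being its average against the normalized [base_bump]; so f - G - c is orthogonal to every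
    rational bump. *)
Lemma AC_of_weak a b f g : a < b -> mu.-integrable `]a, b[ (EFin \o f) ->
  mu.-integrable `]a, b[ (EFin \o g) ->
  (forall (p q : rat) n, a < ratr p -> (ratr p : R) < ratr q -> ratr q < b ->
    \int[mu]_(x in `]a, b[) (f x * test_kernel a b (ratr p) (ratr q) n x) =
    - \int[mu]_(x in `]a, b[) (g x * test_primitive (test_kernel a b (ratr p) (ratr q) n) x)) ->
  exists c, {ae mu, forall x, `]a, b[%classic x -> f x = c + \int[mu]_(s in `]a, x[) g s}.
Proof.
move=> ab fi gi H; have mD := measurable_RM `]a, b[.
pose G x := \int[mu]_(s in `]a, x[) g s.
have GA : AC a b G g := AC_primitive gi.
have Gi := AC_integrable GA.
have hi := integrableRB mD fi Gi.
pose c0 := \int[mu]_(x in `]a, b[) base_bump a b x.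
have c0_gt0 : 0 < c0 by exact: base_bump_gt0.
pose c := (\int[mu]_(x in `]a, b[) ((f x - G x) * base_bump a b x)) / c0.
exists c.
have ci : mu.-integrable `]a, b[ (EFin \o cst c).
  exact: (L2_integrable mD (itv_finite a b) (L2_cst _ mD (itv_finite a b))).
have Z : {ae mu, forall x, `]a, b[%classic x -> f x - G x - c = 0}.
  apply: fundamental_lemma; first exact: (integrableRB mD hi ci).
  move=> p q n ap pq qb.
  have [s1 s2 s3 s4] := test_kernel_primitive n ap pq qb.
  set k := test_kernel _ _ _ _ _ in s1 s2 s3 s4.
  have sk : line_smooth k by exact: test_kernel_smooth.
  have kA : AC a b (test_primitive k) k.
    apply: AC_derive; first exact: ltW.
      move=> x _; apply: DeriveDef; first exact: line_smooth_derivable.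
      by rewrite -derive1E s3.
    by apply: continuous_subspaceT; exact: line_smooth_continuous.
  (* This integrand is the density of the product of [G] and the test function, which vanishes at
     both ends. *)
  have E1 : \int[mu]_(x in `]a, b[) (G x * k x + test_primitive k x * g x) = 0.
    rewrite (AC_increment (ltW ab) (AC_M GA kA)).
    rewrite (s4 a) ?ltxx//= (s4 b) ?ltxx ?andbF//; by rewrite !mulr0 subrr.
  have iGk := integrable_mul_smooth Gi sk.
  have ikg := integrable_mul_smooth gi s1.
  have ifk := integrable_mul_smooth fi sk.
  have E2 : \int[mu]_(x in `]a, b[) ((f x - G x) * k x) = 0.
    have -> : \int[mu]_(x in `]a, b[) ((f x - G x) * k x) =
       \int[mu]_(x in `]a, b[) (f x * k x - G x * k x).
      by apply: eq_Rintegral => x _; rewrite mulrBl.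
    rewrite (RintegralB mD ifk iGk) (H p q n ap pq qb) -/k.
    have -> : \int[mu]_(x in `]a, b[) (G x * k x) = - \int[mu]_(x in `]a, b[) (g x * test_primitive k x).
      apply/eqP; rewrite -addr_eq0 -(RintegralD mD iGk ikg); apply/eqP.
      by rewrite -[RHS]E1; apply: eq_Rintegral => x _; rewrite [g x * _]mulrC.
    by rewrite subrr.
  have sb : @line_smooth R (bump (ratr p : R) (ratr q) n) by exact: bump_smooth.
  have sbb : line_smooth (base_bump a b) by exact: bump_smooth.
  have i1 := integrable_mul_smooth hi sb.
  have i2 := integrable_mul_smooth hi sbb.
  have i3 := integrable_line_smooth a b sb.
  set m := \int[mu]_(x in `]a, b[) bump (ratr p) (ratr q) n x.
  have E3 : \int[mu]_(x in `]a, b[) ((f x - G x) * bump (ratr p) (ratr q) n x) = m * c.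
    have := E2.
    have -> : \int[mu]_(x in `]a, b[) ((f x - G x) * k x) = \int[mu]_(x in `]a, b[)
        ((f x - G x) * bump (ratr p) (ratr q) n x - (m / c0) * ((f x - G x) * base_bump a b x)).
      apply: eq_Rintegral => x _; rewrite /k /test_kernel mulrBr; congr (_ - _).
      by rewrite mulrCA.
    rewrite (RintegralB mD i1 (integrableRZ _ mD i2)) (RintegralZl _ mD i2) => /eqP.
    by rewrite subr_eq0 => /eqP ->; rewrite /c; rewrite mulrAC mulrA.
  have -> : \int[mu]_(x in `]a, b[) ((f x - G x - c) * bump (ratr p) (ratr q) n x) =
     \int[mu]_(x in `]a, b[) ((f x - G x) * bump (ratr p) (ratr q) n x - c * bump (ratr p) (ratr q) n x).
    by apply: eq_Rintegral => x _; rewrite mulrBl.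
  rewrite (RintegralB mD i1 (integrableRZ _ mD i3)) (RintegralZl _ mD i3) E3 -/m.
  by rewrite mulrC subrr.
move: Z; apply: (@ae_imp _ _ _ mu) => x H' /H'.
by move=> /eqP; rewrite -addrA -opprD subr_eq0 addrC => /eqP.
Qed.

End WeakLine.

Section WeakParam.
Context {R : realType} d (T : measurableType d).
Notation mu := (@lebesgue_measure R).
Notation RM := (measurableTypeR R).
Variables (m : {sigma_finite_measure set T -> \bar R}) (D : set T) (mD : measurable D).
Variables (a b : R).
Implicit Types f g h : T * RM -> R.
Let Q : set (T * RM) := D `*` `]a, b[.

(** The null set of parameters in the hypothesis depends on the test function. The kernels needed by
    [AC_of_weak] are indexed by two rationals and an integer, so one null set serves them all. *)
Lemma AC_of_weak_param f g : a < b -> (m \x mu)%E.-integrable Q (EFin \o f) ->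
  (m \x mu)%E.-integrable Q (EFin \o g) ->
  (forall k, line_smooth k -> test_function `]a, b[ k -> {ae m, forall z, D z ->
     \int[mu]_(x in `]a, b[) (f (z, x) * k^`()%classic x) =
     - \int[mu]_(x in `]a, b[) (g (z, x) * k x)}) ->
  {ae m, forall z, D z -> exists c, {ae mu, forall x, `]a, b[%classic x ->
     f (z, x) = c + \int[mu]_(s in `]a, x[) g (z, s)}}.
Proof.
move=> ab fi gi H; have mI := measurable_RM `]a, b[.
have [fs _ _] := Rfubini mD mI fi; have [gs _ _] := Rfubini mD mI gi.
pose P (i : rat * rat * nat) (z : T) := D z -> a < ratr i.1.1 -> (ratr i.1.1 : R) < ratr i.1.2 ->
  ratr i.1.2 < b ->
  \int[mu]_(x in `]a, b[) (f (z, x) * test_kernel a b (ratr i.1.1) (ratr i.1.2) i.2 x) =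
    - \int[mu]_(x in `]a, b[) (g (z, x) * test_primitive (test_kernel a b (ratr i.1.1) (ratr i.1.2) i.2) x).
have HP : {ae m, forall z, forall i, P i z}.
  apply: ae_countable => -[[p q] n]; rewrite /P /=.
  have [ap|nap] := pselect (a < ratr p); last by apply: aeW => z _ /nap.
  have [pq|npq] := pselect ((ratr p : R) < ratr q); last by apply: aeW => z _ _ /npq.
  have [qb|nqb] := pselect (ratr q < b); last by apply: aeW => z _ _ _ /nqb.
  have [s1 s2 s3 s4] := test_kernel_primitive n ap pq qb.
  have := H _ s1 s2; apply: filterS => z Hz zD _ _ _; rewrite -Hz//.
  by apply: eq_Rintegral => x _; rewrite s3.
have := ae_and HP (ae_and fs gs); apply: filterS => z [Pz [fz gz]] zD.
apply: (AC_of_weak ab (fz zD) (gz zD)) => p q n ap pq qb.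
exact: (Pz (p, q, n)).
Qed.

Lemma fundamental_param h : (m \x mu)%E.-integrable Q (EFin \o h) ->
  (forall (p q : rat) n, a < ratr p -> (ratr p : R) < ratr q -> ratr q < b ->
    {ae m, forall z, D z -> \int[mu]_(x in `]a, b[) (h (z, x) * bump (ratr p) (ratr q) n x) = 0}) ->
  {ae m, forall z, D z -> {ae mu, forall x, `]a, b[%classic x -> h (z, x) = 0}}.
Proof.
move=> hi H; have mI := measurable_RM `]a, b[.
have [hs _ _] := Rfubini mD mI hi.
pose P (i : rat * rat * nat) (z : T) := D z -> a < ratr i.1.1 -> (ratr i.1.1 : R) < ratr i.1.2 ->
  ratr i.1.2 < b ->
  \int[mu]_(x in `]a, b[) (h (z, x) * bump (ratr i.1.1) (ratr i.1.2) i.2 x) = 0.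
have HP : {ae m, forall z, forall i, P i z}.
  apply: ae_countable => -[[p q] n]; rewrite /P /=.
  have [ap|nap] := pselect (a < ratr p); last by apply: aeW => z _ /nap.
  have [pq|npq] := pselect ((ratr p : R) < ratr q); last by apply: aeW => z _ _ /npq.
  have [qb|nqb] := pselect (ratr q < b); last by apply: aeW => z _ _ _ /nqb.
  by have := H p q n ap pq qb; apply: filterS => z Hz zD _ _ _; exact: Hz.
have := ae_and HP hs; apply: filterS => z [Pz hz] zD.
apply: (fundamental_lemma (hz zD)) => p q n ap pq qb.
exact: (Pz (p, q, n)).
Qed.

End WeakParam.

Section MulBounded.
Context d (T : measurableType d) (R : realType) (m : {measure set T -> \bar R}).

Lemma integrable_mul_bounded (D : set T) (f k : T -> R) (M : R) : measurable D ->
  measurable_fun D k -> (forall x, D x -> `|k x| <= M) ->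
  m.-integrable D (EFin \o f) -> m.-integrable D (EFin \o (fun x => f x * k x)).
Proof.
move=> mD mk kM fi; apply: (integrable_domination mD (g := fun x => M * `|f x|)).
- by apply: measurable_funM => //; exact: integrable_measurable fi.
- by move=> x xD; rewrite normrM mulrC ler_wpM2r// kM.
- by apply: integrableRZ => //; exact: integrableR_abs.
Qed.

Lemma ae_domination (D : set T) (f g : T -> R) : measurable D -> measurable_fun D f ->
  {ae m, forall x, D x -> `|f x| <= g x} -> m.-integrable D (EFin \o g) ->
  m.-integrable D (EFin \o f).
Proof.
move=> mD mf fg gi; apply/integrableP; split; first exact/measurable_EFinP.
have gai := integrableR_abs mD gi.
have /integrableP[mga gfin] := gai.
apply: (le_lt_trans _ gfin); apply: ae_ge0_le_integral => //.
- by apply: measurableT_comp => //; exact/measurable_EFinP.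
- by apply: measurableT_comp.
- apply: filterS fg => x fg xD /=; rewrite lee_fin normr_id (le_trans (fg xD))//.
  exact: ler_norm.
Qed.

End MulBounded.

Section AeProduct.
Context d1 d2 (T1 : measurableType d1) (T2 : measurableType d2) (R : realType).
Variables (m1 : {sigma_finite_measure set T1 -> \bar R})
  (m2 : {sigma_finite_measure set T2 -> \bar R}).

Lemma ae_snd (P : T2 -> Prop) : {ae m2, forall y, P y} ->
  {ae (m1 \x m2)%E, forall z, P z.2}.
Proof.
move=> [A [mA A0 PA]]; exists (setT `*` A); split.
- exact: measurableX.
- by rewrite product_measure1E// A0 mule0.
- by move=> [x y] /= nP; split => //=; exact: PA.
Qed.

Lemma prod_ae_eq_swap (D1 : set T1) (D2 : set T2) (f g : T1 * T2 -> R) :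
  measurable D1 -> measurable D2 ->
  measurable_fun (D1 `*` D2) f -> measurable_fun (D1 `*` D2) g ->
  {ae m2, forall y, D2 y -> {ae m1, forall x, D1 x -> f (x, y) = g (x, y)}} ->
  {ae (m1 \x m2)%E, forall z, (D1 `*` D2) z -> f z = g z}.
Proof.
move=> mD1 mD2 mf mg H.
have mD12 : measurable (D1 `*` D2) by exact: measurableX.
pose A := (D1 `*` D2) `&` [set z | f z != g z].
have mA : measurable A.
  have mB := measurable_funB mf mg.
  rewrite (_ : A = (D1 `*` D2) `&` (f \- g) @^-1` ~` [set 0]).
    by apply: mB => //; apply: measurableC; exact: measurable_set1.
  apply/seteqP; split => z [zD /=] fg; split => //=.
    by move=> /eqP; rewrite subr_eq0; exact/negP.
  by apply/eqP => fg'; apply: fg; rewrite fg' subrr.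
exists A; split => //; last first.
  move=> z /= /not_implyP[zD fg]; split => //=; exact/eqP.
rewrite product_measure_swap//.
have mA' : measurable (@unstable.swap T2 T1 @^-1` A).
  by rewrite -[_ @^-1` _]setTI; apply: measurable_swap.
have : {ae m2, forall y, {ae m1, forall x, ~ (@unstable.swap T2 T1 @^-1` A) (y, x)}}.
  apply: filterS H => y H.
  have [yD|yD] := pselect (D2 y); last by apply: aeW => x [[/= ]].
  by apply: filterS (H yD) => x E [[/= xD _]]; rewrite E// eqxx.
move=> /(prod_ae mA')[N [mN N0 AN]].
apply: (subset_measure0 mA' mN _ N0) => z zA; apply: AN => /=; exact.
Qed.

End AeProduct.

(** * Weak derivatives on a rectangle *)

Section Rectangle.
Context {R : realType}.
Notation mu := (@lebesgue_measure R).
Notation RM := (measurableTypeR R).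
Variables (a b c d : R).
Implicit Types f g h v w : R * R -> R.

Let I : set RM := `]a, b[%classic.
Let J : set RM := `]c, d[%classic.
Let D : set (RM * RM) := I `*` J.
Let mI : measurable I. Proof. exact: measurable_RM. Qed.
Let mJ : measurable J. Proof. exact: measurable_RM. Qed.
Let mD : measurable D. Proof. exact: measurableX. Qed.

Lemma measurable_tensor (k l : R -> R) (E : set (RM * RM)) : line_smooth k -> line_smooth l ->
  measurable_fun E (fun z : RM * RM => k z.1 * l z.2).
Proof.
move=> sk sl; apply: measurable_funTS; apply: measurable_funM.
  apply: (measurableT_comp (f := (k : RM -> RM))) => //.
  by apply: continuous_measurable_fun; exact: line_smooth_continuous.
apply: (measurableT_comp (f := (l : RM -> RM))) => //.
by apply: continuous_measurable_fun; exact: line_smooth_continuous.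
Qed.

Lemma bounded_tensor (k l : R -> R) : line_smooth k -> line_smooth l ->
  exists M : R, forall z : RM * RM, D z -> `|k z.1 * l z.2| <= M.
Proof.
move=> sk sl; have [M kM] := bounded_line_smooth a b sk.
have [N lN] := bounded_line_smooth c d sl; exists (M * N) => z [/=].
rewrite /I /J /= !in_itv/= => /andP[? ?] /andP[? ?].
by rewrite normrM ler_pM// ?kM ?lN// !ltW.
Qed.

Lemma integrable_tensor f (k l : R -> R) : line_smooth k -> line_smooth l ->
  (mu \x mu)%E.-integrable D (EFin \o f) ->
  (mu \x mu)%E.-integrable D (EFin \o (fun z => f z * (k z.1 * l z.2))).
Proof.
move=> sk sl; have [M klM] := bounded_tensor sk sl.
by apply: integrable_mul_bounded klM => //; exact: measurable_tensor.
Qed.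

Lemma line_smooth1 : @line_smooth R (cst 1). Proof. exact: line_smooth_cst. Qed.

(** By Fubini the hypothesis says that the function obtained by integrating out y is orthogonal to
    every rational bump in x. The factor 1 keeps the test function in product form. *)
Lemma sliced_y f (k : R -> R) : (mu \x mu)%E.-integrable D (EFin \o f) ->
  (forall (p q : rat) n, a < ratr p -> (ratr p : R) < ratr q -> ratr q < b ->
    \int[(mu \x mu)%E]_(z in D) (f z * (bump (ratr p) (ratr q) n z.1 * 1)) = 0) ->
  {ae mu, forall x, I x -> \int[mu]_(y in J) f (x, y) = 0}.
Proof.
move=> fi H; have [fs Fi _] := Rfubini mI mJ fi.
apply: (fundamental_lemma Fi) => p q n ap pq qb.
have sb : @line_smooth R (bump (ratr p : R) (ratr q) n) by exact: bump_smooth.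
have [_ _ E] := Rfubini mI mJ (integrable_tensor sb line_smooth1 fi).
have := H p q n ap pq qb; rewrite -E => <-.
apply: ae_eq_RintegralP => //.
- apply: measurable_funM; first exact: integrable_measurable Fi.
  exact: measurable_line_smooth.
- by have [_ /integrable_measurable + _] := Rfubini mI mJ (integrable_tensor sb line_smooth1 fi).
- move: fs; apply: (@ae_imp _ _ _ mu) => x fs xI.
  rewrite -(RintegralZr _ mJ (fs xI)); apply: eq_Rintegral => y _ /=.
  by rewrite mulr1.
Qed.

Lemma sliced_x f : (mu \x mu)%E.-integrable D (EFin \o f) ->
  (forall (p q : rat) n, c < ratr p -> (ratr p : R) < ratr q -> ratr q < d ->
    \int[(mu \x mu)%E]_(z in D) (f z * (1 * bump (ratr p) (ratr q) n z.2)) = 0) ->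
  {ae mu, forall y, J y -> \int[mu]_(x in I) f (x, y) = 0}.
Proof.
move=> fi H; have [fs Fi _] := Rfubini_swap mI mJ fi.
apply: (fundamental_lemma Fi) => p q n cp pq qd.
have sb : @line_smooth R (bump (ratr p : R) (ratr q) n) by exact: bump_smooth.
have [_ _ E] := Rfubini_swap mI mJ (integrable_tensor line_smooth1 sb fi).
have := H p q n cp pq qd; rewrite -E => <-.
apply: ae_eq_RintegralP => //.
- apply: measurable_funM; first exact: integrable_measurable Fi.
  exact: measurable_line_smooth.
- by have [_ /integrable_measurable + _] := Rfubini_swap mI mJ (integrable_tensor line_smooth1 sb fi).
- move: fs; apply: (@ae_imp _ _ _ mu) => y fs yJ.
  rewrite -(RintegralZr _ mI (fs yJ)); apply: eq_Rintegral => x _ /=.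
  by rewrite mul1r.
Qed.

(** One variable at a time: for a fixed bump in y, [sliced_y] removes the bumps in x, and
    [fundamental_param] then removes the bumps in y. *)
Lemma fundamental_rect h : (mu \x mu)%E.-integrable D (EFin \o h) ->
  (forall (p q : rat) n (p' q' : rat) n', a < ratr p -> (ratr p : R) < ratr q -> ratr q < b ->
    c < ratr p' -> (ratr p' : R) < ratr q' -> ratr q' < d ->
    \int[(mu \x mu)%E]_(z in D) (h z * (bump (ratr p) (ratr q) n z.1 * bump (ratr p') (ratr q') n' z.2)) = 0) ->
  {ae (mu \x mu)%E, forall z, D z -> h z = 0}.
Proof.
move=> hi H; apply: (@prod_ae_eq _ _ _ _ _ mu mu I J mI mJ h (cst 0)) => //.
  exact: integrable_measurable hi.
apply: (fundamental_param mI hi) => p' q' n' cp pq' qd.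
have sb' : @line_smooth R (bump (ratr p' : R) (ratr q') n') by exact: bump_smooth.
have ki := integrable_tensor line_smooth1 sb' hi.
have K0 : {ae mu, forall x, I x -> \int[mu]_(y in J) (h (x, y) * (1 * bump (ratr p') (ratr q') n' y)) = 0}.
  apply: (sliced_y (cst 1) ki) => p q n ap pq qb.
  rewrite -(H p q n p' q' n' ap pq qb cp pq' qd); apply: eq_Rintegral => z _.
  by rewrite mulr1 mul1r -mulrA; congr (_ * _); rewrite mulrC.
move: K0; apply: (@ae_imp _ _ _ mu) => x K0 xI; rewrite -[RHS](K0 xI).
by apply: eq_Rintegral => y _; rewrite mul1r.
Qed.

(** Only products are tested. Fixing k and letting l run over the bumps in y localizes the identity
    on almost every line parallel to the x axis. *)
Definition weak_x f g := forall k l : R -> R, line_smooth k -> line_smooth l ->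
  test_function `]a, b[ k -> test_function `]c, d[ l ->
  \int[(mu \x mu)%E]_(z in D) (f z * (k^`()%classic z.1 * l z.2)) =
  - \int[(mu \x mu)%E]_(z in D) (g z * (k z.1 * l z.2)).

Definition weak_y f g := forall k l : R -> R, line_smooth k -> line_smooth l ->
  test_function `]a, b[ k -> test_function `]c, d[ l ->
  \int[(mu \x mu)%E]_(z in D) (f z * (k z.1 * l^`()%classic z.2)) =
  - \int[(mu \x mu)%E]_(z in D) (g z * (k z.1 * l z.2)).

Lemma bump_rat_test (e1 e2 : R) (p q : rat) n : e1 < ratr p -> (ratr q : R) < e2 ->
  test_function `]e1, e2[ (bump (ratr p : R) (ratr q) n).
Proof.
move=> ep qe; apply: bump_test => x; rewrite /= !in_itv/= => /andP[px xq].
by rewrite (lt_le_trans ep px) (le_lt_trans xq qe).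
Qed.

Lemma weak_x_sliced f g (k : R -> R) : (mu \x mu)%E.-integrable D (EFin \o f) ->
  (mu \x mu)%E.-integrable D (EFin \o g) -> weak_x f g ->
  line_smooth k -> test_function `]a, b[ k ->
  {ae mu, forall y, J y -> \int[mu]_(x in I) (f (x, y) * k^`()%classic x) =
     - \int[mu]_(x in I) (g (x, y) * k x)}.
Proof.
move=> fi gi W sk tk; have sk' := line_smooth_derive sk.
have i1 := integrable_tensor sk' line_smooth1 fi.
have i2 := integrable_tensor sk line_smooth1 gi.
have [f1 _ _] := Rfubini_swap mI mJ i1; have [f2 _ _] := Rfubini_swap mI mJ i2.
have K0 := sliced_x (integrableRD mD i1 i2).
have {}K0 : {ae mu, forall y, J y -> \int[mu]_(x in I) (f (x, y) * (k^`()%classic x * 1) + g (x, y) * (k x * 1)) = 0}.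
  apply: K0 => p q n cp pq qd.
  have sb : @line_smooth R (bump (ratr p : R) (ratr q) n) by exact: bump_smooth.
  have := W _ _ sk sb tk (bump_rat_test n cp qd).
  move=> /eqP; rewrite -addr_eq0 -RintegralD//; last 2 first.
    exact: integrable_tensor.
    exact: integrable_tensor.
  move=> /eqP E; rewrite -[RHS]E; apply: eq_Rintegral => z _.
  by rewrite !mulr1 mul1r mulrDl -!mulrA.
have := ae_and K0 (ae_and f1 f2); apply: (@ae_imp _ _ _ mu) => y [H [h1 h2]] yJ.
have := H yJ; rewrite (RintegralD mI (h1 yJ) (h2 yJ)) => /eqP.
rewrite addr_eq0 => /eqP E.
transitivity (\int[mu]_(x in I) (f (x, y) * (k^`()%classic x * 1))).
  by apply: eq_Rintegral => x _; rewrite mulr1.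
by rewrite E; congr (- _); apply: eq_Rintegral => x _; rewrite mulr1.
Qed.

Lemma weak_y_sliced f g (l : R -> R) : (mu \x mu)%E.-integrable D (EFin \o f) ->
  (mu \x mu)%E.-integrable D (EFin \o g) -> weak_y f g ->
  line_smooth l -> test_function `]c, d[ l ->
  {ae mu, forall x, I x -> \int[mu]_(y in J) (f (x, y) * l^`()%classic y) =
     - \int[mu]_(y in J) (g (x, y) * l y)}.
Proof.
move=> fi gi W sl tl; have sl' := line_smooth_derive sl.
have i1 := integrable_tensor line_smooth1 sl' fi.
have i2 := integrable_tensor line_smooth1 sl gi.
have [f1 _ _] := Rfubini mI mJ i1; have [f2 _ _] := Rfubini mI mJ i2.
have K0 := sliced_y (cst 1) (integrableRD mD i1 i2).
have {}K0 : {ae mu, forall x, I x -> \int[mu]_(y in J) (f (x, y) * (1 * l^`()%classic y) + g (x, y) * (1 * l y)) = 0}.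
  apply: K0 => p q n cp pq qd.
  have sb : @line_smooth R (bump (ratr p : R) (ratr q) n) by exact: bump_smooth.
  have := W _ _ sb sl (bump_rat_test n cp qd) tl.
  move=> /eqP; rewrite -addr_eq0 -RintegralD//; last 2 first.
    exact: integrable_tensor.
    exact: integrable_tensor.
  move=> /eqP E; rewrite -[RHS]E; apply: eq_Rintegral => z _.
  rewrite /=; move: (f z) (g z) (l^`()%classic z.2) (l z.2) (bump _ _ _ _) => u1 u2 u3 u4 u5.
  by ring.
have := ae_and K0 (ae_and f1 f2); apply: (@ae_imp _ _ _ mu) => x [H [h1 h2]] xI.
have := H xI; rewrite (RintegralD mJ (h1 xI) (h2 xI)) => /eqP.
rewrite addr_eq0 => /eqP E.
transitivity (\int[mu]_(y in J) (f (x, y) * (1 * l^`()%classic y))).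
  by apply: eq_Rintegral => y _; rewrite mul1r.
by rewrite E; congr (- _); apply: eq_Rintegral => y _; rewrite mul1r.
Qed.

Lemma AC_y_of_weak f g : c < d -> (mu \x mu)%E.-integrable D (EFin \o f) ->
  (mu \x mu)%E.-integrable D (EFin \o g) -> weak_y f g ->
  {ae mu, forall x, I x -> exists e, {ae mu, forall y, J y ->
     f (x, y) = e + \int[mu]_(s in `]c, y[) g (x, s)}}.
Proof.
move=> cd fi gi W; apply: (AC_of_weak_param mI cd fi gi) => l sl tl.
exact: weak_y_sliced.
Qed.

Lemma AC_x_of_weak f g : a < b -> (mu \x mu)%E.-integrable D (EFin \o f) ->
  (mu \x mu)%E.-integrable D (EFin \o g) -> weak_x f g ->
  {ae mu, forall y, J y -> exists e, {ae mu, forall x, I x ->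
     f (x, y) = e + \int[mu]_(s in `]a, x[) g (s, y)}}.
Proof.
move=> ab fi gi W.
have fi' := integrable_swap mI mJ fi; have gi' := integrable_swap mI mJ gi.
apply: (AC_of_weak_param mJ ab fi' gi') => k sk tk.
exact: weak_x_sliced.
Qed.

(** The upper limit z.1 is absorbed in the indicator of s < x, a measurable function of three
    variables. As [g] is only measurable, Tonelli's theorem is applied to the positive and negative
    parts separately. *)
Lemma measurable_primitive_x g : measurable_fun D g ->
  measurable_fun D (fun z => \int[mu]_(s in `]a, z.1[) g (s, z.2)).
Proof.
move=> mg; pose g0 : RM * RM -> R := g \_ D.
have mg0 : measurable_fun setT g0 by exact/(measurable_restrictT g mD).
pose W := ((RM * RM) * RM)%type.
pose A : set W := [set w | w.2 < w.1.1].
have mA : measurable A.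
  have : measurable_fun setT (fun w : W => w.1.1 - w.2 : RM).
    apply: measurable_funB; last exact: measurable_snd.
    exact: (measurableT_comp measurable_fst measurable_fst).
  move=> /(_ measurableT `]0, +oo[%classic (measurable_itv _)); rewrite setTI.
  congr measurable; apply/seteqP; split => w /=; rewrite in_itv/= andbT subr_gt0//.
pose H (w : W) : R := \1_A w * g0 (w.2, w.1.2).
have mH : measurable_fun setT (EFin \o H).
  apply/measurable_EFinP; apply: measurable_funM; first exact: measurable_indic.
  apply: (measurableT_comp mg0); apply: measurable_fun_pair; first exact: measurable_snd.
  exact: (measurableT_comp measurable_snd measurable_fst).
have mHp : measurable_fun setT (fun z : RM * RM => \int[mu]_s (EFin \o H)^\+ (z, s))%E.
  apply: (@measurable_fun_fubini_tonelli_F _ _ (RM * RM)%type RM _ mu ((EFin \o H)^\+)%E).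
  - exact: measurable_funepos.
  - by move=> w; exact: funepos_ge0.
have mHn : measurable_fun setT (fun z : RM * RM => \int[mu]_s (EFin \o H)^\- (z, s))%E.
  apply: (@measurable_fun_fubini_tonelli_F _ _ (RM * RM)%type RM _ mu ((EFin \o H)^\-)%E).
  - exact: measurable_funeneg.
  - by move=> w; exact: funeneg_ge0.
have mK : measurable_fun setT (fun z : RM * RM => fine (\int[mu]_s (EFin \o H) (z, s)))%E.
  apply: (measurableT_comp (f := fine)) => //.
  rewrite (_ : (fun z => _) = (fun z => \int[mu]_s (EFin \o H)^\+ (z, s) - \int[mu]_s (EFin \o H)^\- (z, s))%E).
    exact: (emeasurable_funB mHp mHn).
  apply/funext => z; rewrite [LHS](integralE mu setT (fun s => (EFin \o H) (z, s))).
  by congr (_ - _)%E; apply: eq_integral => s _; rewrite ?funeposE ?funenegE.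
apply: (eq_measurable_fun (fun z : RM * RM => fine (\int[mu]_s (EFin \o H) (z, s)))%E); last first.
  exact: measurable_funTS.
move=> [x y]; rewrite inE => -[/= xI yJ].
rewrite Rintegral_mkcond /Rintegral; congr fine; apply: eq_integral => s _ /=.
congr EFin; rewrite /H indicE patchE /= /g0 patchE.
have [as_|sa] := ltP a s; last first.
  rewrite (@memNset _ D) ?mulr0; last by rewrite /D /I /= in_itv/= => -[]; rewrite ltNge sa.
  by rewrite memNset// /= in_itv/= ltNge sa.
have [sx|xs] := ltP s x; last first.
  rewrite (@memNset _ A) ?mul0r; last by rewrite /A /= ltNge xs.
  by rewrite memNset// /= in_itv/= [s < x]ltNge xs andbF.
rewrite !mem_set ?mul1r//=; first by rewrite in_itv/= as_ sx.
split => //=; rewrite /I /= in_itv/= as_.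
by move: xI; rewrite /I /= in_itv/= => /andP[_]; exact: lt_trans.
Qed.

(** Dominated by the integral of |g| over the full line, a function of y alone that Fubini makes
    integrable. *)
Lemma integrable_primitive_x g : a < b -> (mu \x mu)%E.-integrable D (EFin \o g) ->
  (mu \x mu)%E.-integrable D (EFin \o (fun z => \int[mu]_(s in `]a, z.1[) g (s, z.2))).
Proof.
move=> ab gi; have ga := integrableR_abs mD gi.
have [gs1 Gi1 _] := Rfubini_swap mI mJ ga.
have [gs2 _ _] := Rfubini_swap mI mJ gi.
have ci : mu.-integrable I (EFin \o cst 1).
  exact: (L2_integrable mI (itv_finite a b) (L2_cst _ mI (itv_finite a b))).
have Bi := integrable_prod mI mJ ci Gi1.
have mP := measurable_primitive_x (integrable_measurable gi).
apply: (ae_domination mD mP _ Bi).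
move: (ae_snd mu gs2); apply: ae_imp => -[x y] /= gs [/= xI yJ].
have ay := gs yJ; move: xI; rewrite /I /= in_itv/= => /andP[ax xb].
have i1 := integrable_suboo (lexx a) (ltW xb) ay.
rewrite mul1r; apply: (le_trans (le_normr_Rintegral (measurable_RM _) i1)).
rewrite (@Rintegral_split _ a x b); [|by rewrite !ltW|exact: integrableR_abs].
by rewrite lerDl Rintegral_ge0.
Qed.

End Rectangle.

(** * Boundary values of v_y by differentiation under the integral *)

Section MixedDerivative.
Context {R : realType}.
Notation mu := (@lebesgue_measure R).
Notation RM := (measurableTypeR R).
Variables (a b c d : R).
Implicit Types f g h v w : R * R -> R.

Let I : set RM := `]a, b[%classic.
Let J : set RM := `]c, d[%classic.
Let D : set (RM * RM) := I `*` J.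
Let mI : measurable I. Proof. exact: measurable_RM. Qed.
Let mJ : measurable J. Proof. exact: measurable_RM. Qed.
Let mD : measurable D. Proof. exact: measurableX. Qed.

Let sliced_weak f g := forall l : R -> R, line_smooth l -> test_function `]c, d[ l ->
  {ae mu, forall x, I x -> \int[mu]_(y in J) (f (x, y) * l^`()%classic y) =
     - \int[mu]_(y in J) (g (x, y) * l y)}.

Let subrect_primitive w (l : R -> R) x : a < x < b ->
  (mu \x mu)%E.-integrable D (EFin \o w) -> line_smooth l ->
  \int[mu]_(s in `]a, x[) (\int[mu]_(y in J) (w (s, y) * l y)) =
  \int[mu]_(y in J) ((\int[mu]_(s in `]a, x[) w (s, y)) * l y).
Proof.
move=> /andP[ax xb] wi sl; set Ix : set RM := `]a, x[%classic.
have mIx : measurable Ix by exact: measurable_RM.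
have sub : Ix `<=` I by apply: subset_itvl; rewrite bnd_simp ltW.
have mDx : measurable (Ix `*` J : set (RM * RM)) by exact: measurableX.
have wi' : (mu \x mu)%E.-integrable (Ix `*` J) (EFin \o w).
  by apply: integrableS wi => // z [? ?]; split => //; exact: sub.
have wli := integrable_tensor line_smooth1 sl wi'.
have [_ _ E1] := Rfubini mIx mJ wli.
have [_ i2 E2] := Rfubini_swap mIx mJ wli.
have [w1 wi2 _] := Rfubini_swap mIx mJ wi'.
transitivity (\int[mu]_(s in Ix) (\int[mu]_(y in J) (w (s, y) * (cst 1 s * l y)))).
  by apply: eq_Rintegral => s _; apply: eq_Rintegral => y _; rewrite mul1r.
rewrite E1 -E2; apply: ae_eq_RintegralP => //.
- exact: integrable_measurable i2.
- by apply: measurable_funM; [exact: integrable_measurable wi2|exact: measurable_line_smooth].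
- move: w1; apply: (@ae_imp _ _ _ mu) => y w1 yJ.
  rewrite -(RintegralZr _ mIx (w1 yJ)); apply: eq_Rintegral => s _ /=.
  by rewrite mul1r.
Qed.

(** Against l(y), on almost every vertical line: int v_y l = - int v l' = - int_a^x int v_x l' =
    int_a^x int v_xy l = int (int_a^x v_xy) l. This transfers to v_y the vanishing of v at x = a,
    for which no trace is assumed. *)
Lemma derive_under_primitive v vx vy vxy : a < b ->
  (mu \x mu)%E.-integrable D (EFin \o v) -> (mu \x mu)%E.-integrable D (EFin \o vx) ->
  (mu \x mu)%E.-integrable D (EFin \o vy) -> (mu \x mu)%E.-integrable D (EFin \o vxy) ->
  sliced_weak v vy -> sliced_weak vx vxy ->
  {ae mu, forall y, J y -> {ae mu, forall x, I x ->
     v (x, y) = \int[mu]_(s in `]a, x[) vx (s, y)}} ->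
  {ae mu, forall y, J y -> {ae mu, forall x, I x ->
     vy (x, y) = \int[mu]_(s in `]a, x[) vxy (s, y)}}.
Proof.
move=> ab vi vxi vyi vxyi Wv Wvx vE.
have Gi := integrable_primitive_x ab vxyi.
have Vi := integrable_primitive_x ab vxi.
(* The representation is known on horizontal lines, but the test in y needs it on vertical ones; the
   exchange goes through the plane. *)
have vE' : {ae mu, forall x, I x -> {ae mu, forall y, J y ->
     v (x, y) = \int[mu]_(s in `]a, x[) vx (s, y)}}.
  have := prod_ae_eq_swap mI mJ (integrable_measurable vi) (integrable_measurable Vi) vE.
  move=> /ae_prodP; apply: ae_imp => x H xI; move: H; apply: ae_imp => y H yJ.
  by apply: H; split.
suff : {ae mu, forall x, I x -> {ae mu, forall y, J y ->
     vy (x, y) - \int[mu]_(s in `]a, x[) vxy (s, y) = 0}}.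
  move=> H; have H' : {ae mu, forall x, I x -> {ae mu, forall y, J y ->
     vy (x, y) = \int[mu]_(s in `]a, x[) vxy (s, y)}}.
    move: H; apply: (@ae_imp _ _ _ mu) => x H xI; move: (H xI).
    by apply: (@ae_imp _ _ _ mu) => y {}H yJ; apply/eqP; rewrite -subr_eq0 H.
  have := prod_ae_eq mI mJ (integrable_measurable vyi) (integrable_measurable Gi) H'.
  move=> /ae_prod_swap; apply: ae_imp => y {H'}H yJ; move: H; apply: ae_imp => x H xI.
  by apply: H; split.
apply: (fundamental_param mI (integrableRB mD vyi Gi)) => p q n cp pq qd.
have sl : @line_smooth R (bump (ratr p : R) (ratr q) n) by exact: bump_smooth.
have tl := bump_rat_test n cp qd.
have sl' := line_smooth_derive sl.
set l := bump _ _ _ in sl tl sl' *.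
have [vys _ _] := Rfubini mI mJ vyi.
have [Gs _ _] := Rfubini mI mJ Gi.
have [vs _ _] := Rfubini mI mJ vi.
have [Vs _ _] := Rfubini mI mJ Vi.
have [_ i1 _] := Rfubini mI mJ (integrable_tensor line_smooth1 sl' vxi).
have [_ i2 _] := Rfubini mI mJ (integrable_tensor line_smooth1 sl vxyi).
have Bx := Wvx l sl tl.
have := ae_and (ae_and vys Gs) (ae_and (ae_and vs Vs) (ae_and vE' (Wv l sl tl))).
apply: (@ae_imp _ _ _ mu) => x [[h1 h2] [[h3 h4] [h5 h6]]] xI.
have axb : a < x < b by move: xI; rewrite /I /= in_itv.
have {}h1 := integrable_mul_smooth (h1 xI) sl.
have {}h2 := integrable_mul_smooth (h2 xI) sl.
have E1 : \int[mu]_(y in J) ((\int[mu]_(s in `]a, x[) vxy (s, y)) * l y) =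
    \int[mu]_(y in J) (vy (x, y) * l y).
  rewrite -(subrect_primitive axb vxyi sl).
  transitivity (- \int[mu]_(s in `]a, x[) (\int[mu]_(y in J) (vx (s, y) * l^`()%classic y))).
    have /andP[ax xb] := axb.
    have sub : `]a, x[ `<=` I by apply: subset_itvl; rewrite bnd_simp ltW.
    have mx := measurable_RM `]a, x[.
    have i1' : mu.-integrable `]a, x[ (EFin \o (fun s => \int[mu]_(y in J) (vx (s, y) * l^`()%classic y))).
      apply: (@integrableS _ _ _ mu I) => //; move: i1; apply: eq_integrable => // s _ /=; congr EFin.
      by apply: eq_Rintegral => y _; rewrite mul1r.
    have i2' : mu.-integrable `]a, x[ (EFin \o (fun s => \int[mu]_(y in J) (vxy (s, y) * l y))).
      apply: (@integrableS _ _ _ mu I) => //; move: i2; apply: eq_integrable => // s _ /=; congr EFin.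
      by apply: eq_Rintegral => y _; rewrite mul1r.
    rewrite -(RintegralN mx i1'); apply: ae_eq_RintegralP => //.
    - exact: integrable_measurable i2'.
    - exact: integrable_measurable (integrableRN mx i1').
    - move: Bx; apply: (@ae_imp _ _ _ mu) => s Bx sx.
      by rewrite Bx ?opprK//; exact: sub.
  rewrite (subrect_primitive axb vxi sl') -[RHS]opprK -(h6 xI); congr (- _).
  apply: ae_eq_RintegralP => //.
  - by have := integrable_measurable (integrable_mul_smooth (h4 xI) sl').
  - by have := integrable_measurable (integrable_mul_smooth (h3 xI) sl').
  - move: (h5 xI); apply: (@ae_imp _ _ _ mu) => y {}h5 yJ.
    by rewrite -h5.
transitivity (\int[mu]_(y in J) (vy (x, y) * l y - (\int[mu]_(s in `]a, x[) vxy (s, y)) * l y)).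
  by apply: eq_Rintegral => y _; rewrite mulrBl.
by rewrite (RintegralB mJ h1 h2) E1 subrr.
Qed.

(** The zero mean of v_x expresses v = 0 at x = b once v = 0 at x = a; differentiating it in y gives
    the same for v_y. *)
Lemma derive_under_integral vx vxy :
  (mu \x mu)%E.-integrable D (EFin \o vx) -> (mu \x mu)%E.-integrable D (EFin \o vxy) ->
  sliced_weak vx vxy ->
  {ae mu, forall y, J y -> \int[mu]_(s in I) vx (s, y) = 0} ->
  {ae mu, forall y, J y -> \int[mu]_(s in I) vxy (s, y) = 0}.
Proof.
move=> vxi vxyi W H0.
have [ws wi _] := Rfubini_swap mI mJ vxyi.
have [us ui _] := Rfubini_swap mI mJ vxi.
apply: (fundamental_lemma wi) => p q n cp pq qd.
have sl : @line_smooth R (bump (ratr p : R) (ratr q) n) by exact: bump_smooth.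
have tl := bump_rat_test n cp qd.
have sl' := line_smooth_derive sl.
set l := bump _ _ _ in sl tl sl' *.
have Bx := W l sl tl.
have t1 := integrable_tensor line_smooth1 sl' vxi.
have t2 := integrable_tensor line_smooth1 sl vxyi.
have [_ i1 F1] := Rfubini mI mJ t1; have [_ i2 F2] := Rfubini mI mJ t2.
have [_ j1 G1] := Rfubini_swap mI mJ t1; have [_ j2 G2] := Rfubini_swap mI mJ t2.
have E w (k : R -> R) : line_smooth k -> (mu \x mu)%E.-integrable D (EFin \o w) ->
    \int[mu]_(y in J) ((\int[mu]_(s in I) w (s, y)) * k y) =
    \int[mu]_(s in I) (\int[mu]_(y in J) (w (s, y) * (cst 1 s * k y))).
  move=> sk wi'; have t := integrable_tensor line_smooth1 sk wi'.
  have [_ k1 K1] := Rfubini mI mJ t; have [_ k2 K2] := Rfubini_swap mI mJ t.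
  have [k3 k4 _] := Rfubini_swap mI mJ wi'.
  rewrite K1 -K2; apply: ae_eq_RintegralP => //.
  - by apply: measurable_funM; [exact: integrable_measurable k4|exact: measurable_line_smooth].
  - exact: integrable_measurable k2.
  - move: k3; apply: (@ae_imp _ _ _ mu) => y k3 yJ.
    rewrite -(RintegralZr _ mI (k3 yJ)); apply: eq_Rintegral => s _ /=.
    by rewrite mul1r.
rewrite (E _ _ sl vxyi).
have -> : \int[mu]_(s in I) (\int[mu]_(y in J) (vxy (s, y) * (cst 1 s * l y))) =
    - \int[mu]_(s in I) (\int[mu]_(y in J) (vx (s, y) * (cst 1 s * l^`()%classic y))).
  rewrite -(RintegralN mI i1); apply: ae_eq_RintegralP => //.
  - exact: integrable_measurable i2.
  - exact: integrable_measurable (integrableRN mI i1).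
  - move: Bx; apply: (@ae_imp _ _ _ mu) => s Bx sI.
    transitivity (\int[mu]_(y in J) (vxy (s, y) * l y)).
      by apply: eq_Rintegral => y _; rewrite mul1r.
    rewrite -[LHS]opprK -(Bx sI); congr (- _).
    by apply: eq_Rintegral => y _; rewrite mul1r.
rewrite -(E _ _ sl' vxi).
rewrite (@ae_eq_RintegralP _ _ _ mu J _ (cst 0)) ?Rintegral0 ?oppr0//.
- by rewrite /Rintegral integral0_eq//= oppr0.
- by apply: measurable_funM; [exact: integrable_measurable ui|exact: measurable_line_smooth].
- by move: H0; apply: (@ae_imp _ _ _ mu) => y H0 yJ; rewrite H0// mul0r.
Qed.

End MixedDerivative.

(** * Weak derivatives of the plane tested on products *)

Section WeakDerivatives.
Context {R : realType}.
Notation mu := (@lebesgue_measure R).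
Notation RM := (measurableTypeR R).
Variables (a b c d : R).
Implicit Types f g h v w : R * R -> R.

Let I : set RM := `]a, b[%classic.
Let J : set RM := `]c, d[%classic.
Let D : set (R * R) := `]a, b[ `*` `]c, d[.
Let mI : measurable I. Proof. exact: measurable_RM. Qed.
Let mJ : measurable J. Proof. exact: measurable_RM. Qed.
Let mD : measurable (D : set (RM * RM)). Proof. exact: measurableX. Qed.

Lemma derive_test_function (O : set R) (k : R -> R) : line_smooth k -> test_function O k ->
  test_function O (k^`())%classic.
Proof.
move=> sk [_ [K [cK KO k0]]]; split.
  by apply: line_smooth_smooth; exact: line_smooth_derive.
exists K; split => // x nKx.
have oK : open (~` K).
  by apply: closed_openC; apply: compact_closed => //; exact: Rhausdorff.
rewrite derive1E; have [_ <-] := is_derive_cst (0 : R) x (1 : R).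
apply: near_eq_derive.
have : nbhs x (~` K) by apply: open_nbhs_nbhs; split.
by apply: filterS => y nKy; rewrite /cst k0.
Qed.

Lemma derive_ex_tensor (k l : R -> R) : line_smooth k -> line_smooth l ->
  'D_ex (fun z : R * R => k z.1 * l z.2) = (fun z => k^`()%classic z.1 * l z.2).
Proof.
move=> sk sl; apply/funext => z.
have [_ ->] := is_derive_tensor (ex : R * R) (line_smooth_derivable (x:=z.1) sk)
  (line_smooth_derivable (x:=z.2) sl).
by rewrite /= mul1r mul0r addr0.
Qed.

Lemma derive_ey_tensor (k l : R -> R) : line_smooth k -> line_smooth l ->
  'D_ey (fun z : R * R => k z.1 * l z.2) = (fun z => k z.1 * l^`()%classic z.2).
Proof.
move=> sk sl; apply/funext => z.
have [_ ->] := is_derive_tensor (ey : R * R) (line_smooth_derivable (x:=z.1) sk)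
  (line_smooth_derivable (x:=z.2) sl).
by rewrite /= mul1r mul0r add0r.
Qed.

Let sign_cancel (n : nat) (x y : R) : (-1) ^+ n * x = (-1) ^+ n * y -> x = y.
Proof. by move=> /(congr1 ( *%R ((-1) ^+ n))); rewrite !mulrA -!expr2 !sqrr_sign !mul1r. Qed.

(** The last direction of the list is the first one applied to the test function. Hence testing [f]
    against k'(x) l(y) and [g] against k(x) l(y) produces the same integral of [v], up to the sign
    of one derivative. *)
Lemma weak_deriv_weak_x vs v f g : weak_deriv D vs v f -> weak_deriv D (rcons vs ex) v g ->
  weak_x a b c d f g.
Proof.
move=> [_ _ Wf] [_ _ Wg] k l sk sl tk tl.
have tk' := derive_test_function sk tk.
have := Wf _ (tensor_test (line_smooth_derive sk) sl tk' tl).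
have := Wg _ (tensor_test sk sl tk tl).
rewrite /iter_deriv foldr_rcons (derive_ex_tensor sk sl) => -> /esym.
by rewrite size_rcons exprS mulN1r mulNr -mulrN => /sign_cancel.
Qed.

Lemma weak_deriv_weak_y vs v f g : weak_deriv D vs v f -> weak_deriv D (rcons vs ey) v g ->
  weak_y a b c d f g.
Proof.
move=> [_ _ Wf] [_ _ Wg] k l sk sl tk tl.
have tl' := derive_test_function sl tl.
have := Wf _ (tensor_test sk (line_smooth_derive sl) tk tl').
have := Wg _ (tensor_test sk sl tk tl).
rewrite /iter_deriv foldr_rcons (derive_ey_tensor sk sl) => -> /esym.
by rewrite size_rcons exprS mulN1r mulNr -mulrN => /sign_cancel.
Qed.

(** The functions are only locally integrable, so [fundamental_rect] is applied on the rational
    rectangles compactly contained in [D]; they are countably many and cover it. *)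
Lemma tensor_unique g1 g2 : locally_integrable_on D g1 -> locally_integrable_on D g2 ->
  (forall k l : R -> R, line_smooth k -> line_smooth l ->
    test_function `]a, b[ k -> test_function `]c, d[ l ->
    \int[(mu \x mu)%E]_(z in D) (g1 z * (k z.1 * l z.2)) =
    \int[(mu \x mu)%E]_(z in D) (g2 z * (k z.1 * l z.2))) ->
  {ae (mu \x mu)%E, forall z, D z -> g1 z = g2 z}.
Proof.
move=> L1 L2 H.
pose r (i : rat * rat * (rat * rat)) : set (RM * RM) :=
  `]ratr i.1.1, ratr i.1.2[ `*` `]ratr i.2.1, ratr i.2.2[.
pose P (i : rat * rat * (rat * rat)) (z : RM * RM) :=
  a < ratr i.1.1 -> ratr i.1.2 < b -> c < ratr i.2.1 -> ratr i.2.2 < d ->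
  r i z -> g1 z - g2 z = 0.
suff : {ae (mu \x mu)%E, forall z, forall i, P i z}.
  apply: ae_imp => -[x y] Pz [/=]; rewrite !in_itv/= => /andP[ax xb] /andP[cy yd].
  have [p1] := @rat_in_itvoo R a x ax; rewrite in_itv/= => /andP[ap1 p1x].
  have [p2] := @rat_in_itvoo R x b xb; rewrite in_itv/= => /andP[xp2 p2b].
  have [q1] := @rat_in_itvoo R c y cy; rewrite in_itv/= => /andP[cq1 q1y].
  have [q2] := @rat_in_itvoo R y d yd; rewrite in_itv/= => /andP[yq2 q2d].
  have := Pz ((p1, p2), (q1, q2)) ap1 p2b cq1 q2d.
  rewrite /r /= => /(_ _)/eqP; rewrite subr_eq0 => H0; apply/eqP; apply: H0.
  by split; rewrite /= in_itv/= ?p1x ?q1y.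
apply: ae_countable => -[[p1 p2] [q1 q2]]; rewrite /P /r /=.
have [ap1|n1] := pselect (a < ratr p1); last by apply: aeW => z /n1.
have [p2b|n2] := pselect (ratr p2 < b); last by apply: aeW => z _ /n2.
have [cq1|n3] := pselect (c < ratr q1); last by apply: aeW => z _ _ /n3.
have [q2d|n4] := pselect (ratr q2 < d); last by apply: aeW => z _ _ _ /n4.
pose K : set (R * R) := `[ratr p1, ratr p2] `*` `[ratr q1, ratr q2].
have cK : compact K by apply: compact_setX; exact: segment_compact.
have KD : K `<=` D.
  move=> z [/=]; rewrite !in_itv/= => /andP[? ?] /andP[? ?]; split => /=; rewrite in_itv/=.
    by rewrite (lt_le_trans ap1)// (le_lt_trans _ p2b).
  by rewrite (lt_le_trans cq1)// (le_lt_trans _ q2d).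
pose D' : set (RM * RM) := `]ratr p1, ratr p2[ `*` `]ratr q1, ratr q2[.
have mK : measurable (K : set (RM * RM)) by apply: measurableX; exact: measurable_RM.
have mD' : measurable D' by apply: measurableX; exact: measurable_RM.
have D'K : D' `<=` K.
  by move=> z [? ?]; split; apply: subset_itv_oo_cc.
have i1 : (mu \x mu)%E.-integrable D' (EFin \o g1).
  by apply: (integrableS mK mD' D'K); exact: L1.
have i2 : (mu \x mu)%E.-integrable D' (EFin \o g2).
  by apply: (integrableS mK mD' D'K); exact: L2.
have : {ae (mu \x mu)%E, forall z, D' z -> g1 z - g2 z = 0}.
  apply: (fundamental_rect (integrableRB mD' i1 i2)) => p q n p' q' n' h1 h2 h3 h4 h5 h6.
  have sk : @line_smooth R (bump (ratr p : R) (ratr q) n) by exact: bump_smooth.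
  have sl : @line_smooth R (bump (ratr p' : R) (ratr q') n') by exact: bump_smooth.
  have tk := bump_rat_test n (lt_trans ap1 h1) (lt_trans h3 p2b).
  have tl := bump_rat_test n' (lt_trans cq1 h4) (lt_trans h6 q2d).
  have E g : \int[(mu \x mu)%E]_(z in D) (g z * (bump (ratr p) (ratr q) n z.1 * bump (ratr p') (ratr q') n' z.2)) =
      \int[(mu \x mu)%E]_(z in D') (g z * (bump (ratr p) (ratr q) n z.1 * bump (ratr p') (ratr q') n' z.2)).
    rewrite Rintegral_mkcond [RHS]Rintegral_mkcond; congr Rintegral; apply/funext => z.
    rewrite !patchE; case: ifPn => zD; case: ifPn => // zD'.
      have [b1|b1] := boolP (ratr p < z.1 < ratr q); last by rewrite (bump_out _ b1) mul0r mulr0.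
      have [b2|b2] := boolP (ratr p' < z.2 < ratr q'); last by rewrite (bump_out _ b2) !mulr0.
      exfalso; move/negP: zD'; apply; rewrite inE; split => /=; rewrite in_itv/=.
        by have /andP[? ?] := b1; rewrite (lt_trans h1)// (lt_trans _ h3).
      by have /andP[? ?] := b2; rewrite (lt_trans h4)// (lt_trans _ h6).
    exfalso; move/negP: zD; apply; rewrite inE; apply: KD; apply: D'K; by rewrite -inE.
  have := H _ _ sk sl tk tl; rewrite (E g1) (E g2) => EE.
  transitivity (\int[(mu \x mu)%E]_(z in D')
      (g1 z * (bump (ratr p) (ratr q) n z.1 * bump (ratr p') (ratr q') n' z.2) -
       g2 z * (bump (ratr p) (ratr q) n z.1 * bump (ratr p') (ratr q') n' z.2))).
    by apply: eq_Rintegral => z _; rewrite mulrBl.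
  by rewrite (RintegralB mD' (integrable_tensor sk sl i1) (integrable_tensor sk sl i2)) EE subrr.
by apply: ae_imp => z H' _ _ _ _; exact: H'.
Qed.

Lemma weak_deriv_unique vs v g1 g2 : weak_deriv D vs v g1 -> weak_deriv D vs v g2 ->
  {ae (mu \x mu)%E, forall z, D z -> g1 z = g2 z}.
Proof.
move=> [_ l1 W1] [_ l2 W2]; apply: (tensor_unique l1 l2) => k l sk sl tk tl.
have t := tensor_test sk sl tk tl.
by have := W1 _ t; rewrite (W2 _ t) => /sign_cancel.
Qed.

Lemma weak_deriv_compose_x vs v f g w : weak_deriv D vs v f -> weak_deriv D (rcons vs ex) v g ->
  weak_deriv D [:: ex] f w -> {ae (mu \x mu)%E, forall z, D z -> g z = w z}.
Proof.
move=> Wf Wg [l1 l2 Ww]; have X := weak_deriv_weak_x Wf Wg.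
have [_ lg _] := Wg; apply: (tensor_unique lg l2) => k l sk sl tk tl.
have E := Ww _ (tensor_test sk sl tk tl); have E' := X k l sk sl tk tl.
rewrite (_ : iter_deriv [:: ex] _ = fun z => k^`()%classic z.1 * l z.2) in E; last exact: derive_ex_tensor.
by move: E; rewrite E' expr1 mulN1r => /oppr_inj.
Qed.

End WeakDerivatives.

(** * Smooth functions of the plane and their L^2 norms *)

Section SmoothFunctions.
Context {R : realType}.
Notation mu := (@lebesgue_measure R).
Notation RM := (measurableTypeR R).
Implicit Types (f : R * R -> R).

(** Measurability refers to the product sigma-algebra, so [U] is written as the countable union of
    the rational open rectangles it contains. *)
Lemma open_measurable_plane (U : set (R * R)) : open U -> measurable (U : set (RM * RM)).
Proof.
move=> oU; pose F (i : rat * rat * (rat * rat)) : set (RM * RM) :=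
  [set z | `]ratr i.1.1, ratr i.1.2[%classic `*` `]ratr i.2.1, ratr i.2.2[%classic `<=` U /\
     (`]ratr i.1.1, ratr i.1.2[%classic `*` `]ratr i.2.1, ratr i.2.2[%classic) z].
have -> : U = \bigcup_n oapp F set0 (unpickle n).
  apply/seteqP; split=> [z Uz|z [n _]]; last by case: unpickle => //= i [sub /sub].
  have /nbhs_ballP[e /= e0 sub] : nbhs z U by apply: open_nbhs_nbhs; split.
  have ballE (x y : R) : ball x e y = (x - e < y < x + e) :> Prop.
    by rewrite /ball /= ltr_distlC.
  have [p1] := @rat_in_itvoo R (z.1 - e) z.1 (ltac:(by rewrite ltrBlDr ltrDl)).
  rewrite in_itv/= => /andP[p11 p12].
  have [q1] := @rat_in_itvoo R z.1 (z.1 + e) (ltac:(by rewrite ltrDl)).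
  rewrite in_itv/= => /andP[q11 q12].
  have [p2] := @rat_in_itvoo R (z.2 - e) z.2 (ltac:(by rewrite ltrBlDr ltrDl)).
  rewrite in_itv/= => /andP[p21 p22].
  have [q2] := @rat_in_itvoo R z.2 (z.2 + e) (ltac:(by rewrite ltrDl)).
  rewrite in_itv/= => /andP[q21 q22].
  pose i := ((p1, q1), (p2, q2)); exists (pickle i); first by [].
  rewrite pickleK; split; last first.
    by split => /=; rewrite in_itv/= ?p12 ?p22.
  move=> y [/=]; rewrite !in_itv/= => /andP[y1 y2] /andP[y3 y4]; apply: sub; split => /=.
    by rewrite ballE (lt_trans p11)// (lt_trans y2).
  by rewrite ballE (lt_trans p21)// (lt_trans y4).
apply: bigcupT_measurable => n; case: unpickle => //= i.
have [sub|nsub] := pselect (`]ratr i.1.1, ratr i.1.2[%classic `*` `]ratr i.2.1, ratr i.2.2[%classic `<=` U).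
  rewrite (_ : F i = `]ratr i.1.1, ratr i.1.2[%classic `*` `]ratr i.2.1, ratr i.2.2[%classic).
    by apply: measurableX; exact: measurable_RM.
  by apply/seteqP; split => z // [].
by rewrite (_ : F i = set0)//; apply/seteqP; split => z // [].
Qed.

Lemma continuous_measurable_plane f (E : set (RM * RM)) : continuous f ->
  measurable_fun E (f : RM * RM -> R).
Proof.
move=> /continuousP cf; apply: (@measurable_funS _ _ _ _ setT) => //.
apply: (measurability _ (RGenOpens.measurableE R)) => _ [_ [a [b ->] <-]].
by rewrite setTI; apply: open_measurable_plane; apply: cf; exact: interval_open.
Qed.

Lemma smooth_continuous f : smooth f -> continuous f.
Proof. by move=> /(_ [::])[]. Qed.

Lemma smooth_derive f v : smooth f -> smooth ('D_v f).
Proof.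
by move=> sf vs; have := sf (rcons vs v); rewrite /iter_deriv foldr_rcons.
Qed.

Lemma smooth_bounded f (K : set (R * R)) : smooth f -> compact K ->
  exists M : R, forall z, K z -> `|f z| <= M.
Proof.
move=> /smooth_continuous cf cK.
have /compact_bounded : compact (f @` K).
  by apply: continuous_compact => //; exact: continuous_subspaceT.
rewrite /bounded_set /= => /pinfty_ex_gt0[M M0 H]; exists M => z Kz.
by apply: H => /=; exists z.
Qed.

Lemma smooth_L2 f (a b c d : R) : smooth f ->
  L2 (mu \x mu)%E (`]a, b[%classic `*` `]c, d[%classic : set (RM * RM)) f.
Proof.
move=> sf; pose D : set (RM * RM) := `]a, b[%classic `*` `]c, d[%classic.
have mD : measurable D by apply: measurableX; exact: measurable_RM.
have [M HM] : exists M : R, forall z, (`[a, b] `*` `[c, d])%classic z -> `|f z| <= M.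
  by apply: smooth_bounded => //; apply: compact_setX; exact: segment_compact.
have fin : ((mu \x mu)%E D < +oo)%E.
  rewrite product_measure1E; [|exact: measurable_RM..].
  by rewrite lte_mul_pinfty ?measure_ge0//; [rewrite ge0_fin_numE//; exact: itv_finite|exact: itv_finite].
have H := @L2_bounded _ _ _ (mu \x mu)%E D (cst 1) f M mD.
have mf : measurable_fun D (f : RM * RM -> R) by apply: continuous_measurable_plane; exact: smooth_continuous.
have := H mf _ (L2_cst 1 mD fin).
rewrite (_ : (fun x => f x * cst 1 x) = f); last by apply/funext => z; rewrite /= mulr1.
by apply=> z [z1 z2]; apply: HM; split; apply: subset_itv_oo_cc.
Qed.

Lemma is_derive_line_x f (x y : R) : derivable f (x, y) ex ->
  is_derive x (1 : R) (fun s => f (s, y)) ('D_ex f (x, y)).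
Proof.
move=> df; have E (h : R) : f (h *: ex + (x, y)) = f (h *: 1 + x, y).
  by congr f; congr pair; rewrite /= ?scaler0 ?add0r// /GRing.scale /= mulr0 add0r.
have Ef : (fun h : R => h^-1 *: ((f \o shift (x, y)) (h *: ex) - f (x, y))) =
    (fun h : R => h^-1 *: (((fun s : R => f (s, y)) \o shift x) (h *: (1 : R)) - f (x, y))).
  by apply/funext => h; rewrite /= E.
apply: DeriveDef; first by move: df; rewrite /derivable Ef.
by rewrite /derive Ef.
Qed.

Lemma is_derive_line_y f (x y : R) : derivable f (x, y) ey ->
  is_derive y (1 : R) (fun s => f (x, s)) ('D_ey f (x, y)).
Proof.
move=> df; have E (h : R) : f (h *: ey + (x, y)) = f (x, h *: 1 + y).
  by congr f; congr pair; rewrite /= ?scaler0 ?add0r// /GRing.scale /= mulr0 add0r.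
have Ef : (fun h : R => h^-1 *: ((f \o shift (x, y)) (h *: ey) - f (x, y))) =
    (fun h : R => h^-1 *: (((fun s : R => f (x, s)) \o shift y) (h *: (1 : R)) - f (x, y))).
  by apply/funext => h; rewrite /= E.
apply: DeriveDef; first by move: df; rewrite /derivable Ef.
by rewrite /derive Ef.
Qed.

Lemma continuous_line_x f (y : R) : continuous f -> continuous (fun s : R => f (s, y)).
Proof.
move=> cf x; apply: (@continuous_comp _ _ _ (fun s : R => (s, y)) f); last exact: cf.
by apply: (@cvg_pair _ _ _ _ (nbhs x) (nbhs y)); [exact: cvg_id|exact: cvg_cst].
Qed.

Lemma continuous_line_y f (x : R) : continuous f -> continuous (fun s : R => f (x, s)).
Proof.
move=> cf y; apply: (@continuous_comp _ _ _ (fun s : R => (x, s)) f); last exact: cf.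
by apply: (@cvg_pair _ _ _ _ (nbhs x) (nbhs y)); [exact: cvg_cst|exact: cvg_id].
Qed.

Lemma smooth_AC_x f (a b y : R) : a <= b -> smooth f ->
  AC a b (fun s => f (s, y)) (fun s => 'D_ex f (s, y)).
Proof.
move=> ab sf; apply: AC_derive => //.
  by move=> x _; apply: is_derive_line_x; have [_] := sf [::].
by apply: continuous_subspaceT; apply: (@continuous_line_x ('D_ex f)); apply: smooth_continuous; exact: smooth_derive.
Qed.

Lemma smooth_AC_y f (a b x : R) : a <= b -> smooth f ->
  AC a b (fun s => f (x, s)) (fun s => 'D_ey f (x, s)).
Proof.
move=> ab sf; apply: AC_derive => //.
  by move=> y _; apply: is_derive_line_y; have [_] := sf [::].
by apply: continuous_subspaceT; apply: (@continuous_line_y ('D_ey f)); apply: smooth_continuous; exact: smooth_derive.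
Qed.

Lemma L2normE (D : set (RM * RM)) f : measurable D ->
  L2norm D f = ((\int[(mu \x mu)%E]_(z in D) (f z ^+ 2)%:E) `^ 2^-1)%E.
Proof.
move=> mD; rewrite /L2norm Lnorm.unlock; rewrite [RHS](_ : _ = ((\int[(mu \x mu)%E]_z (((fun z => (f z ^+ 2)%:E) \_ D) z)) `^ 2^-1)%E); last by rewrite -integral_mkcond.
congr (_ `^ _)%E; apply: eq_integral => z _ /=.
rewrite !patchE; case: ifPn => _ /=.
  by rewrite powR_mulrn// real_normK// num_real.
by rewrite -[X in `|X|]/(0 : R) normr0 powR0.
Qed.

Lemma L2norm1E (I : set RM) (h : R -> R) : measurable I ->
  L2norm1 I h = ((\int[mu]_(z in I) (h z ^+ 2)%:E) `^ 2^-1)%E.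
Proof.
move=> mD; rewrite /L2norm1 Lnorm.unlock; rewrite [RHS](_ : _ = ((\int[mu]_z (((fun z => (h z ^+ 2)%:E) \_ I) z)) `^ 2^-1)%E); last by rewrite -integral_mkcond.
congr (_ `^ _)%E; apply: eq_integral => z _ /=.
rewrite !patchE; case: ifPn => _ /=.
  by rewrite powR_mulrn// real_normK// num_real.
by rewrite -[X in `|X|]/(0 : R) normr0 powR0.
Qed.

Lemma integral_sqr_ge0 d (T : measurableType d) (m : {measure set T -> \bar R}) (E : set T)
  (h : T -> R) : (0 <= \int[m]_(z in E) (h z ^+ 2)%:E)%E.
Proof. by apply: integral_ge0 => z _; rewrite lee_fin sqr_ge0. Qed.

Lemma poweR_half_sqr (x : \bar R) : (0 <= x)%E -> ((x `^ 2^-1) * (x `^ 2^-1) = x)%E.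
Proof.
case: x => [r| |]//; last by move=> _; rewrite poweRyr ?invr_eq0// mulyy.
by rewrite lee_fin => r0; rewrite poweR_EFin powR12_sqrt// -EFinM -expr2 sqr_sqrtr.
Qed.

Lemma poweR_half_cvg0 {T : Type} (F : set_system T) {FF : Filter F} (g : T -> \bar R) :
  (forall n, (0 <= g n)%E) -> (g n `^ 2^-1)%E @[n --> F] --> 0%E -> g n @[n --> F] --> 0%E.
Proof.
move=> g0 H; rewrite (_ : g = fun n => (g n `^ 2^-1 * g n `^ 2^-1)%E); last first.
  by apply/funext => n; rewrite poweR_half_sqr.
by rewrite -[X in _ --> X](mule0 0%E); apply: cvgeM.
Qed.

End SmoothFunctions.

(** * From traces to primitives with prescribed endpoint values *)

Section Traces.
Context {R : realType}.
Notation mu := (@lebesgue_measure R).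
Notation RM := (measurableTypeR R).
Variables (a b c d : R).
Implicit Types f g h v w : R * R -> R.

Let I : set RM := `]a, b[%classic.
Let J : set RM := `]c, d[%classic.
Let D : set (RM * RM) := `]a, b[%classic `*` `]c, d[%classic.
Let mI : measurable I. Proof. exact: measurable_RM. Qed.
Let mJ : measurable J. Proof. exact: measurable_RM. Qed.
Let mD : measurable D. Proof. exact: measurableX. Qed.

Let shrink (e x l r : R) : 0 < e -> l + e <= x -> x <= r - e -> l < x < r.
Proof. by move=> ? ? ?; apply/andP; split; lra. Qed.

Let expand (e x l r : R) : e <= x - l -> e <= r - x -> l + e <= x <= r - e.
Proof. by move=> ? ?; apply/andP; split; lra. Qed.

(** The open rectangle is exhausted by the compact rectangles at distance 1/(n + 1) from its
    sides. *)
Lemma locally_integrable_measurable f : locally_integrable_on D f -> measurable_fun D f.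
Proof.
move=> fi; pose K n : set (RM * RM) :=
  `[a + n.+1%:R^-1, b - n.+1%:R^-1] `*` `[c + n.+1%:R^-1, d - n.+1%:R^-1].
have mK n : measurable (K n) by apply: measurableX; exact: measurable_RM.
have KD n : K n `<=` D.
  have n0 : (0 : R) < n.+1%:R^-1 by rewrite invr_gt0.
  move=> z [/=]; rewrite !in_itv/= => /andP[? ?] /andP[? ?].
  by split; rewrite /= in_itv/=; exact: (shrink n0).
have -> : D = \bigcup_n K n.
  apply/seteqP; split=> [z [/=]|z [n _ /KD]//]; rewrite !in_itv/= => /andP[z1 z2] /andP[z3 z4].
  pose e := Num.min (Num.min (z.1 - a) (b - z.1)) (Num.min (z.2 - c) (d - z.2)).
  have e0 : 0 < e by rewrite /e !lt_min !subr_gt0 z1 z2 z3 z4.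
  have [n ne] : exists n, n.+1%:R^-1 < e.
    exists (Num.truncn e^-1); rewrite invf_plt ?posrE//.
    by have := truncnS_gt e^-1.
  have := ltW ne; rewrite /e !le_min => /andP[/andP[h1 h2] /andP[h3 h4]].
  by exists n => //; split; rewrite /= in_itv/=; exact: expand.
apply/measurable_fun_bigcup => // n.
have : (mu \x mu)%E.-integrable (K n) (EFin \o f).
  apply: fi; last exact: KD.
  by apply: compact_setX; exact: segment_compact.
by move=> /integrable_measurable.
Qed.

Lemma L2_swap f : L2 (mu \x mu)%E D f ->
  L2 (mu \x mu)%E (`]c, d[%classic `*` `]a, b[%classic : set (RM * RM)) (fun z => f (z.2, z.1)).
Proof.
move=> [mf fi]; split; last exact: (integrable_swap mI mJ fi).
apply: (@measurable_comp _ _ _ _ _ _ D) => //.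
  by move=> _ [z [z1 z2] <-].
apply: (@measurable_funS _ _ _ _ setT) => //; exact: measurable_swap.
Qed.

(** The weak derivative inside [has_trace] is hidden under an existential, hence the hypothesis that
    any such derivative agrees with [g]. The coordinates are exchanged because [trace_param] takes
    the parameter of the line first. With e = a or e = b this serves the left or the right side. *)
Lemma trace_x e v g : a < b -> a <= e <= b ->
  L2 (mu \x mu)%E D v -> L2 (mu \x mu)%E D g ->
  (forall vx, weak_deriv D [:: ex] v vx -> {ae (mu \x mu)%E, forall z, D z -> vx z = g z}) ->
  has_trace D (fun y => (e, y)) `]c, d[%classic v (cst 0) ->
  {ae mu, forall y, J y -> {ae mu, forall x, I x ->
     v (x, y) = \int[mu]_(s in `]a, x[) g (s, y) - \int[mu]_(s in `]a, e[) g (s, y)}}.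
Proof.
move=> ab eab Lv Lg Wg [phi [vx [vy [[sphi Wx _] [c1 c2 _ c3]]]]].
have E0 := Wg _ Wx.
have mvx : measurable_fun D (vx : RM * RM -> R).
  by apply: locally_integrable_measurable; have [] := Wx.
have Lvx : L2 (mu \x mu)%E D vx.
  by apply: L2_ae Lg => //; move: E0; apply: (@ae_imp _ _ _ (mu \x mu)%E) => z Ez Dz; rewrite Ez.
have Lphi n := smooth_L2 a b c d (sphi n).
have Lphi' n := smooth_L2 a b c d (smooth_derive ex (sphi n)).
have cvg_swap (f : nat -> R * R -> R) w : (forall n, L2 (mu \x mu)%E D (f n)) ->
    L2 (mu \x mu)%E D w -> L2norm D (f n \- w) @[n --> \oo] --> 0%E ->
    (\int[(mu \x mu)%E]_(z in J `*` I) ((w (z.2, z.1) - f n (z.2, z.1)) ^+ 2)%:E)%E @[n --> \oo] --> 0%E.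
  move=> Lf Lw; under eq_fun do rewrite (L2normE _ mD); move=> /poweR_half_cvg0 H.
  have {}H := H (fun n => integral_sqr_ge0 _ _ _).
  rewrite (_ : (fun n => _) = (fun n => \int[(mu \x mu)%E]_(z in D) ((f n \- w) z ^+ 2)%:E)%E) //.
  apply/funext => n.
  have [mB _] := L2B mD Lw (Lf n).
  have mB2 : measurable_fun D (fun z => ((w z - f n z) ^+ 2)%:E : \bar R).
    by apply/measurable_EFinP; apply: measurable_funX.
  have [mB' _] := L2_swap (L2B mD Lw (Lf n)).
  have mB2' : measurable_fun (J `*` I) (fun z => ((w (z.2, z.1) - f n (z.2, z.1)) ^+ 2)%:E : \bar R).
    by apply/measurable_EFinP; apply: measurable_funX.
  rewrite (tonelli_rect mu mu mJ mI mB2'); last by move=> z; rewrite lee_fin sqr_ge0.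
  rewrite -(tonelli_rect_swap mu mu mI mJ mB2); last by move=> z; rewrite lee_fin sqr_ge0.
  by apply: eq_integral => z _ /=; rewrite -sqrrN opprB.
have E := @trace_param _ _ _ mu J mJ a b e (fun z => v (z.2, z.1)) (fun z => vx (z.2, z.1))
  (fun n z => phi n (z.2, z.1)) (fun n z => 'D_ex (phi n) (z.2, z.1)) ab eab
  (L2_swap Lv) (L2_swap Lvx) (fun n => L2_swap (Lphi n)) (fun n => L2_swap (Lphi' n)).
have /E{}E : forall n z, J z -> AC a b (fun x => phi n (x, z)) (fun x => 'D_ex (phi n) (x, z)).
  by move=> n z _; apply: smooth_AC_x => //; exact: ltW.
have /E{}E : forall n, measurable_fun J (fun z => phi n (e, z)).
  move=> n; apply: (@measurable_funS _ _ _ _ setT) => //; apply: continuous_measurable_fun.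
  by apply: continuous_line_y; exact: smooth_continuous.
have {}E := E (cvg_swap _ _ Lphi Lv c1) (cvg_swap (fun n => 'D_ex (phi n)) _ Lphi' Lvx c2).
have {}E : {ae mu, forall y, J y -> {ae mu, forall x, I x ->
     v (x, y) = \int[mu]_(s in `]a, x[) vx (s, y) - \int[mu]_(s in `]a, e[) vx (s, y)}}.
  apply: E; move: c3; under eq_fun do rewrite (L2norm1E _ mJ); move=> /poweR_half_cvg0 H.
  have {}H := H (fun n => integral_sqr_ge0 _ _ _).
  by move: H; under eq_fun do under eq_integral do rewrite /= subr0.
have := ae_and E (ae_prod_swap E0); apply: (@ae_imp _ _ _ mu) => y [H1 H2] yJ.
move: (H1 yJ); apply: (@ae_imp _ _ _ mu) => x Hx xI; rewrite (Hx xI).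
have cong (x' : R) : x' <= b -> \int[mu]_(s in `]a, x'[) vx (s, y) = \int[mu]_(s in `]a, x'[) g (s, y).
  move=> x'b; have sub : `]a, x'[ `<=` I by apply: subset_itvl; rewrite bnd_simp.
  have mS h : L2 (mu \x mu)%E D h -> measurable_fun `]a, x'[ (fun s : RM => h (s, y)).
    move=> /L2_swap[mh _]; apply: (measurable_funS mI sub).
    exact: (@measurable_section _ _ _ _ _ J I mJ mI (fun z => h (z.2, z.1)) y yJ mh).
  apply: ae_eq_RintegralP; [exact: measurable_RM|exact: mS|exact: mS|].
  by move: H2; apply: (@ae_imp _ _ _ mu) => s Hs /sub sI; apply: Hs; split.
have eb : e <= b by case/andP: eab.
rewrite !cong//; apply: ltW; move: xI; rewrite /I /= in_itv/= => /andP[]//.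
Qed.

Lemma trace_y e v g : c < d -> c <= e <= d ->
  L2 (mu \x mu)%E D v -> L2 (mu \x mu)%E D g ->
  (forall vy, weak_deriv D [:: ey] v vy -> {ae (mu \x mu)%E, forall z, D z -> vy z = g z}) ->
  has_trace D (fun x => (x, e)) `]a, b[%classic v (cst 0) ->
  {ae mu, forall x, I x -> {ae mu, forall y, J y ->
     v (x, y) = \int[mu]_(s in `]c, y[) g (x, s) - \int[mu]_(s in `]c, e[) g (x, s)}}.
Proof.
move=> cd ecd Lv Lg Wg [phi [vx [vy [[sphi _ Wy] [c1 _ c2 c3]]]]].
have E0 := Wg _ Wy.
have mvy : measurable_fun D (vy : RM * RM -> R).
  by apply: locally_integrable_measurable; have [] := Wy.
have Lvy : L2 (mu \x mu)%E D vy.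
  by apply: L2_ae Lg => //; move: E0; apply: (@ae_imp _ _ _ (mu \x mu)%E) => z Ez Dz; rewrite Ez.
have Lphi n := smooth_L2 a b c d (sphi n).
have Lphi' n := smooth_L2 a b c d (smooth_derive ey (sphi n)).
have cvg_int (f : nat -> R * R -> R) w : L2norm D (f n \- w) @[n --> \oo] --> 0%E ->
    (\int[(mu \x mu)%E]_(z in I `*` J) ((w z - f n z) ^+ 2)%:E)%E @[n --> \oo] --> 0%E.
  under eq_fun do rewrite (L2normE _ mD); move=> /poweR_half_cvg0 H.
  have {}H := H (fun n => integral_sqr_ge0 _ _ _).
  rewrite (_ : (fun n => _) = (fun n => \int[(mu \x mu)%E]_(z in D) ((f n \- w) z ^+ 2)%:E)%E) //.
  by apply/funext => n; apply: eq_integral => z _ /=; rewrite -sqrrN opprB.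
have E := @trace_param _ _ _ mu I mI c d e v vy phi (fun n => 'D_ey (phi n)) cd ecd
  Lv Lvy Lphi Lphi'.
have /E{}E : forall n z, I z -> AC c d (fun y => phi n (z, y)) (fun y => 'D_ey (phi n) (z, y)).
  by move=> n z _; apply: smooth_AC_y => //; exact: ltW.
have /E{}E : forall n, measurable_fun I (fun z => phi n (z, e)).
  move=> n; apply: (@measurable_funS _ _ _ _ setT) => //; apply: continuous_measurable_fun.
  by apply: continuous_line_x; exact: smooth_continuous.
have {}E := E (cvg_int _ _ c1) (cvg_int (fun n => 'D_ey (phi n)) _ c2).
have {}E : {ae mu, forall x, I x -> {ae mu, forall y, J y ->
     v (x, y) = \int[mu]_(s in `]c, y[) vy (x, s) - \int[mu]_(s in `]c, e[) vy (x, s)}}.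
  apply: E; move: c3; under eq_fun do rewrite (L2norm1E _ mI); move=> /poweR_half_cvg0 H.
  have {}H := H (fun n => integral_sqr_ge0 _ _ _).
  by move: H; under eq_fun do under eq_integral do rewrite /= subr0.
have := ae_and E (ae_prodP E0); apply: (@ae_imp _ _ _ mu) => x [H1 H2] xI.
move: (H1 xI); apply: (@ae_imp _ _ _ mu) => y Hy yJ; rewrite (Hy yJ).
have cong (y' : R) : y' <= d -> \int[mu]_(s in `]c, y'[) vy (x, s) = \int[mu]_(s in `]c, y'[) g (x, s).
  move=> y'd; have sub : `]c, y'[ `<=` J by apply: subset_itvl; rewrite bnd_simp.
  have mS h : L2 (mu \x mu)%E D h -> measurable_fun `]c, y'[ (fun s : RM => h (x, s)).
    move=> [mh _]; apply: (measurable_funS mJ sub).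
    exact: (@measurable_section _ _ _ _ _ I J mI mJ h x xI mh).
  apply: ae_eq_RintegralP; [exact: measurable_RM|exact: mS|exact: mS|].
  by move: H2; apply: (@ae_imp _ _ _ mu) => s Hs /sub sJ; apply: Hs; split.
have ed : e <= d by case/andP: ecd.
rewrite !cong//; apply: ltW; move: yJ; rewrite /J /= in_itv/= => /andP[]//.
Qed.

End Traces.

(** * Energy identities on a line *)

Section EnergyLine.
Context {R : realType}.
Notation mu := (@lebesgue_measure R).
Notation RM := (measurableTypeR R).
Variables (a b : R).
Hypothesis ab : a < b.
Implicit Types V P Q f g q r : R -> R.

Let mI := measurable_RM `]a, b[.

Lemma AC_affine (al be : R) : AC a b (fun x => al + be * (x - a)) (cst be).
Proof.
apply: AC_derive; first exact: ltW.
  move=> x _; have D : is_derive x (1 : R) (fun x => al + be * (x - a)) (0 + be *: (1 - 0)).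
    by apply: is_deriveD; apply: is_deriveZ; apply: is_deriveB.
  by case: D => d v; apply: DeriveDef => //; rewrite v add0r subr0 /GRing.scale /= mulr1.
by apply: continuous_subspaceT => x; exact: cvg_cst.
Qed.

Lemma AC_end0 V f : AC a b V f -> V a = 0 -> V b = 0 -> \int[mu]_(x in `]a, b[) f x = 0.
Proof. by move=> /(AC_increment (ltW ab)) -> -> ->; rewrite subrr. Qed.

(** V(x)^2 equals both 2 int_a^x V f and -2 int_x^b V f. Half their sum is int_a^x V f - int_x^b V
    f, which saves the factor 2 that a single endpoint would cost. *)
Lemma sup_le_integral V f x : AC a b V f -> V a = 0 -> V b = 0 -> a <= x <= b ->
  V x ^+ 2 <= \int[mu]_(s in `]a, b[) `|V s * f s|.
Proof.
move=> Vf Va Vb xab; have VVf := AC_M Vf Vf.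
have Vfi := AC_mul_integrable Vf Vf.1.
have Vfi' : mu.-integrable `]a, b[ (EFin \o (fun s => V s * f s)) by [].
have Vfa := integrableR_abs mI Vfi'.
have [i2 E] := VVf; have := E x xab; rewrite Va mul0r add0r => E1.
have := Rintegral_split xab i2; have := AC_end0 VVf; rewrite Va Vb !mul0r => /(_ erefl erefl) ->.
rewrite -E1 => /esym/eqP; rewrite addr_eq0 => /eqP E2.
have /andP[ax xb] := xab.
have sub1 : mu.-integrable `]a, x[ (EFin \o (fun s => V s * f s)) by exact: integrable_suboo Vfi'.
have sub2 : mu.-integrable `]x, b[ (EFin \o (fun s => V s * f s)) by exact: integrable_suboo Vfi'.
rewrite (Rintegral_split xab Vfa).
have D2 y z : mu.-integrable `]y, z[ (EFin \o (fun s => V s * f s)) ->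
    \int[mu]_(s in `]y, z[) (V s * f s + V s * f s) = 2 * \int[mu]_(s in `]y, z[) (V s * f s).
  by move=> i; rewrite (RintegralD (measurable_RM _) i i) mulr_natl mulr2n.
have B1 : `|\int[mu]_(s in `]a, x[) (V s * f s)| <= \int[mu]_(s in `]a, x[) `|V s * f s|.
  exact: le_normr_Rintegral.
have B2 : `|\int[mu]_(s in `]x, b[) (V s * f s)| <= \int[mu]_(s in `]x, b[) `|V s * f s|.
  exact: le_normr_Rintegral.
move: E1 E2; rewrite (D2 _ _ sub1) (D2 _ _ sub2) -expr2.
move: B1 B2; rewrite !ler_norml.
move: (\int[mu]_(s in `]a, x[) _) (\int[mu]_(s in `]a, x[) _) => i1 j1.
move: (\int[mu]_(s in `]x, b[) _) (\int[mu]_(s in `]x, b[) _) (V x ^+ 2) => k1 l1 m.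
move=> /andP[? ?] /andP[? ?] ? ?; lra.
Qed.

Let ctr := (a + b) / 2.
(** A parabola in place of the first eigenfunction: phi'' is the constant -6/(b - a)^2, and 1/4 <=
    phi <= 1 on the segment, so -phi''/phi >= 6/(b - a)^2. This is where the 6 comes from. *)
Let phi (x : R) := 1 - 3 * ((x - ctr) / (b - a)) ^+ 2.
Let dphi (x : R) := - 6 / (b - a) ^+ 2 * (x - ctr).
Let h x := dphi x / phi x.

Let phi_bounds x : a <= x <= b -> 4^-1 <= phi x <= 1.
Proof.
move=> /andP[ax xb]; rewrite /phi; set r := _ / _.
have ba : 0 < b - a by rewrite subr_gt0.
have r1 : r <= 2^-1 by rewrite /r ler_pdivrMr// /ctr; lra.
have r2 : - 2^-1 <= r by rewrite /r ler_pdivlMr// /ctr; lra.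
have r3 : r ^+ 2 <= 4^-1 by rewrite expr2; nra.
have r4 := sqr_ge0 r; move: r3 r4; move: (r ^+ 2) => r3 ? ?.
by apply/andP; split; lra.
Qed.

(** The Riccati equation h' = phi''/phi - h^2 of a logarithmic derivative. *)
Let is_derive_h x : a <= x <= b ->
  is_derive x (1 : R) h (- 6 / (b - a) ^+ 2 / phi x - h x ^+ 2).
Proof.
move=> /phi_bounds /andP[p0 p1]; have pn0 : phi x != 0 by apply/eqP => E; lra.
have ba : b - a != 0 by rewrite subr_eq0 gt_eqF.
have D0 : is_derive x (1 : R) (fun x => x - ctr) 1.
  have D : is_derive x (1 : R) (fun x => x - ctr) (1 - 0) by exact: is_deriveB.
  by case: D => d v; apply: DeriveDef => //; rewrite v subr0.
have D1 : is_derive x (1 : R) dphi (- 6 / (b - a) ^+ 2).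
  have D := is_deriveZ (- 6 / (b - a) ^+ 2) D0.
  by case: D => d v; apply: DeriveDef => //; rewrite v /GRing.scale /= mulr1.
have D2 : is_derive x (1 : R) phi (dphi x).
  have DD : is_derive x (1 : R) (fun x => 1 - (3 / (b - a) ^+ 2) * ((x - ctr) * (x - ctr))) (dphi x).
    have D := is_deriveB (is_derive_cst (1 : R) x (1 : R)) (is_deriveZ (3 / (b - a) ^+ 2) (is_deriveM D0 D0)).
    case: D => d v; apply: DeriveDef => //; rewrite v /dphi /GRing.scale /=.
    by field.
  rewrite (_ : phi = fun x => 1 - (3 / (b - a) ^+ 2) * ((x - ctr) * (x - ctr)))//.
  by apply/funext => y; rewrite /phi; field.
have D3 := is_deriveM D1 (is_deriveV pn0 D2).
case: D3 => d v; apply: DeriveDef; first exact: d.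
rewrite [LHS]v /h /GRing.scale /=; move: (dphi x) (phi x) pn0 => u w w0.
by field; apply/andP.
Qed.

Let AC_h : AC a b h (fun x => - 6 / (b - a) ^+ 2 / phi x - h x ^+ 2).
Proof.
apply: AC_derive; [exact: ltW|exact: is_derive_h|].
have ch : {within `[a, b], continuous h}.
  apply: derivable_within_continuous => x; rewrite in_itv/= => /is_derive_h[] //.
have cp : {within `[a, b], continuous (fun x => (phi x)^-1)}.
  apply: continuous_in_subspaceT => x; rewrite inE /= in_itv/= => /phi_bounds/andP[p0 _].
  apply: cvgV; first by apply/eqP => E; lra.
  rewrite /phi; apply: cvgB; first exact: cvg_cst.
  apply: cvgM; first exact: cvg_cst.
  have c : ((x0 - ctr) / (b - a)) @[x0 --> x] --> (x - ctr) / (b - a).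
    by apply: cvgM; [apply: cvgB; [exact: cvg_id|exact: cvg_cst]|exact: cvg_cst].
  by rewrite expr2; under eq_fun do rewrite expr2; exact: cvgM.
move=> x; apply: cvgB; first by apply: cvgM; [exact: cvg_cst|exact: cp].
exact: (cvgM (ch x) (ch x)).
Qed.

(* Completing the square in (V' - h V)^2 with h = phi'/phi, where phi > 0 is
   concave: this is Poincare's inequality with the constant
   6 in place of the optimal pi^2. *)
Lemma poincare V f : AC a b V f -> L2 mu `]a, b[ f -> V a = 0 -> V b = 0 ->
  6 / (b - a) ^+ 2 * \int[mu]_(x in `]a, b[) V x ^+ 2 <= \int[mu]_(x in `]a, b[) f x ^+ 2.
Proof.
move=> Vf Lf Va Vb; have A := AC_M AC_h (AC_M Vf Vf).
have [iA _] := A; have E0 := AC_end0 A; rewrite Va Vb !mul0r !mulr0 in E0.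
have {}E0 := E0 erefl erefl.
have iV2 : mu.-integrable `]a, b[ (EFin \o (fun x => V x * V x)).
  exact: AC_mul_integrable Vf (AC_integrable Vf).
have iV2' : mu.-integrable `]a, b[ (EFin \o (fun x => V x ^+ 2)) by [].
have i1 := integrableRZ (6 / (b - a) ^+ 2) mI iV2'.
have i2 := integrableRB mI Lf.2 i1.
rewrite -subr_ge0 -(RintegralZl _ mI iV2') -(RintegralB mI Lf.2 i1).
(* The subtracted term is the density of h V^2, which vanishes at both ends; it completes the
   square, and the remainder is (k/phi - k) V^2 with k = 6/(b - a)^2. *)
have -> : \int[mu]_(x in `]a, b[) (f x ^+ 2 - 6 / (b - a) ^+ 2 * V x ^+ 2) =
    \int[mu]_(x in `]a, b[) (f x ^+ 2 - 6 / (b - a) ^+ 2 * V x ^+ 2 - (h x * (V x * f x + V x * f x) +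
       V x * V x * (-6 / (b - a) ^+ 2 / phi x - h x ^+ 2))).
  by rewrite (RintegralB mI i2 iA) E0 subr0.
apply: Rintegral_ge0 => x; rewrite /= in_itv/= => /andP[ax xb].
have /phi_bounds/andP[] : a <= x <= b by rewrite !ltW.
move=> p0 p1; set k := 6 / (b - a) ^+ 2.
have k0 : 0 <= k by rewrite /k divr_ge0// sqr_ge0.
have -> : - 6 / (b - a) ^+ 2 = - k by rewrite /k mulNr.
have kp : k <= k / phi x by rewrite ler_peMr// invf_ge1//; lra.
rewrite mulNr; move: kp; move: (k / phi x) (h x) (V x) (f x) => kp hx vx fx kkp.
rewrite [leRHS](_ : _ = (fx - hx * vx) ^+ 2 + (kp - k) * vx ^+ 2); last by ring.
by rewrite addr_ge0 ?sqr_ge0// mulr_ge0 ?sqr_ge0// subr_ge0.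
Qed.

(** With w = al + be (x - a), the function w V q - be V f - w f^2/2 has density w V g - (3/2) be
    f^2. It vanishes at b and equals -al f(a)^2/2 at a. *)
Let boundary_xxx (al be : R) V f q g : AC a b V f -> AC a b f q -> AC a b q g ->
  V a = 0 -> V b = 0 -> f b = 0 ->
  \int[mu]_(x in `]a, b[) ((al + be * (x - a)) * (V x * g x)) =
  3 / 2 * be * (\int[mu]_(x in `]a, b[) f x ^+ 2) + 2^-1 * al * f a ^+ 2.
Proof.
move=> Vf fq qg Va Vb fb; have W := AC_affine al be.
have A := AC_M W (AC_M Vf qg).
have A' := AC_Z (- be) (AC_M Vf fq).
have A'' := AC_Z (- 2^-1) (AC_M W (AC_M fq fq)).
have S := AC_D (AC_D A A') A''.
have if2 : mu.-integrable `]a, b[ (EFin \o (fun x => f x ^+ 2)).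
  by have := AC_mul_integrable fq (AC_integrable fq).
have iT : mu.-integrable `]a, b[ (EFin \o (fun x => (al + be * (x - a)) * (V x * g x))).
  exact: AC_mul_integrable W (AC_mul_integrable Vf qg.1).
have i2 := integrableRZ (3 / 2 * be) mI if2.
have := AC_increment (ltW ab) S.
rewrite Va Vb fb !subrr !mulr0 !mul0r !mulr0 !addr0.
rewrite (_ : \int[mu]_(x in `]a, b[) _ = \int[mu]_(x in `]a, b[) ((al + be * (x - a)) * (V x * g x) - 3 / 2 * be * f x ^+ 2)).
  rewrite (RintegralB mI iT i2) (RintegralZl _ mI if2).
  move: (\int[mu]_(x in `]a, b[) _) (\int[mu]_(x in `]a, b[) _) (f a) => X Y Z E.
  by move: E; rewrite expr2 -!mulNr => E; lra.
by apply: eq_Rintegral => x _; rewrite /cst; field.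
Qed.

Lemma energy_xxx (al be : R) V f q g : AC a b V f -> AC a b f q -> AC a b q g ->
  V a = 0 -> V b = 0 -> f b = 0 -> 0 <= al ->
  3 / 2 * be * (\int[mu]_(x in `]a, b[) f x ^+ 2) <=
  \int[mu]_(x in `]a, b[) ((al + be * (x - a)) * (V x * g x)).
Proof.
move=> Vf fq qg Va Vb fb al0; rewrite (boundary_xxx al be Vf fq qg Va Vb fb).
by rewrite lerDl mulr_ge0 ?sqr_ge0// mulr_ge0.
Qed.

Lemma energy_mixed (al be : R) V f : AC a b V f -> V a = 0 -> V b = 0 ->
  \int[mu]_(x in `]a, b[) ((al + be * (x - a)) * (V x * f x)) =
  - (be / 2) * \int[mu]_(x in `]a, b[) V x ^+ 2.
Proof.
move=> Vf Va Vb; have W := AC_affine al be.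
have S := AC_Z 2^-1 (AC_M W (AC_M Vf Vf)).
have iV : mu.-integrable `]a, b[ (EFin \o (fun x => V x ^+ 2)).
  by have := AC_mul_integrable Vf (AC_integrable Vf).
have iT : mu.-integrable `]a, b[ (EFin \o (fun x => (al + be * (x - a)) * (V x * f x))).
  exact: AC_mul_integrable W (AC_mul_integrable Vf Vf.1).
have i2 := integrableRZ (- (be / 2)) mI iV.
have := AC_increment (ltW ab) S; rewrite Va Vb !mul0r !mulr0 subrr.
rewrite (_ : \int[mu]_(x in `]a, b[) _ = \int[mu]_(x in `]a, b[) ((al + be * (x - a)) * (V x * f x) - - (be / 2) * V x ^+ 2)).
  by rewrite (RintegralB mI iT i2) (RintegralZl _ mI iV) => /eqP; rewrite subr_eq0 => /eqP.
by apply: eq_Rintegral => x _; rewrite /cst; field.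
Qed.

Lemma energy_nonlinear (al be : R) V f : AC a b V f -> V a = 0 -> V b = 0 ->
  \int[mu]_(x in `]a, b[) ((al + be * (x - a)) * (V x * (V x * f x))) =
  - (be / 3) * \int[mu]_(x in `]a, b[) V x ^+ 3.
Proof.
move=> Vf Va Vb; have W := AC_affine al be.
have S := AC_Z 3^-1 (AC_M W (AC_M Vf (AC_M Vf Vf))).
have iV : mu.-integrable `]a, b[ (EFin \o (fun x => V x ^+ 3)).
  rewrite (_ : (fun x => V x ^+ 3) = fun x => V x * (V x * V x)); last first.
    by apply/funext => x; ring.
  exact: AC_mul_integrable Vf (AC_mul_integrable Vf (AC_integrable Vf)).
have iT : mu.-integrable `]a, b[ (EFin \o (fun x => (al + be * (x - a)) * (V x * (V x * f x)))).
  exact: AC_mul_integrable W (AC_mul_integrable Vf (AC_mul_integrable Vf Vf.1)).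
have i2 := integrableRZ (- (be / 3)) mI iV.
have := AC_increment (ltW ab) S; rewrite Va Vb !mul0r !mulr0 subrr.
rewrite (_ : \int[mu]_(x in `]a, b[) _ = \int[mu]_(x in `]a, b[) ((al + be * (x - a)) * (V x * (V x * f x)) - - (be / 3) * V x ^+ 3)).
  by rewrite (RintegralB mI iT i2) (RintegralZl _ mI iV) => /eqP; rewrite subr_eq0 => /eqP.
by apply: eq_Rintegral => x _; rewrite /cst; field.
Qed.

Lemma energy_cross V f q g : AC a b V f -> AC a b q g -> V a = 0 -> V b = 0 ->
  \int[mu]_(x in `]a, b[) (V x * g x) = - \int[mu]_(x in `]a, b[) (f x * q x).
Proof.
move=> Vf qg Va Vb; have S := AC_M Vf qg; have iT := AC_mul_integrable Vf qg.1.
have i2 := AC_mul_integrable qg Vf.1.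
have := AC_increment (ltW ab) S; rewrite Va Vb !mul0r subrr.
rewrite (RintegralD mI iT i2) => /eqP; rewrite addr_eq0 => /eqP ->; congr (- _).
by apply: eq_Rintegral => x _; rewrite mulrC.
Qed.

End EnergyLine.

(* With E = 3a + b, s^2 <= (9/16) E and N^4 <= s^4 E^2 / 12 give N <= E / 2. *)
Lemma cubic_absorption (R : realFieldType) (s a b N p q : R) : 0 < p -> 0 < q -> 0 <= s ->
  6 * p * s <= a -> 6 * q * s <= b -> N ^+ 4 <= s ^+ 4 * (a * b) ->
  s <= 9 / 8 * ((3 * p + q) ^+ 2 / (p + q)) ->
  4 * (3 * p + q) * s <= 3 * a + b - 2 / 3 * N.
Proof.
move=> p0 q0 s0 pa qb N4 sK; pose E := 3 * a + b; pose r := 3 * p + q.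
have r0 : 0 < r by rewrite /r; lra.
have ps0 : 0 <= p * s by rewrite mulr_ge0// ltW.
have qs0 : 0 <= q * s by rewrite mulr_ge0// ltW.
have rE : 6 * (r * s) <= E.
  by rewrite /E /r; nra.
have a0 : 0 <= a by nra.
have b0 : 0 <= b by nra.
have E0 : 0 <= E by rewrite /E; lra.
(* Uses r^2/(p + q) <= 3 r and (9/8) 3 = 27/8. Combined with 6 r s <= E, it yields the factor
   (27/8)/6 = 9/16 below. *)
have sr : s <= 27 / 8 * r.
  apply: le_trans sK _; have -> : 27 / 8 * r = 9 / 8 * (3 * r) by lra.
  rewrite ler_wpM2l ?divr_ge0// ler_pdivrMr ?addr_gt0// expr2 -/r.
  have : r * r <= r * (3 * (p + q)) by rewrite ler_wpM2l ?ltW// /r; lra.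
  by lra.
have s2 : s ^+ 2 <= 9 / 16 * E.
  have h : s * s <= s * (27 / 8 * r) by rewrite ler_wpM2l.
  by rewrite expr2; lra.
have s4 : s ^+ 4 <= 81 / 256 * E ^+ 2.
  have -> : s ^+ 4 = s ^+ 2 * s ^+ 2 by ring.
  have -> : 81 / 256 * E ^+ 2 = (9 / 16 * E) * (9 / 16 * E) by field.
  by rewrite ler_pM ?sqr_ge0.
(* Arithmetic-geometric mean: E^2 - 12 a b = (3 a - b)^2. *)
have abE : a * b <= E ^+ 2 / 12.
  by have := sqr_ge0 (3 * a - b); rewrite /E !expr2; nra.
have N4E : N ^+ 4 <= 81 / 3072 * E ^+ 4.
  apply: le_trans N4 _; have -> : 81 / 3072 * E ^+ 4 = (81 / 256 * E ^+ 2) * (E ^+ 2 / 12) by field.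
  by rewrite ler_pM ?mulr_ge0 ?exprn_ge0.
(* Since 81/3072 < 1/16, N > E/2 would contradict the bound on N^4. *)
have NE : N <= E / 2.
  rewrite leNgt; apply/negP => NE.
  have : (E / 2) ^+ 4 < N ^+ 4 by rewrite ltrXn2r// ?nnegrE; lra.
  have -> : (E / 2) ^+ 4 = E ^+ 4 / 16 by field.
  have := exprn_ge0 4 E0; move: N4E; move: (E ^+ 4) (N ^+ 4) => e n; lra.
(* The cubic term takes (2/3)(E/2) = E/3, and two thirds of E >= 6 r s remain. *)
by rewrite -/E -/r; move: rE; rewrite -mulrA; move: (r * s) => rs; lra.
Qed.

(** * Energy inequalities on the rectangle at a fixed time *)

Section SliceEnergy.
Context {R : realType}.
Notation mu := (@lebesgue_measure R).
Notation RM := (measurableTypeR R).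
Variables (a b c d : R).
Hypotheses (ab : a < b) (cd : c < d).
Variables v vx vy vxy vxxx vxyy : R * R -> R.

Let I : set RM := `]a, b[%classic.
Let J : set RM := `]c, d[%classic.
Let D : set (RM * RM) := `]a, b[%classic `*` `]c, d[%classic.
Let mI : measurable I. Proof. exact: measurable_RM. Qed.
Let mJ : measurable J. Proof. exact: measurable_RM. Qed.
Let mD : measurable D. Proof. exact: measurableX. Qed.

(** All that the estimates use of a solution at a fixed time. The absolutely continuous
    representatives are chosen line by line and agree with the functions almost everywhere on the
    line; [ds_xy] records separately that v_y too vanishes at both ends in x. *)
Record dirichlet_slice : Prop := {
  ds_v : L2 (mu \x mu)%E D v ;
  ds_vx : L2 (mu \x mu)%E D vx ;
  ds_vy : L2 (mu \x mu)%E D vy ;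
  ds_vxy : L2 (mu \x mu)%E D vxy ;
  ds_vxxx : L2 (mu \x mu)%E D vxxx ;
  ds_vxyy : L2 (mu \x mu)%E D vxyy ;
  ds_x : {ae mu, forall y, J y -> exists V f q : R -> R,
    [/\ AC a b V f, AC a b f q & AC a b q (fun x => vxxx (x, y))] /\
    [/\ V a = 0, V b = 0 & f b = 0] /\
    {ae mu, forall x, I x -> v (x, y) = V x /\ vx (x, y) = f x}} ;
  ds_xy : {ae mu, forall y, J y -> exists U : R -> R,
    [/\ AC a b U (fun x => vxy (x, y)), U a = 0, U b = 0 &
    {ae mu, forall x, I x -> vy (x, y) = U x}]} ;
  ds_y : {ae mu, forall x, I x -> exists V q : R -> R,
    [/\ AC c d V (fun y => vy (x, y)), AC c d q (fun y => vxyy (x, y)), V c = 0 & V d = 0] /\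
    {ae mu, forall y, J y -> v (x, y) = V y /\ vxy (x, y) = q y}} }.

Hypothesis ds : dirichlet_slice.

Lemma L2_section_y f : L2 (mu \x mu)%E D f ->
  {ae mu, forall x, I x -> L2 mu `]c, d[ (fun y => f (x, y))}.
Proof. by move=> /(L2_section mI mJ). Qed.

Lemma L2_section_x f : L2 (mu \x mu)%E D f ->
  {ae mu, forall y, J y -> L2 mu `]a, b[ (fun x => f (x, y))}.
Proof. by move=> /L2_swap/(L2_section mJ mI). Qed.

Let w (al be : R) (z : R * R) := al + be * (z.1 - a).

Let measurable_w al be : measurable_fun D (w al be : RM * RM -> R).
Proof.
apply: measurable_funD; first exact: measurable_cst.
apply: measurable_funM; first exact: measurable_cst.
by apply: measurable_funB; [apply: measurable_funTS; exact: measurable_fst|exact: measurable_cst].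
Qed.

Let w_bounded al be z : D z -> `|w al be z| <= `|al| + `|be| * (b - a).
Proof.
case=> /=; rewrite in_itv/= => /andP[az zb] _; rewrite /w (le_trans (ler_normD _ _))// lerD2l normrM.
rewrite ler_wpM2l// ger0_norm; last by rewrite subr_ge0 ltW.
by rewrite lerB// ltW.
Qed.

Lemma integrable_affine al be f : (mu \x mu)%E.-integrable D (EFin \o f) ->
  (mu \x mu)%E.-integrable D (EFin \o (fun z => w al be z * f z)).
Proof.
move=> fi; have := integrable_mul_bounded mD (measurable_w al be) (@w_bounded al be) fi.
by apply: eq_integrable => // z _ /=; rewrite mulrC.
Qed.

Let iM f g : L2 (mu \x mu)%E D f -> L2 (mu \x mu)%E D g ->
  (mu \x mu)%E.-integrable D (EFin \o (fun z => f z * g z)).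
Proof. exact: L2M. Qed.

Lemma slice_xxx al be : 0 <= al ->
  3 / 2 * be * (\int[(mu \x mu)%E]_(z in D) vx z ^+ 2) <=
  \int[(mu \x mu)%E]_(z in D) (w al be z * (v z * vxxx z)).
Proof.
move=> al0; have i1 := (ds_vx ds).2.
have i2 := integrable_affine al be (iM (ds_v ds) (ds_vxxx ds)).
have [_ j1 <-] := Rfubini_swap mI mJ i1; have [_ j2 <-] := Rfubini_swap mI mJ i2.
rewrite -(RintegralZl _ mJ j1); apply: (le_ae_Rintegral mJ (integrableRZ _ mJ j1) j2).
have := ae_and (ds_x ds) (ae_and (L2_section_x (ds_v ds))
  (ae_and (L2_section_x (ds_vx ds)) (L2_section_x (ds_vxxx ds)))).
apply: (@ae_imp _ _ _ mu) => y [H [l1 [l2 l3]]] yJ.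
have [V [f [q [[Vf fq qg] [[Va Vb fb] E]]]]] := H yJ.
rewrite (@ae_eq_RintegralP _ _ _ mu I (fun x => vx (x, y) ^+ 2) (fun x => f x ^+ 2))//; first last.
- by move: E; apply: (@ae_imp _ _ _ mu) => x E xI; rewrite (E xI).2.
- by apply: measurable_funX; exact: AC_measurable fq.
- by apply: measurable_funX; exact: (l2 yJ).1.
rewrite [leRHS](@ae_eq_RintegralP _ _ _ mu I _ (fun x => (al + be * (x - a)) * (V x * vxxx (x, y))))//; first last.
- by move: E; apply: (@ae_imp _ _ _ mu) => x E xI; rewrite /w (E xI).1.
- apply: measurable_funM; first exact: AC_measurable (AC_affine ab al be).
  by apply: measurable_funM; [exact: AC_measurable Vf|exact: (l3 yJ).1].
- apply: measurable_funM; first exact: AC_measurable (AC_affine ab al be).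
  by apply: measurable_funM; [exact: (l1 yJ).1|exact: (l3 yJ).1].
exact: energy_xxx qg Va Vb fb al0.
Qed.

(** Two integrations by parts in different directions. In y the weight is constant, so w v v_xyy
    becomes -w v_y v_xy; in x the latter is -w (v_y^2)_x / 2, and the boundary values of v_y leave
    (be/2) v_y^2. *)
Lemma slice_xyy al be : \int[(mu \x mu)%E]_(z in D) (w al be z * (v z * vxyy z)) =
  be / 2 * \int[(mu \x mu)%E]_(z in D) vy z ^+ 2.
Proof.
have i1 := integrable_affine al be (iM (ds_v ds) (ds_vxyy ds)).
have i2 := integrable_affine al be (iM (ds_vy ds) (ds_vxy ds)).
transitivity (- \int[(mu \x mu)%E]_(z in D) (w al be z * (vy z * vxy z))).
  have [s1 j1 <-] := Rfubini mI mJ i1; have [_ j2 <-] := Rfubini mI mJ i2.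
  rewrite -(RintegralN mI j2); apply: (ae_eq_RintegralP mI).
  - exact: integrable_measurable j1.
  - by have := integrable_measurable (integrableRN mI j2).
  have := ae_and (ds_y ds) (ae_and (L2_section_y (ds_v ds)) (ae_and (L2_section_y (ds_vy ds))
    (ae_and (L2_section_y (ds_vxy ds)) (L2_section_y (ds_vxyy ds))))).
  apply: (@ae_imp _ _ _ mu) => x [H [l1 [l2 [l3 l4]]]] xI.
  have [V [q [[Vf qg Vc Vd] E]]] := H xI.
  have k1 := L2M mJ (l1 xI) (l4 xI); have k2 := L2M mJ (l2 xI) (l3 xI).
  have Z g : mu.-integrable J (EFin \o g) -> \int[mu]_(y in J) (w al be (x, y) * g y) =
      (al + be * (x - a)) * \int[mu]_(y in J) g y by move=> gi; rewrite -(RintegralZl _ mJ gi).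
  rewrite (Z _ k1) (Z _ k2) -mulrN; congr (_ * _).
  rewrite (@ae_eq_RintegralP _ _ _ mu J _ (fun y => V y * vxyy (x, y)))//; first last.
  - by move: E; apply: (@ae_imp _ _ _ mu) => y E yJ; rewrite (E yJ).1.
  - by apply: measurable_funM; [exact: AC_measurable Vf|exact: (l4 xI).1].
  - exact: integrable_measurable k1.
  rewrite [in RHS](@ae_eq_RintegralP _ _ _ mu J _ (fun y => vy (x, y) * q y))//; first last.
  - by move: E; apply: (@ae_imp _ _ _ mu) => y E yJ; rewrite (E yJ).2.
  - by apply: measurable_funM; [exact: (l2 xI).1|exact: AC_measurable qg].
  - exact: integrable_measurable k2.
  exact: energy_cross Vf qg Vc Vd.
have i3 := (ds_vy ds).2.
have [_ j2 <-] := Rfubini_swap mI mJ i2; have [_ j3 <-] := Rfubini_swap mI mJ i3.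
rewrite -[LHS]mulN1r -(RintegralZl _ mJ j2) -(RintegralZl _ mJ j3); apply: (ae_eq_RintegralP mJ).
- exact: integrable_measurable (integrableRZ _ mJ j2).
- exact: integrable_measurable (integrableRZ _ mJ j3).
have := ae_and (ds_xy ds) (ae_and (L2_section_x (ds_vy ds)) (L2_section_x (ds_vxy ds))).
apply: (@ae_imp _ _ _ mu) => y [H [l1 l2]] yJ.
have [U [Uf Ua Ub E]] := H yJ.
rewrite (@ae_eq_RintegralP _ _ _ mu I _ (fun x => (al + be * (x - a)) * (U x * vxy (x, y))))//; first last.
- by move: E; apply: (@ae_imp _ _ _ mu) => x E xI; rewrite /w (E xI).
- apply: measurable_funM; first exact: AC_measurable (AC_affine ab al be).
  by apply: measurable_funM; [exact: AC_measurable Uf|exact: (l2 yJ).1].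
- apply: measurable_funM; first exact: AC_measurable (AC_affine ab al be).
  by apply: measurable_funM; [exact: (l1 yJ).1|exact: (l2 yJ).1].
rewrite [in RHS](@ae_eq_RintegralP _ _ _ mu I _ (fun x => U x ^+ 2))//; first last.
- by move: E; apply: (@ae_imp _ _ _ mu) => x E xI; rewrite (E xI).
- by apply: measurable_funX; exact: AC_measurable Uf.
- by apply: measurable_funX; exact: (l1 yJ).1.
by rewrite (energy_mixed ab al be Uf Ua Ub) mulN1r mulNr opprK.
Qed.

Lemma slice_poincare_x : 6 / (b - a) ^+ 2 * (\int[(mu \x mu)%E]_(z in D) v z ^+ 2) <=
  \int[(mu \x mu)%E]_(z in D) vx z ^+ 2.
Proof.
have [_ j1 <-] := Rfubini_swap mI mJ (ds_v ds).2; have [_ j2 <-] := Rfubini_swap mI mJ (ds_vx ds).2.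
rewrite -(RintegralZl _ mJ j1); apply: (le_ae_Rintegral mJ (integrableRZ _ mJ j1) j2).
have := ae_and (ds_x ds) (ae_and (L2_section_x (ds_v ds)) (L2_section_x (ds_vx ds))).
apply: (@ae_imp _ _ _ mu) => y [H [l1 l2]] yJ.
have [V [f [q [[Vf fq qg] [[Va Vb fb] E]]]]] := H yJ.
have E2 : {ae mu, forall x, I x -> vx (x, y) = f x}.
  by move: E; apply: (@ae_imp _ _ _ mu) => x E xI; rewrite (E xI).2.
rewrite [leRHS](@ae_eq_RintegralP _ _ _ mu I (fun x => vx (x, y) ^+ 2) (fun x => f x ^+ 2))//; first last.
- by move: E2; apply: (@ae_imp _ _ _ mu) => x E2 xI; rewrite (E2 xI).
- by apply: measurable_funX; exact: AC_measurable fq.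
- by apply: measurable_funX; exact: (l2 yJ).1.
rewrite (@ae_eq_RintegralP _ _ _ mu I (fun x => v (x, y) ^+ 2) (fun x => V x ^+ 2))//; first last.
- by move: E; apply: (@ae_imp _ _ _ mu) => x E xI; rewrite (E xI).1.
- by apply: measurable_funX; exact: AC_measurable Vf.
- by apply: measurable_funX; exact: (l1 yJ).1.
apply: (poincare ab Vf _ Va Vb).
by have := @L2_ae _ _ _ mu _ _ _ mI (AC_measurable fq) E2 (l2 yJ).
Qed.

Lemma slice_poincare_y : 6 / (d - c) ^+ 2 * (\int[(mu \x mu)%E]_(z in D) v z ^+ 2) <=
  \int[(mu \x mu)%E]_(z in D) vy z ^+ 2.
Proof.
have [_ j1 <-] := Rfubini mI mJ (ds_v ds).2; have [_ j2 <-] := Rfubini mI mJ (ds_vy ds).2.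
rewrite -(RintegralZl _ mI j1); apply: (le_ae_Rintegral mI (integrableRZ _ mI j1) j2).
have := ae_and (ds_y ds) (ae_and (L2_section_y (ds_v ds)) (L2_section_y (ds_vy ds))).
apply: (@ae_imp _ _ _ mu) => x [H [l1 l2]] xI.
have [V [q [[Vf qg Vc Vd] E]]] := H xI.
rewrite (@ae_eq_RintegralP _ _ _ mu J (fun y => v (x, y) ^+ 2) (fun y => V y ^+ 2))//; first last.
- by move: E; apply: (@ae_imp _ _ _ mu) => y E yJ; rewrite (E yJ).1.
- by apply: measurable_funX; exact: AC_measurable Vf.
- by apply: measurable_funX; exact: (l1 xI).1.
exact: (poincare cd Vf (l2 xI) Vc Vd).
Qed.

Lemma slice_sup_x : {ae (mu \x mu)%E, forall z, D z ->
  v z ^+ 2 <= \int[mu]_(s in I) `|v (s, z.2) * vx (s, z.2)|}.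
Proof.
have ai := integrableR_abs mD (iM (ds_v ds) (ds_vx ds)).
have [_ j1 _] := Rfubini_swap mI mJ ai.
pose B (z : RM * RM) := v z ^+ 2 - \int[mu]_(s in I) `|v (s, z.2) * vx (s, z.2)|.
have mB : measurable_fun D B.
  apply: measurable_funB; first by apply: measurable_funX; exact: (ds_v ds).1.
  apply: (@measurable_comp _ _ _ _ _ _ J (fun y => \int[mu]_(s in I) `|v (s, y) * vx (s, y)|) D snd) => //.
  - by move=> _ [z [_ zJ] <-].
  - exact: integrable_measurable j1.
  - by apply: measurable_funTS; exact: measurable_snd.
(* The inequality B <= 0 is recast as an equality between measurable functions, to pass from lines
   to the plane with [prod_ae_eq_swap]. *)
have : {ae (mu \x mu)%E, forall z, D z -> Num.max (B z) 0 = cst 0 z}.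
  apply: (prod_ae_eq_swap mI mJ).
  - by apply: measurable_maxr => //; exact: measurable_cst.
  - exact: measurable_cst.
  have := ae_and (ds_x ds) (ae_and (L2_section_x (ds_v ds)) (L2_section_x (ds_vx ds))).
  apply: (@ae_imp _ _ _ mu) => y [H [l1 l2]] yJ.
  have [V [f [q [[Vf fq qg] [[Va Vb fb] E]]]]] := H yJ.
  have E3 : \int[mu]_(s in I) `|v (s, y) * vx (s, y)| = \int[mu]_(s in I) `|V s * f s|.
    apply: (ae_eq_RintegralP mI).
    - exact: integrable_measurable (integrableR_abs mI (L2M mI (l1 yJ) (l2 yJ))).
    - apply: measurableT_comp => //; apply: measurable_funM.
        exact: AC_measurable Vf.
      exact: AC_measurable fq.
    - by move: E; apply: (@ae_imp _ _ _ mu) => x E xI; rewrite (E xI).1 (E xI).2.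
  move: E; apply: (@ae_imp _ _ _ mu) => x E xI.
  apply/max_idPr; rewrite /B subr_le0 /= E3 (E xI).1; apply: (sup_le_integral ab Vf Va Vb).
  by move: xI; rewrite /I /= in_itv/= => /andP[? ?]; rewrite !ltW.
apply: ae_imp => z H /H /max_idPr; by rewrite /B subr_le0.
Qed.

Lemma slice_sup_y : {ae (mu \x mu)%E, forall z, D z ->
  v z ^+ 2 <= \int[mu]_(s in J) `|v (z.1, s) * vy (z.1, s)|}.
Proof.
have ai := integrableR_abs mD (iM (ds_v ds) (ds_vy ds)).
have [_ j1 _] := Rfubini mI mJ ai.
pose B (z : RM * RM) := v z ^+ 2 - \int[mu]_(s in J) `|v (z.1, s) * vy (z.1, s)|.
have mB : measurable_fun D B.
  apply: measurable_funB; first by apply: measurable_funX; exact: (ds_v ds).1.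
  apply: (@measurable_comp _ _ _ _ _ _ I (fun x => \int[mu]_(s in J) `|v (x, s) * vy (x, s)|) D fst) => //.
  - by move=> _ [z [zI _] <-].
  - exact: integrable_measurable j1.
  - by apply: measurable_funTS; exact: measurable_fst.
have : {ae (mu \x mu)%E, forall z, D z -> Num.max (B z) 0 = cst 0 z}.
  apply: (prod_ae_eq mI mJ).
  - by apply: measurable_maxr => //; exact: measurable_cst.
  - exact: measurable_cst.
  have := ae_and (ds_y ds) (ae_and (L2_section_y (ds_v ds)) (L2_section_y (ds_vy ds))).
  apply: (@ae_imp _ _ _ mu) => x [H [l1 l2]] xI.
  have [V [q [[Vf qg Vc Vd] E]]] := H xI.
  have E3 : \int[mu]_(s in J) `|v (x, s) * vy (x, s)| = \int[mu]_(s in J) `|V s * vy (x, s)|.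
    apply: (ae_eq_RintegralP mJ).
    - exact: integrable_measurable (integrableR_abs mJ (L2M mJ (l1 xI) (l2 xI))).
    - apply: measurableT_comp => //; apply: measurable_funM.
        exact: AC_measurable Vf.
      exact: (l2 xI).1.
    - by move: E; apply: (@ae_imp _ _ _ mu) => y E yJ; rewrite (E yJ).1.
  move: E; apply: (@ae_imp _ _ _ mu) => y E yJ.
  apply/max_idPr; rewrite /B subr_le0 /= E3 (E yJ).1; apply: (sup_le_integral cd Vf Vc Vd).
  by move: yJ; rewrite /J /= in_itv/= => /andP[? ?]; rewrite !ltW.
apply: ae_imp => z H /H /max_idPr; by rewrite /B subr_le0.
Qed.

(* v^2 is bounded both by a function of y and by a function of x. *)
Lemma slice_ladyzhenskaya : L2 (mu \x mu)%E D (fun z => v z ^+ 2) /\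
  \int[(mu \x mu)%E]_(z in D) (v z ^+ 2) ^+ 2 <=
  (\int[(mu \x mu)%E]_(z in D) `|v z * vx z|) * (\int[(mu \x mu)%E]_(z in D) `|v z * vy z|).
Proof.
have a1 := integrableR_abs mD (iM (ds_v ds) (ds_vx ds)).
have a2 := integrableR_abs mD (iM (ds_v ds) (ds_vy ds)).
have [_ j1 E1] := Rfubini_swap mI mJ a1; have [_ j2 E2] := Rfubini mI mJ a2.
have ip := integrable_prod mI mJ j2 j1.
have mv2 : measurable_fun D (fun z : RM * RM => v z ^+ 2) by apply: measurable_funX; exact: (ds_v ds).1.
have mv4 : measurable_fun D (fun z : RM * RM => (v z ^+ 2) ^+ 2) by apply: measurable_funX.
have B : {ae (mu \x mu)%E, forall z, D z -> (v z ^+ 2) ^+ 2 <=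
    (\int[mu]_(s in J) `|v (z.1, s) * vy (z.1, s)|) * (\int[mu]_(s in I) `|v (s, z.2) * vx (s, z.2)|)}.
  have := ae_and slice_sup_x slice_sup_y; apply: (@ae_imp _ _ _ (mu \x mu)%E) => z [H1 H2] Dz.
  by rewrite expr2 ler_pM ?sqr_ge0//; [exact: H2|exact: H1].
have i4 : (mu \x mu)%E.-integrable D (EFin \o (fun z => (v z ^+ 2) ^+ 2)).
  apply: (ae_domination mD mv4 _ ip); move: B; apply: (@ae_imp _ _ _ (mu \x mu)%E) => z B Dz.
  by rewrite ger0_norm ?sqr_ge0// B.
split; first by split.
apply: le_trans (le_ae_Rintegral mD i4 ip B) _.
have [_ _ <-] := Rfubini mI mJ ip.
rewrite -E1 -E2 [leRHS]mulrC le_eqVlt; apply/orP; left; apply/eqP.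
transitivity (\int[mu]_(x in I) ((\int[mu]_(y in J) (\int[mu]_(x in I) `|v (x, y) * vx (x, y)|)) *
    \int[mu]_(y in J) `|v (x, y) * vy (x, y)|)).
  by apply: eq_Rintegral => x _ /=; rewrite mulrC; exact: (RintegralZl _ mJ j1).
by rewrite [RHS]mulrC; have := RintegralZl (\int[mu]_(y in J) (\int[mu]_(x in I) `|v (x, y) * vx (x, y)|)) mI j2.
Qed.

(** The cubic integrands are integrable because v^2 is in L^2, by [slice_ladyzhenskaya]; the
    identity itself is that of each horizontal line. *)
Lemma slice_nonlinear al be : \int[(mu \x mu)%E]_(z in D) (w al be z * (v z * (v z * vx z))) =
  - (be / 3) * \int[(mu \x mu)%E]_(z in D) v z ^+ 3.
Proof.
have [L4 _] := slice_ladyzhenskaya.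
have i1 : (mu \x mu)%E.-integrable D (EFin \o (fun z => w al be z * (v z * (v z * vx z)))).
  apply: integrable_affine; have := iM L4 (ds_vx ds).
  by apply: eq_integrable => // z _ /=; rewrite expr2 mulrA.
have i3 : (mu \x mu)%E.-integrable D (EFin \o (fun z => v z ^+ 3)).
  by have := iM (ds_v ds) L4; apply: eq_integrable => // z _ /=; rewrite -exprS.
have [s1 j1 <-] := Rfubini_swap mI mJ i1; have [s3 j3 <-] := Rfubini_swap mI mJ i3.
rewrite -(RintegralZl _ mJ j3); apply: (ae_eq_RintegralP mJ).
- exact: integrable_measurable j1.
- exact: integrable_measurable (integrableRZ _ mJ j3).
have := ae_and (ae_and s1 s3) (ds_x ds).
apply: (@ae_imp _ _ _ mu) => y [[k1 k3] H] yJ.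
have [V [f [q [[Vf fq qg] [[Va Vb fb] E]]]]] := H yJ.
rewrite (@ae_eq_RintegralP _ _ _ mu I _ (fun x => (al + be * (x - a)) * (V x * (V x * f x))))//; first last.
- by move: E; apply: (@ae_imp _ _ _ mu) => x E xI; rewrite /w (E xI).1 (E xI).2.
- apply: measurable_funM; first exact: AC_measurable (AC_affine ab al be).
  apply: measurable_funM; first exact: AC_measurable Vf.
  by apply: measurable_funM; [exact: AC_measurable Vf|exact: AC_measurable fq].
- exact: integrable_measurable (k1 yJ).
rewrite [in RHS](@ae_eq_RintegralP _ _ _ mu I _ (fun x => V x ^+ 3))//; first last.
- by move: E; apply: (@ae_imp _ _ _ mu) => x E xI; rewrite (E xI).1.
- by apply: measurable_funX; exact: AC_measurable Vf.
- exact: integrable_measurable (k3 yJ).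
exact: energy_nonlinear.
Qed.

(** With N = int v^3, s = int v^2 and F = int v^4, Cauchy-Schwarz gives N^2 <= s F. Applied again to
    the two factors bounding F, it gives F^2 <= (s int v_x^2)(s int v_y^2). *)
Lemma slice_cubic : (\int[(mu \x mu)%E]_(z in D) v z ^+ 3) ^+ 4 <=
  (\int[(mu \x mu)%E]_(z in D) v z ^+ 2) ^+ 4 *
  ((\int[(mu \x mu)%E]_(z in D) vx z ^+ 2) * (\int[(mu \x mu)%E]_(z in D) vy z ^+ 2)).
Proof.
have [L4 B] := slice_ladyzhenskaya.
have C1 := cauchy_schwarz mD (ds_v ds) L4.
have C2 := cauchy_schwarz mD (L2_abs mD (ds_v ds)) (L2_abs mD (ds_vx ds)).
have C3 := cauchy_schwarz mD (L2_abs mD (ds_v ds)) (L2_abs mD (ds_vy ds)).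
have P (f g : R * R -> R) : \int[(mu \x mu)%E]_(z in D) (`|f z| * `|g z|) =
    \int[(mu \x mu)%E]_(z in D) `|f z * g z| by apply: eq_Rintegral => z _; rewrite normrM.
have Q (f : R * R -> R) : \int[(mu \x mu)%E]_(z in D) `|f z| ^+ 2 =
    \int[(mu \x mu)%E]_(z in D) f z ^+ 2.
  by apply: eq_Rintegral => z _; rewrite real_normK// num_real.
rewrite P !Q in C2; rewrite P !Q in C3.
have E3 : \int[(mu \x mu)%E]_(z in D) (v z * v z ^+ 2) = \int[(mu \x mu)%E]_(z in D) v z ^+ 3.
  by apply: eq_Rintegral => z _; rewrite -exprS.
rewrite E3 in C1.
have g0 (f : R * R -> R) : 0 <= \int[(mu \x mu)%E]_(z in D) f z ^+ 2.
  by apply: Rintegral_ge0 => z _; exact: sqr_ge0.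
have h0 (f : R * R -> R) : 0 <= \int[(mu \x mu)%E]_(z in D) `|f z|.
  by apply: Rintegral_ge0 => z _; exact: normr_ge0.
move: C1 C2 C3 B (g0 v) (g0 vx) (g0 vy) (g0 (fun z => v z ^+ 2))
  (h0 (fun z => v z * vx z)) (h0 (fun z => v z * vy z)).
move: (\int[(mu \x mu)%E]_(z in D) v z ^+ 3) (\int[(mu \x mu)%E]_(z in D) v z ^+ 2) => N s.
move: (\int[(mu \x mu)%E]_(z in D) vx z ^+ 2) (\int[(mu \x mu)%E]_(z in D) vy z ^+ 2) => p q.
move: (\int[(mu \x mu)%E]_(z in D) (v z ^+ 2) ^+ 2) => F.
move: (\int[(mu \x mu)%E]_(z in D) `|v z * vx z|) (\int[(mu \x mu)%E]_(z in D) `|v z * vy z|) => A B.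
move=> C1 C2 C3 FAB s0 p0 q0 F0 A0 B0.
have F2 : F ^+ 2 <= (s * p) * (s * q).
  apply: (@le_trans _ _ ((A * B) ^+ 2)); first by rewrite ler_pXn2r// nnegrE// mulr_ge0.
  by rewrite exprMn ler_pM ?sqr_ge0.
have -> : N ^+ 4 = (N ^+ 2) ^+ 2 by ring.
apply: (@le_trans _ _ ((s * F) ^+ 2)); first by rewrite ler_pXn2r// nnegrE ?sqr_ge0// mulr_ge0.
have -> : s ^+ 4 * (p * q) = s ^+ 2 * ((s * p) * (s * q)) by ring.
by rewrite exprMn ler_wpM2l ?sqr_ge0.
Qed.

(** The equation multiplied by w v. Both weights are needed: (al, be) = (1, 0) makes the right side
    0 and controls the mass, (1, 1) produces the dissipation. *)
Lemma slice_energy (al be : R) (ut : R * R -> R) : 0 <= al -> measurable_fun D (ut : RM * RM -> R) ->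
  {ae (mu \x mu)%E, forall z, D z -> ut z + v z * vx z + vxxx z + vxyy z = 0} ->
  2 * (\int[(mu \x mu)%E]_(z in D) (w al be z * (v z * ut z))) <=
  - be * (3 * (\int[(mu \x mu)%E]_(z in D) vx z ^+ 2) +
     \int[(mu \x mu)%E]_(z in D) vy z ^+ 2 - 2 / 3 * \int[(mu \x mu)%E]_(z in D) v z ^+ 3).
Proof.
move=> al0 mut eqn; have [L4 _] := slice_ladyzhenskaya.
have i1 : (mu \x mu)%E.-integrable D (EFin \o (fun z => w al be z * (v z * (v z * vx z)))).
  apply: integrable_affine; have := iM L4 (ds_vx ds).
  by apply: eq_integrable => // z _ /=; rewrite expr2 mulrA.
have i2 := integrable_affine al be (iM (ds_v ds) (ds_vxxx ds)).
have i3 := integrable_affine al be (iM (ds_v ds) (ds_vxyy ds)).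
have i12 := integrableRD mD i1 i2; have i123 := integrableRD mD i12 i3.
have -> : \int[(mu \x mu)%E]_(z in D) (w al be z * (v z * ut z)) =
    \int[(mu \x mu)%E]_(z in D) - (w al be z * (v z * (v z * vx z)) + w al be z * (v z * vxxx z) +
      w al be z * (v z * vxyy z)).
  apply: (ae_eq_RintegralP mD).
  - apply: measurable_funM; first exact: measurable_w.
    by apply: measurable_funM => //; exact: (ds_v ds).1.
  - exact: integrable_measurable (integrableRN mD i123).
  - move: eqn; apply: (@ae_imp _ _ _ (mu \x mu)%E) => z E Dz.
    have -> : ut z = - (v z * vx z + vxxx z + vxyy z).
      by apply/eqP; rewrite -addr_eq0 !addrA E.
    by rewrite !mulrN !mulrDr.
rewrite (RintegralN mD i123) (RintegralD mD i12 i3) (RintegralD mD i1 i2).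
have := slice_xxx be al0; rewrite slice_nonlinear slice_xyy.
move: (\int[(mu \x mu)%E]_(z in D) v z ^+ 3) => N.
move: (\int[(mu \x mu)%E]_(z in D) vx z ^+ 2) (\int[(mu \x mu)%E]_(z in D) vy z ^+ 2) => p q.
move: (\int[(mu \x mu)%E]_(z in D) (w al be z * (v z * vxxx z))) => X H.
rewrite [leRHS](_ : _ = 2 * (be / 3 * N - 3 / 2 * be * p - be / 2 * q)); last by field.
by rewrite ler_pM2l// mulNr; lra.
Qed.

Lemma slice_decay (al be : R) (ut : R * R -> R) : 0 <= al -> 0 <= be -> measurable_fun D (ut : RM * RM -> R) ->
  {ae (mu \x mu)%E, forall z, D z -> ut z + v z * vx z + vxxx z + vxyy z = 0} ->
  \int[(mu \x mu)%E]_(z in D) v z ^+ 2 <= 9 / 8 *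
    ((3 / (b - a) ^+ 2 + 1 / (d - c) ^+ 2) ^+ 2 / (1 / (b - a) ^+ 2 + 1 / (d - c) ^+ 2)) ->
  2 * (\int[(mu \x mu)%E]_(z in D) (w al be z * (v z * ut z))) <=
  - be * (4 * (3 / (b - a) ^+ 2 + 1 / (d - c) ^+ 2) * \int[(mu \x mu)%E]_(z in D) v z ^+ 2).
Proof.
move=> al0 be0 mut eqn sK; apply: le_trans (slice_energy be al0 mut eqn) _.
rewrite !mulNr lerN2 ler_wpM2l//.
have ba : 0 < 1 / (b - a) ^+ 2 by rewrite divr_gt0// exprn_gt0// subr_gt0.
have dc : 0 < 1 / (d - c) ^+ 2 by rewrite divr_gt0// exprn_gt0// subr_gt0.
have E (x : R) : 3 / x = 3 * (1 / x) by rewrite mul1r.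
have E6 (x : R) : 6 / x = 6 * (1 / x) by rewrite mul1r.
rewrite E; apply: cubic_absorption => //.
- by apply: Rintegral_ge0 => z _; exact: sqr_ge0.
- by rewrite -E6; exact: slice_poincare_x.
- by rewrite -E6; exact: slice_poincare_y.
- exact: slice_cubic.
- by rewrite -E.
Qed.

End SliceEnergy.

(** * Slices of a solution *)

Section SliceOfTraces.
Context {R : realType}.
Notation mu := (@lebesgue_measure R).
Notation RM := (measurableTypeR R).

Lemma Rintegral_prefix_ae (a b x : R) (f g : R -> R) : x <= b ->
  measurable_fun `]a, b[ (f : RM -> R) -> measurable_fun `]a, b[ (g : RM -> R) ->
  {ae mu, forall s, `]a, b[%classic s -> f s = g s} ->
  \int[mu]_(s in `]a, x[) f s = \int[mu]_(s in `]a, x[) g s.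
Proof.
move=> xb mf mg E; have sub : `]a, x[ `<=` `]a, b[ by apply: subset_itvl; rewrite bnd_simp.
have mI := measurable_RM `]a, b[.
apply: ae_eq_RintegralP; [exact: measurable_RM|exact: (measurable_funS mI sub)|exact: (measurable_funS mI sub)|].
by move: E; apply: (@ae_imp _ _ _ mu) => s H /sub /H.
Qed.

Lemma AC_shift (a b e : R) (g : R -> R) : mu.-integrable `]a, b[ (EFin \o g) ->
  AC a b (fun x => e + \int[mu]_(s in `]a, x[) g s) g.
Proof.
move=> gi; have := AC_D (AC_cst a b e) (AC_primitive gi).
by rewrite (_ : (fun x => cst 0 x + g x) = g)//; apply/funext => x; rewrite add0r.
Qed.

(* The two one-sided representations of v differ by the mean of f. *)
Lemma zero_mean (a b : R) (v f : R -> R) : a < b ->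
  {ae mu, forall x, `]a, b[%classic x ->
    v x = \int[mu]_(s in `]a, x[) f s - \int[mu]_(s in `]a, a[) f s} ->
  {ae mu, forall x, `]a, b[%classic x ->
    v x = \int[mu]_(s in `]a, x[) f s - \int[mu]_(s in `]a, b[) f s} ->
  \int[mu]_(s in `]a, b[) f s = 0.
Proof.
move=> ab H1 H2; have [x [xI [h1 h2]]] := ae_itv_exists ab (ae_and H1 H2).
move: (h1 xI); rewrite (h2 xI) Rintegral_oo_eq0 subr0 => /eqP.
by rewrite -subr_eq0 addrC addrA addNr add0r oppr_eq0 => /eqP.
Qed.

Variables (a b c d : R).
Hypotheses (ab : a < b) (cd : c < d).

Let I : set RM := `]a, b[%classic.
Let J : set RM := `]c, d[%classic.
Let D : set (RM * RM) := `]a, b[%classic `*` `]c, d[%classic.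
Let mI : measurable I. Proof. exact: measurable_RM. Qed.
Let mJ : measurable J. Proof. exact: measurable_RM. Qed.
Let mD : measurable D. Proof. exact: measurableX. Qed.

Lemma rect_finite : ((mu \x mu)%E D < +oo)%E.
Proof.
rewrite product_measure1E//.
by rewrite lte_mul_pinfty ?measure_ge0//; [rewrite ge0_fin_numE//; exact: itv_finite|exact: itv_finite].
Qed.

Variables v ux vx vy vxx vxy vxxx vxyy : R * R -> R.
Hypotheses (Lv : L2 (mu \x mu)%E D v) (Lvx : L2 (mu \x mu)%E D vx) (Lvy : L2 (mu \x mu)%E D vy)
  (Lvxx : L2 (mu \x mu)%E D vxx) (Lvxy : L2 (mu \x mu)%E D vxy)
  (Lvxxx : L2 (mu \x mu)%E D vxxx) (Lvxyy : L2 (mu \x mu)%E D vxyy).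
Hypotheses (Wv : weak_deriv D [::] v v) (Wux : weak_deriv D [:: ex] v ux)
  (Wvx : weak_deriv D [:: ex] v vx)
  (Wvy : weak_deriv D [:: ey] v vy) (Wvxx : weak_deriv D [:: ex; ex] v vxx)
  (Wvxy : weak_deriv D [:: ex; ey] v vxy) (Wvxxx : weak_deriv D [:: ex; ex; ex] v vxxx)
  (Wvxyy : weak_deriv D [:: ex; ey; ey] v vxyy).
Hypotheses
  (T_left : has_trace D (fun y => (a, y)) `]c, d[%classic v (cst 0))
  (T_right : has_trace D (fun y => (b, y)) `]c, d[%classic v (cst 0))
  (T_bottom : has_trace D (fun x => (x, c)) `]a, b[%classic v (cst 0))
  (T_top : has_trace D (fun x => (x, d)) `]a, b[%classic v (cst 0))
  (T_right_x : has_trace D (fun y => (b, y)) `]c, d[%classic ux (cst 0)).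

Let int f : L2 (mu \x mu)%E D f -> (mu \x mu)%E.-integrable D (EFin \o f).
Proof. by move=> Lf; exact: (L2_integrable mD rect_finite Lf). Qed.

Let int1 (e1 e2 : R) f : L2 mu `]e1, e2[ f -> mu.-integrable `]e1, e2[ (EFin \o f).
Proof. by move=> Lf; exact: (L2_integrable (measurable_RM _) (itv_finite _ _) Lf). Qed.

(** The condition at x = b is stated for the derivative [ux] attached to the solution, whereas the
    square integrable derivative is [vx]; uniqueness identifies them. *)
Let Eux : {ae (mu \x mu)%E, forall z, D z -> ux z = vx z}.
Proof. exact: weak_deriv_unique Wux Wvx. Qed.

Let Lux : L2 (mu \x mu)%E D ux.
Proof.
have mux : measurable_fun D (ux : RM * RM -> R).
  by apply: locally_integrable_measurable; have [] := Wux.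
by apply: (L2_ae mD mux _ Lvx); move: Eux; apply: (@ae_imp _ _ _ (mu \x mu)%E) => z E Dz; rewrite E.
Qed.

Let left := trace_x ab (introT andP (conj (lexx a) (ltW ab))) Lv Lvx
  (fun _ W => weak_deriv_unique W Wvx) T_left.
Let right := trace_x ab (introT andP (conj (ltW ab) (lexx b))) Lv Lvx
  (fun _ W => weak_deriv_unique W Wvx) T_right.
Let bottom := trace_y cd (introT andP (conj (lexx c) (ltW cd))) Lv Lvy
  (fun _ W => weak_deriv_unique W Wvy) T_bottom.
Let top := trace_y cd (introT andP (conj (ltW cd) (lexx d))) Lv Lvy
  (fun _ W => weak_deriv_unique W Wvy) T_top.

Let right_x : {ae mu, forall y, J y -> {ae mu, forall x, I x ->
  ux (x, y) = \int[mu]_(s in `]a, x[) vxx (s, y) - \int[mu]_(s in `]a, b[) vxx (s, y)}}.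
Proof.
apply: trace_x T_right_x => //; first by rewrite ltW/=.
move=> w Ww; have := weak_deriv_compose_x (vs := [:: ex]) Wux Wvxx Ww.
by apply: (@ae_imp _ _ _ (mu \x mu)%E) => z E Dz; rewrite E.
Qed.

Let mean_x : {ae mu, forall y, J y -> \int[mu]_(s in I) vx (s, y) = 0}.
Proof.
have := ae_and left right; apply: (@ae_imp _ _ _ mu) => y [h1 h2] yJ.
exact: zero_mean ab (h1 yJ) (h2 yJ).
Qed.

Let primitive_x : {ae mu, forall y, J y -> {ae mu, forall x, I x ->
  v (x, y) = \int[mu]_(s in `]a, x[) vx (s, y)}}.
Proof.
move: left; apply: (@ae_imp _ _ _ mu) => y H yJ; move: (H yJ).
by apply: (@ae_imp _ _ _ mu) => x {}H xI; rewrite (H xI) Rintegral_oo_eq0 subr0.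
Qed.

Let weak_vy := weak_deriv_weak_y (vs := [::]) Wv Wvy.
Let weak_vxy := weak_deriv_weak_y (vs := [:: ex]) Wvx Wvxy.

(** Built downwards from the third derivative: q is a primitive of v_xxx representing v_xx, f the
    primitive of q that vanishes at b by the trace of v_x, and V the primitive of f that vanishes at
    a. Finally V b = 0 because v_x has zero mean. *)
Let line_x : {ae mu, forall y, J y -> exists V f q : R -> R,
  [/\ AC a b V f, AC a b f q & AC a b q (fun x => vxxx (x, y))] /\
  [/\ V a = 0, V b = 0 & f b = 0] /\
  {ae mu, forall x, I x -> v (x, y) = V x /\ vx (x, y) = f x}}.
Proof.
have A := AC_x_of_weak ab (int Lvxx) (int Lvxxx) (weak_deriv_weak_x (vs := [:: ex; ex]) Wvxx Wvxxx).
have := ae_and (ae_and primitive_x mean_x) (ae_and (ae_and right_x A) (ae_and (ae_prod_swap Eux)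
  (ae_and (L2_section_x Lvx) (ae_and (L2_section_x Lvxx) (L2_section_x Lvxxx))))).
apply: (@ae_imp _ _ _ mu) => y [[h1 h2] [[h3 h4] [h5 [l1 [l2 l3]]]]] yJ.
have [e {}h4] := h4 yJ.
have qg := AC_shift e (int1 (l3 yJ)); set q := (fun x => e + _) in qg.
have Iq (x : R) : x <= b -> \int[mu]_(s in `]a, x[) vxx (s, y) = \int[mu]_(s in `]a, x[) q s.
  move=> xb; apply: (Rintegral_prefix_ae xb _ _ h4); first exact: (l2 yJ).1.
  exact: AC_measurable qg.
have fq := AC_shift (- \int[mu]_(s in `]a, b[) q s) (AC_integrable qg).
set f := (fun x => _ + _) in fq.
have Ef : {ae mu, forall x, I x -> vx (x, y) = f x}.
  have := ae_and h5 (h3 yJ); apply: (@ae_imp _ _ _ mu) => x [E5 E3] xI.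
  rewrite -E5; last by split.
  have xb : x <= b by move: xI; rewrite /I /= in_itv/= => /andP[_ /ltW].
  by rewrite (E3 xI) (Iq _ (lexx b)) (Iq _ xb) /f addrC.
have If (x : R) : x <= b -> \int[mu]_(s in `]a, x[) vx (s, y) = \int[mu]_(s in `]a, x[) f s.
  move=> xb; apply: (Rintegral_prefix_ae xb _ _ Ef); first exact: (l1 yJ).1.
  exact: AC_measurable fq.
have Vf := AC_primitive (AC_integrable fq); set V := (fun x => _) in Vf.
exists V, f, q; split; first by split.
split; first split.
- by rewrite /V Rintegral_oo_eq0.
- by rewrite /V -(If _ (lexx b)); exact: (h2 yJ).
- by rewrite /f addNr.
have := ae_and Ef (h1 yJ); apply: (@ae_imp _ _ _ mu) => x [Ex E1] xI; split; last exact: Ex.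
rewrite (E1 xI) If//; by move: xI; rewrite /I /= in_itv/= => /andP[_ /ltW].
Qed.

Let line_xy : {ae mu, forall y, J y -> exists U : R -> R,
  [/\ AC a b U (fun x => vxy (x, y)), U a = 0, U b = 0 &
  {ae mu, forall x, I x -> vy (x, y) = U x}]}.
Proof.
have P := derive_under_primitive ab (int Lv) (int Lvx) (int Lvy) (int Lvxy)
  (fun l sl tl => weak_y_sliced (int Lv) (int Lvy) weak_vy sl tl)
  (fun l sl tl => weak_y_sliced (int Lvx) (int Lvxy) weak_vxy sl tl) primitive_x.
have Q := derive_under_integral (int Lvx) (int Lvxy)
  (fun l sl tl => weak_y_sliced (int Lvx) (int Lvxy) weak_vxy sl tl) mean_x.
have := ae_and (ae_and P Q) (L2_section_x Lvxy).
apply: (@ae_imp _ _ _ mu) => y [[h1 h2] l1] yJ.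
exists (fun x => \int[mu]_(s in `]a, x[) vxy (s, y)); split.
- exact: AC_primitive (int1 (l1 yJ)).
- exact: Rintegral_oo_eq0.
- exact: (h2 yJ).
- exact: (h1 yJ).
Qed.

Let line_y : {ae mu, forall x, I x -> exists V q : R -> R,
  [/\ AC c d V (fun y => vy (x, y)), AC c d q (fun y => vxyy (x, y)), V c = 0 & V d = 0] /\
  {ae mu, forall y, J y -> v (x, y) = V y /\ vxy (x, y) = q y}}.
Proof.
have A := AC_y_of_weak cd (int Lvxy) (int Lvxyy) (weak_deriv_weak_y (vs := [:: ex; ey]) Wvxy Wvxyy).
have := ae_and (ae_and bottom top) (ae_and A (ae_and (L2_section_y Lvy) (L2_section_y Lvxyy))).
apply: (@ae_imp _ _ _ mu) => x [[h1 h2] [h3 [l1 l2]]] xI.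
have [e {}h3] := h3 xI.
exists (fun y => \int[mu]_(s in `]c, y[) vy (x, s)), (fun y => e + \int[mu]_(s in `]c, y[) vxyy (x, s)).
split; first split.
- exact: AC_primitive (int1 (l1 xI)).
- exact: AC_shift (int1 (l2 xI)).
- exact: Rintegral_oo_eq0.
- exact: zero_mean cd (h1 xI) (h2 xI).
have := ae_and (h1 xI) h3; apply: (@ae_imp _ _ _ mu) => y [{}h1 {}h3] yJ; split; last exact: h3.
by rewrite (h1 yJ) Rintegral_oo_eq0 subr0.
Qed.

Lemma dirichlet_slice_of_traces : dirichlet_slice a b c d v vx vy vxy vxxx vxyy.
Proof. by split. Qed.

End SliceOfTraces.

(** * Evolution of the energy *)

Section EnergyTime.
Context {R : realType} d (T : measurableType d).
Notation mu := (@lebesgue_measure R).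
Notation RM := (measurableTypeR R).
Variables (m : {sigma_finite_measure set T -> \bar R}) (D : set T) (mD : measurable D).
Variables (S : R) (u ut : T * RM -> R) (w : T -> R) (M : R).
Let I : set RM := `]0, S[%classic.
Let Q : set (T * RM) := D `*` `]0, S[%classic.
Let mI : measurable I. Proof. exact: measurable_RM. Qed.
Let mQ : measurable Q. Proof. exact: measurableX. Qed.
Hypotheses (S0 : 0 < S) (Lu : L2 (m \x mu)%E Q u) (Lut : L2 (m \x mu)%E Q ut)
  (mw : measurable_fun D w) (wM : forall z, D z -> `|w z| <= M)
  (uE : {ae m, forall z, D z -> exists c, {ae mu, forall t, I t ->
     u (z, t) = c + \int[mu]_(s in `]0, t[) ut (z, s)}}).

Let weighted f : (m \x mu)%E.-integrable Q (EFin \o f) ->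
  (m \x mu)%E.-integrable Q (EFin \o (fun q => w q.1 * f q)).
Proof.
move=> fi; have mw1 : measurable_fun Q (fun q => w q.1).
  apply: (@measurable_comp _ _ _ _ _ _ D w Q fst) => //.
  - by move=> _ [q [qD _] <-].
  - by apply: measurable_funTS; exact: measurable_fst.
have wM1 q : Q q -> `|w q.1| <= M by move=> [q1 _]; exact: wM.
have := integrable_mul_bounded mQ mw1 wM1 fi.
by apply: eq_integrable => // q _ /=; rewrite mulrC.
Qed.

Let timed f k : line_smooth k -> (m \x mu)%E.-integrable Q (EFin \o f) ->
  (m \x mu)%E.-integrable Q (EFin \o (fun q => f q * k q.2)).
Proof.
move=> sk fi; have mk : measurable_fun Q (fun q : T * RM => k q.2).
  apply: (@measurable_comp _ _ _ _ _ _ setT (k : RM -> R) Q snd) => //.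
  - exact: measurable_line_smooth.
  - by apply: measurable_funTS; exact: measurable_snd.
have [C HC] := bounded_line_smooth 0 S sk.
apply: (integrable_mul_bounded mQ mk _ fi (M := C)) => q [_ /=]; rewrite in_itv/= => /andP[? ?].
by apply: HC; rewrite !ltW.
Qed.

Let g q := 2 * (u q * ut q).
Let gi : (m \x mu)%E.-integrable Q (EFin \o g).
Proof. exact: integrableRZ mQ (L2M mQ Lu Lut). Qed.

Let u2i : (m \x mu)%E.-integrable Q (EFin \o (fun q => u q ^+ 2)).
Proof. exact: Lut.2 || exact: Lu.2. Qed.

(** For almost every z, u(z, .) is absolutely continuous in time and (u^2)' = 2 u u_t. The constant
    of integration, which varies with z, no longer appears in the tested identity. *)
Let square_weak k : line_smooth k -> k 0 = 0 -> k S = 0 ->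
  {ae m, forall z, D z -> \int[mu]_(t in I) (u (z, t) ^+ 2 * k^`()%classic t) =
    - \int[mu]_(t in I) (g (z, t) * k t)}.
Proof.
move=> sk k0 kS; have Ak : AC 0 S k (k^`())%classic.
  apply: AC_derive; first exact: ltW.
    move=> x _; apply: DeriveDef; first exact: line_smooth_derivable.
    by rewrite derive1E.
  apply: continuous_subspaceT; apply: line_smooth_continuous.
  exact: line_smooth_derive.
have := ae_and uE (ae_and (L2_section mD mI Lu) (L2_section mD mI Lut)).
apply: (@ae_imp _ _ _ m) => z [H [l1 l2]] zD; have [c Ec] := H zD.
have l1i := L2_integrable mI (itv_finite _ _) (l2 zD).
have Uu := AC_shift c l1i; set U := (fun x => c + _) in Uu.
have E := energy_cross S0 Ak (AC_M Uu Uu) k0 kS.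
have mk h : line_smooth h -> measurable_fun I (h : RM -> R) by exact: measurable_line_smooth.
transitivity (\int[mu]_(t in I) ((k^`())%classic t * (U t * U t))).
  apply: (ae_eq_RintegralP mI).
  - apply: measurable_funM; first by apply: measurable_funX; exact: (l1 zD).1.
    by apply: mk; exact: line_smooth_derive.
  - apply: measurable_funM; first by apply: mk; exact: line_smooth_derive.
    by apply: measurable_funM; exact: AC_measurable Uu.
  - by move: Ec; apply: (@ae_imp _ _ _ mu) => t Et tI; rewrite (Et tI) mulrC expr2.
rewrite -[LHS]opprK -E; congr (- _); apply: (ae_eq_RintegralP mI).
- apply: measurable_funM; first exact: mk.
  by apply: measurable_funD; apply: measurable_funM; (exact: AC_measurable Uu || exact: (l2 zD).1).
- apply: measurable_funM; last exact: mk.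
  apply: measurable_funM; first exact: measurable_cst.
  by apply: measurable_funM; [exact: (l1 zD).1|exact: (l2 zD).1].
- by move: Ec; apply: (@ae_imp _ _ _ mu) => t Et tI; rewrite /g (Et tI) -/(U t) mulrC mulr_natl mulr2n.
Qed.

(** The identity of each point z is tested in time, weighted and integrated over z; Fubini turns the
    result into a weak derivative of the energy, and [AC_of_weak] into a primitive. *)
Lemma energy_time : mu.-integrable I (EFin \o (fun t => \int[m]_(z in D) (w z * g (z, t)))) /\
  exists C, {ae mu, forall t, I t -> \int[m]_(z in D) (w z * u (z, t) ^+ 2) =
    C + \int[mu]_(s in `]0, t[) (\int[m]_(z in D) (w z * g (z, s)))}.
Proof.
have [_ j1 _] := Rfubini_swap mD mI (weighted u2i).
have [_ j2 _] := Rfubini_swap mD mI (weighted gi).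
split; first exact: j2.
apply: (AC_of_weak S0 j1 j2) => p q n p0 pq qS.
have [s1 [_ [K [cK KI K0]]] s3 _] := test_kernel_primitive n p0 pq qS.
set k := test_primitive _ in s1 K0 s3 *.
have k0 : k 0 = 0 by apply: K0 => /KI; rewrite /= in_itv/= ltxx.
have kS : k S = 0 by apply: K0 => /KI; rewrite /= in_itv/= ltxx andbF.
have F f h : line_smooth h -> (m \x mu)%E.-integrable Q (EFin \o f) ->
    [/\ {ae m, forall z, D z -> mu.-integrable I (EFin \o (fun t => f (z, t) * h t))},
    m.-integrable D (EFin \o (fun z => w z * \int[mu]_(t in I) (f (z, t) * h t))) &
    \int[mu]_(t in I) ((\int[m]_(z in D) (w z * f (z, t))) * h t) =
    \int[m]_(z in D) (w z * \int[mu]_(t in I) (f (z, t) * h t))].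
  move=> sh fi; have i1 := timed sh fi; have i2 := weighted i1.
  have [a1 _ _] := Rfubini mD mI i1.
  have [_ a2 E2] := Rfubini mD mI i2; have [_ a3 E3] := Rfubini_swap mD mI i2.
  have [b1 b2 _] := Rfubini_swap mD mI (weighted fi).
  have [_ c2 _] := Rfubini mD mI i1.
  have mint : measurable_fun D (fun z => w z * \int[mu]_(t in I) (f (z, t) * h t)).
    by apply: measurable_funM => //; exact: integrable_measurable c2.
  have Ez : {ae m, forall z, D z -> \int[mu]_(t in I) (w z * (f (z, t) * h t)) =
      w z * \int[mu]_(t in I) (f (z, t) * h t)}.
    by move: a1; apply: (@ae_imp _ _ _ m) => z a1 zD; exact: (RintegralZl _ mI (a1 zD)).
  split=> //; first exact: (ae_integrable mD mint Ez a2).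
  transitivity (\int[mu]_(t in I) (\int[m]_(z in D) (w z * (f (z, t) * h t)))).
    apply: (ae_eq_RintegralP mI).
    - apply: measurable_funM; first exact: integrable_measurable b2.
      exact: measurable_line_smooth.
    - exact: integrable_measurable a3.
    - move: b1; apply: (@ae_imp _ _ _ mu) => t b1 tI.
      rewrite -(RintegralZr _ mD (b1 tI)); apply: eq_Rintegral => z _ /=.
      by rewrite mulrA.
  rewrite E3 -E2; apply: (ae_eq_RintegralP mD _ mint Ez).
  exact: integrable_measurable a2.
have sk' := line_smooth_derive s1.
have [_ i1 E1] := F _ _ sk' u2i; have [_ i2 E2] := F _ _ s1 gi.
rewrite E2 -(RintegralN mD i2).
transitivity (\int[mu]_(t in I) ((\int[m]_(z in D) (w z * u (z, t) ^+ 2)) * (k^`())%classic t)).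
  by apply: eq_Rintegral => t _; rewrite s3.
rewrite E1; apply: (ae_eq_RintegralP mD).
- exact: integrable_measurable i1.
- exact: integrable_measurable (integrableRN mD i2).
- have := square_weak s1 k0 kS; apply: (@ae_imp _ _ _ m) => z H zD.
  by rewrite (H zD) mulrN.
Qed.

End EnergyTime.

Section PlaneMeasure.
Context {R : realType}.
Notation mu := (@lebesgue_measure R).
Notation RM := (measurableTypeR R).

Lemma plane_sigma_finite : sigma_finite setT (mu \x mu)%E.
Proof.
pose F n : set RM := `]- n%:R, n%:R[%classic.
have xF (x : RM) n : (`|x| < n%:R) -> F n x by rewrite ltr_norml /F /= in_itv.
exists (fun n => F n `*` F n); last first.
  move=> n; split; first by apply: measurableX; exact: measurable_RM.
  rewrite product_measure1E; [|exact: measurable_RM..].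
  by rewrite lte_mul_pinfty ?measure_ge0//; [rewrite ge0_fin_numE//; exact: itv_finite|exact: itv_finite].
apply/seteqP; split=> // z _.
pose N := maxn (Num.truncn `|z.1|).+1 (Num.truncn `|z.2|).+1; exists N => //.
split; apply: xF; apply: (lt_le_trans (truncnS_gt _)); rewrite ler_nat.
  exact: leq_maxl.
exact: leq_maxr.
Qed.
(* Canonical inference does not find the sigma-finite structure of the product
   lebesgue measure; the space-time measure is a product with it. *)
Definition plane_measure : {sigma_finite_measure set (RM * RM)%type -> \bar R} :=
  HB.pack_for {sigma_finite_measure set (RM * RM)%type -> \bar R} (mu \x mu)%E
   (Measure_isSigmaFinite.Build _ _ _ (mu \x mu)%E plane_sigma_finite).

End PlaneMeasure.

(** * From regularity in space-time to regularity of slices *)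

Section Regularity.
Context {R : realType}.
Notation mu := (@lebesgue_measure R).
Notation RM := (measurableTypeR R).
Notation m2 := (@plane_measure R).
Variables (a b c d : R).

Let D : set (RM * RM) := `]a, b[%classic `*` `]c, d[%classic.
Let mD : measurable D. Proof. by apply: measurableX; exact: measurable_RM. Qed.

Lemma measurable_slice (I : set RM) (w : R * R * R -> R) t : measurable I -> I t ->
  measurable_fun (D `*` I) (w : RM * RM * RM -> R) -> measurable_fun D (slice w t : RM * RM -> R).
Proof.
move=> mI It mw; have mw' : measurable_fun (I `*` D) (fun q : RM * (RM * RM) => w (q.2, q.1)).
  apply: (@measurable_comp _ _ _ _ _ _ (D `*` I)) => //; first exact: measurableX.
    by move=> _ [q [q1 q2] <-].
  apply: (@measurable_funS _ _ _ _ setT) => //; exact: measurable_swap.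
exact: (measurable_section mI mD It mw').
Qed.

Lemma poweR_half_norm_sqr (x : \bar R) : (0 <= x)%E -> (`|x `^ 2^-1| `^ 2 = x)%E.
Proof.
case: x => [r| |]//; last by move=> _; rewrite poweRyr ?invr_eq0//= pnatr_eq0.
rewrite lee_fin => r0; rewrite poweR_EFin powR12_sqrt//= ger0_norm ?sqrtr_ge0//.
by rewrite powR_mulrn ?sqrtr_ge0// sqr_sqrtr.
Qed.

Lemma poweR_half_lty (x : \bar R) : (x `^ 2^-1 < +oo -> x < +oo)%E.
Proof. by case: x => [r| |]//; rewrite ?ltry// poweRyr// invr_eq0. Qed.

(** For exponent 2 the mixed norm is the L^2 norm on the space-time cylinder, by Tonelli. *)
Lemma LpL2_L2 (S : R) (w : R * R * R -> R) : LpL2 D 2%:E S w ->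
  L2 (m2 \x mu)%E (D `*` `]0, S[%classic : set (RM * RM * RM)) w.
Proof.
move=> [mw]; set I : set RM := `]0, S[%classic; have mI : measurable I by exact: measurable_RM.
have mQ : measurable (D `*` I) by exact: measurableX.
have mw2 : measurable_fun (D `*` I) (fun q : RM * RM * RM => (w q ^+ 2)%:E).
  by apply/measurable_EFinP; exact: measurable_funX.
rewrite /mixed_norm Lnorm.unlock => /poweR_half_lty H; split; first exact: mw.
apply/integrableP; split; first exact: mw2.
have -> : (\int[m2 \x mu]_(q in D `*` I) `|(w q ^+ 2)%:E| =
    \int[m2 \x mu]_(q in D `*` I) (w q ^+ 2)%:E)%E.
  by apply: eq_integral => q _ /=; rewrite ger0_norm ?sqr_ge0.
rewrite (tonelli_rect_swap m2 mu mD mI mw2); last by move=> q; rewrite lee_fin sqr_ge0.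
rewrite integral_mkcond; apply: le_lt_trans H; rewrite le_eqVlt; apply/orP; left; apply/eqP.
apply: eq_integral => t _; rewrite !patchE; case: ifPn => tI.
  by rewrite (L2normE _ mD) poweR_half_norm_sqr// integral_sqr_ge0.
by rewrite -[X in `|X|%E]/(0%E) abse0 poweR_EFin powR0// pnatr_eq0.
Qed.

Lemma L2_section_time (S : R) (w : R * R * R -> R) :
  L2 (m2 \x mu)%E (D `*` `]0, S[%classic : set (RM * RM * RM)) w ->
  {ae mu, forall t, 0 < t < S -> L2 m2 D (slice w t)}.
Proof.
set I : set RM := `]0, S[%classic; have mI : measurable I by exact: measurable_RM.
move=> [mw wi]; have [H _ _] := Rfubini_swap mD mI wi.
move: H; apply: (@ae_imp _ _ _ mu) => t H tS; have tI : I t by rewrite /I /= in_itv.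
by split; [exact: (measurable_slice mI tI mw)|exact: (H tI)].
Qed.

(** The derivative of order 0 in [LpHk] is some function [g], not the function itself; testing
    against products shows that the two agree almost everywhere. *)
Let weak_id (v g : R * R -> R) : weak_deriv D [::] v g ->
  weak_deriv D [::] v v /\ {ae m2, forall z, D z -> v z = g z}.
Proof.
move=> [lv lg W]; split; first by split=> // phi _; rewrite expr0 mul1r.
apply: (tensor_unique lv lg) => k l sk sl tk tl.
by have := W _ (tensor_test sk sl tk tl); rewrite expr0 mul1r.
Qed.

Lemma LpHk_L2 (S : R) k (w : R * R * R -> R) : LpHk D 2%:E S k w ->
  L2 (m2 \x mu)%E (D `*` `]0, S[%classic : set (RM * RM * RM)) w.
Proof.
set I : set RM := `]0, S[%classic; have mI : measurable I by exact: measurable_RM.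
move=> [mw /(_ 0%N 0%N (leq0n _))[g [/LpL2_L2 Lg W]]].
apply: (L2_ae (measurableX mD mI) mw _ Lg); apply: (prod_ae_eq_swap mD mI Lg.1 mw).
move: W; apply: (@ae_imp _ _ _ mu) => t W tI; have tS : 0 < t < S by move: tI; rewrite /I /= in_itv.
have [_] := weak_id (W tS).
by apply: (@ae_imp _ _ _ m2) => z E zD; rewrite -[LHS](E zD).
Qed.

Lemma LpHk_slices (S : R) k (w : R * R * R -> R) i j : LpHk D 2%:E S k w -> (i + j <= k)%N ->
  {ae mu, forall t, 0 < t < S -> exists2 g, L2 m2 D g &
    weak_deriv D (nseq i ex ++ nseq j ey) (slice w t) g}.
Proof.
move=> [_ H] /H[g [/LpL2_L2/L2_section_time Lg W]].
have := ae_and Lg W; apply: (@ae_imp _ _ _ mu) => t [h1 h2] tS.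
by exists (slice g t); [exact: h1|exact: h2].
Qed.

Lemma LpHk_slice_id (S : R) k (w : R * R * R -> R) : LpHk D 2%:E S k w ->
  {ae mu, forall t, 0 < t < S -> weak_deriv D [::] (slice w t) (slice w t)}.
Proof.
move=> [_ /(_ 0%N 0%N (leq0n _))[g [_ W]]].
by move: W; apply: (@ae_imp _ _ _ mu) => t W /W/weak_id[].
Qed.

Lemma time_deriv_AC (S : R) (w wt : R * R * R -> R) : 0 < S -> time_deriv D w wt ->
  L2 (m2 \x mu)%E (D `*` `]0, S[%classic : set (RM * RM * RM)) w ->
  L2 (m2 \x mu)%E (D `*` `]0, S[%classic : set (RM * RM * RM)) wt ->
  {ae m2, forall z, D z -> exists c, {ae mu, forall t, `]0, S[%classic t ->
     w (z, t) = c + \int[mu]_(s in `]0, t[) wt (z, s)}}.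
Proof.
move=> S0 [_ W] Lw Lwt; set I : set RM := `]0, S[%classic.
have mI : measurable I by exact: measurable_RM.
have mQ : measurable (D `*` I) by exact: measurableX.
have fin : ((m2 \x mu)%E (D `*` I) < +oo)%E.
  rewrite product_measure1E//.
  rewrite lte_mul_pinfty ?measure_ge0//; last exact: itv_finite.
  by rewrite ge0_fin_numE//; exact: rect_finite.
apply: (AC_of_weak_param mD S0 (L2_integrable mQ fin Lw) (L2_integrable mQ fin Lwt)) => k sk tk.
have sub : `]0, S[%classic `<=` @Rpos R by apply: subset_itvl; rewrite bnd_simp.
have tk' : test_function Rpos k by case: tk => sk' [K [cK KI K0]]; split => //; exists K; split => //; exact: subset_trans sub.
have restrict (f h : R -> R) : test_function `]0, S[ h ->
    \int[mu]_(t in Rpos) (f t * h t) = \int[mu]_(t in `]0, S[) (f t * h t).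
  move=> [_ [K [_ KI K0]]]; rewrite Rintegral_mkcond [RHS]Rintegral_mkcond.
  congr Rintegral; apply/funext => t; rewrite !patchE; case: ifPn => tP; case: ifPn => // tI.
    by rewrite K0 ?mulr0// => /KI /mem_set; rewrite (negbTE tI).
  by move: tP; rewrite mem_set//; apply: sub; rewrite -inE.
have := W k tk'; apply: (@ae_imp _ _ _ m2) => z H zD.
rewrite -(restrict _ _ tk) -(restrict _ _ (derive_test_function sk tk)) -(H zD).
by apply: eq_Rintegral => t _; rewrite derive1E.
Qed.

End Regularity.

Section SolutionSlices.
Context {R : realType}.
Notation mu := (@lebesgue_measure R).
Notation RM := (measurableTypeR R).
Notation m2 := (@plane_measure R).
Variables (B L : R) (u0 : R * R -> R) (u ut ux uxxx uxyy : R * R * R -> R).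
Hypotheses (B0 : 0 < B) (L0 : 0 < L)
  (sol : regular_solution_with B L u0 u ut ux uxxx uxyy).

Let D : set (RM * RM) := `]0, L[%classic `*` `]-B, B[%classic.
Let mD : measurable D. Proof. by apply: measurableX; exact: measurable_RM. Qed.

(** The class L^2(0,T;H^3) supplies square integrable derivatives unrelated to the equation, while
    [ux], [uxxx] and [uxyy] satisfy the equation but carry no separate L^2 bounds. Uniqueness of
    weak derivatives identifies the two families. *)
Lemma solution_slices (S : R) : 0 < S ->
  {ae mu, forall t, 0 < t < S -> exists vx vy vxy vxxx vxyy,
    dirichlet_slice 0 L (- B) B (slice u t) vx vy vxy vxxx vxyy /\
    {ae m2, forall z, D z ->
      ut (z, t) + u (z, t) * vx z + vxxx z + vxyy z = 0}}.
Proof.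
move=> S0; have [_ H3] := rs_reg_u sol S0.
have nB : - B < B by rewrite gtrN.
have G i j := @LpHk_slices R 0 L (- B) B S 3 u i j H3.
have Lu := L2_section_time (LpHk_L2 H3).
have Wid := LpHk_slice_id H3.
have G10 := G 1%N 0%N erefl; have G01 := G 0%N 1%N erefl; have G20 := G 2%N 0%N erefl.
have G11 := G 1%N 1%N erefl; have G30 := G 3%N 0%N erefl; have G12 := G 1%N 2%N erefl.
have [_ Wux] := rs_ux sol; have [_ Wuxxx] := rs_uxxx sol; have [_ Wuxyy] := rs_uxyy sol.
have eqn : {ae (m2 \x mu)%E, forall q, (rect B L `*` Rpos) q ->
    ut q + u q * ux q + uxxx q + uxyy q = 0} := rs_eqn sol.
have {}eqn := @ae_prod_swap _ _ _ _ _ m2 mu _ eqn.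
have traces := ae_and (ae_and (rs_left sol) (rs_right sol)) (ae_and (ae_and (rs_bottom sol) (rs_top sol)) (rs_right_x sol)).
have := ae_and (ae_and (ae_and Lu Wid) (ae_and (ae_and G10 G01) (ae_and (ae_and G20 G11) (ae_and G30 G12))))
  (ae_and traces (ae_and (ae_and Wux (ae_and Wuxxx Wuxyy)) eqn)).
apply: (@ae_imp _ _ _ mu) => t [[[h1 h2] [[h3 h4] [[h5 h6] [h7 h8]]]] [[[k1 k2] [[k3 k4] k5]] [[k6 [k7 k8]] k9]]] tS.
have t0 : 0 < t by case/andP: tS.
have {}h1 := h1 tS; have {}h2 := h2 tS.
have [vx Lvx Wvx] := h3 tS; have [vy Lvy Wvy] := h4 tS; have [vxx Lvxx Wvxx] := h5 tS.
have [vxy Lvxy Wvxy] := h6 tS; have [vxxx Lvxxx Wvxxx] := h7 tS; have [vxyy Lvxyy Wvxyy] := h8 tS.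
exists vx, vy, vxy, vxxx, vxyy; split.
  exact: (dirichlet_slice_of_traces L0 nB h1 Lvx Lvy Lvxx Lvxy Lvxxx Lvxyy h2 (k6 t0) Wvx Wvy Wvxx Wvxy
    Wvxxx Wvxyy (k1 t0) (k2 t0) (k3 t0) (k4 t0) (k5 t0)).
have E1 := weak_deriv_unique (k6 t0) Wvx; have E2 := weak_deriv_unique (k7 t0) Wvxxx.
have E3 := weak_deriv_unique (k8 t0) Wvxyy.
have := ae_and k9 (ae_and E1 (ae_and E2 E3)); apply: (@ae_imp _ _ _ m2) => z [e0 [e1 [e2 e3]]] zD.
rewrite -(e1 zD) -(e2 zD) -(e3 zD); apply: e0.
by split => //; rewrite /Rpos /= in_itv/= t0.
Qed.

End SolutionSlices.

(** * Decay of the energy at every time *)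

Section Decay.
Context {R : realType}.
Notation mu := (@lebesgue_measure R).
Notation RM := (measurableTypeR R).

Lemma AC_nonincreasing (a b x : R) (F f : R -> R) : AC a b F f ->
  {ae mu, forall s, `]a, b[%classic s -> f s <= 0} -> a <= x <= b -> F x <= F a.
Proof.
move=> [fi FE] f0 xab; have /andP[ax xb] := xab; rewrite (FE x xab) gerDl.
have mx := measurable_RM `]a, x[.
have -> : 0 = \int[mu]_(s in `]a, x[) (cst 0 s : R) by rewrite Rintegral_itv_cst// mul0r.
apply: (le_ae_Rintegral mx (integrable_suboo (lexx a) xb fi)).
  exact: (L2_integrable mx (itv_finite _ _) (L2_cst 0 mx (itv_finite _ _))).
have sub : `]a, x[ `<=` `]a, b[ by apply: subset_itvl; rewrite bnd_simp.
by move: f0; apply: (@ae_imp _ _ _ mu) => s H /sub /H.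
Qed.

Lemma AC_right_cvg (a b x : R) (F f : R -> R) : AC a b F f -> a <= x < b ->
  F s @[s --> x^'+] --> F x.
Proof.
move=> FA /andP[ax xb]; have ab := le_lt_trans ax xb.
have := AC_continuous (ltW ab) FA; rewrite continuous_within_itvP// => -[c1 c2 _].
move: ax; rewrite le_eqVlt => /orP[/eqP <-//|ax].
by apply: cvg_at_right_filter; apply: c1; rewrite in_itv/= ax.
Qed.

(** Points where f = g accumulate at a from the right. This turns an identity for almost every time
    into one at a prescribed time, 0 included. *)
Lemma ae_right_limit_unique (a b l m : R) (f g : R -> R) : a < b ->
  {ae mu, forall x, `]a, b[%classic x -> f x = g x} ->
  f x @[x --> a^'+] --> l -> g x @[x --> a^'+] --> m -> l = m.
Proof.
move=> ab E fl gm; apply/eqP; rewrite -subr_eq0; apply/negPn/negP => lm.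
have e0 : 0 < `|l - m| by rewrite normr_gt0.
have /cvgrPdist_lt/(_ _ e0) : (f x - g x) @[x --> a^'+] --> l - m by exact: cvgB.
move=> [e /= e1 H].
have [x /andP[ax xe] Ex] := @ae_itv_exists _ a (Num.min b (a + e)) _ (ltac:(by rewrite lt_min ab ltrDl)) E.
move: xe; rewrite lt_min => /andP[xb xe].
have := H x; rewrite /ball /= distrC ger0_norm ?subr_ge0 ?ltW// ltrBlDl => /(_ xe ax).
by rewrite Ex ?subrr ?subr0 ?ltxx//= in_itv/= ax.
Qed.

(* Gronwall in the form: e^{sigma x} F is nonincreasing. *)
Lemma AC_exponential_decay (b x sigma : R) (F f : R -> R) : AC 0 b F f ->
  {ae mu, forall s, `]0, b[%classic s -> f s <= - sigma * F s} -> 0 <= x <= b ->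
  F x <= expR (- sigma * x) * F 0.
Proof.
move=> FA f0 xb; have b0 : 0 <= b by case/andP: xb => h1 h2; exact: le_trans h2.
have EA : AC 0 b (fun s => expR (sigma * s)) (fun s => sigma * expR (sigma * s)).
  apply: AC_derive => //.
    move=> s _; have D1 : is_derive s (1 : R) (fun s => sigma * s) sigma.
      have D := is_deriveZ sigma (is_derive_id s (1 : R)).
      by case: D => d v; apply: DeriveDef => //; rewrite v /GRing.scale /= mulr1.
    have D2 := is_derive1_comp (is_derive_expR (sigma * s)) D1.
    by case: D2 => d v; apply: DeriveDef => //; rewrite v mulrC.
  apply: continuous_subspaceT => s; apply: cvgM; first exact: cvg_cst.
  apply: (@continuous_comp _ _ _ (fun s : R => sigma * s) expR); last exact: continuous_expR.
  exact: mulrl_continuous.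
have := @AC_nonincreasing 0 b x _ _ (AC_M EA FA) _ xb.
rewrite mulr0 expR0 mul1r mulNr expRN mulrC => H.
rewrite ler_pdivlMl ?expR_gt0// mulrC; apply: H.
move: f0; apply: (@ae_imp _ _ _ mu) => s H sI.
have := H sI; have := expR_gt0 (sigma * s); move: (expR _) (f s) (F s) => e y z e0 yz.
have -> : e * y + z * (sigma * e) = e * (y + sigma * z) by ring.
by rewrite pmulr_rle0//; lra.
Qed.

Variables (B L : R).
Hypotheses (B0 : 0 < B) (L0 : 0 < L).
Notation m2 := (@plane_measure R).
Let D : set (RM * RM) := `]0, L[%classic `*` `]-B, B[%classic.
Let mD : measurable D. Proof. by apply: measurableX; exact: measurable_RM. Qed.
Let nB : - B < B. Proof. by rewrite gtrN. Qed.

(** Written with [z.1 - 0] to coincide with the weight of the slice estimates at a = 0. *)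
Definition affine_weight (al be : R) (z : R * R) := al + be * (z.1 - 0).

Lemma measurable_affine_weight al be : measurable_fun D (affine_weight al be : RM * RM -> R).
Proof.
apply: measurable_funD; first exact: measurable_cst.
apply: measurable_funM; first exact: measurable_cst.
by apply: measurable_funB; [apply: measurable_funTS; exact: measurable_fst|exact: measurable_cst].
Qed.

Lemma affine_weight_bounded al be z : D z -> `|affine_weight al be z| <= `|al| + `|be| * L.
Proof.
case=> /=; rewrite in_itv/= => /andP[z0 zL] _; rewrite /affine_weight subr0.
rewrite (le_trans (ler_normD _ _))// lerD2l normrM ler_wpM2l// ger0_norm ltW//.
Qed.

Lemma weighted_integrable al be (f : R * R -> R) : m2.-integrable D (EFin \o f) ->
  m2.-integrable D (EFin \o (fun z => affine_weight al be z * f z)).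
Proof. exact: integrable_affine. Qed.

(** The weight is bounded by C, and |l^2 - v^2| <= |v - l|^2 + 2 |v - l| |l|; by Cauchy-Schwarz the
    energies differ by at most C (X + 2 sqrt(X Y)), where X is the squared distance and Y the
    squared norm of the limit. *)
Lemma weighted_energy_cvg (F : set_system R) {FF : ProperFilter F} (al be : R)
    (v : R -> R * R -> R) (l : R * R -> R) :
  (\forall s \near F, measurable_fun D (v s : RM * RM -> R)) -> L2 m2 D l ->
  L2norm D (v s \- l) @[s --> F] --> 0%E ->
  \int[m2]_(z in D) (affine_weight al be z * v s z ^+ 2) @[s --> F] -->
  \int[m2]_(z in D) (affine_weight al be z * l z ^+ 2).
Proof.
move=> mv Ll; under eq_fun do rewrite (L2normE _ mD).
move=> /poweR_half_cvg0 H; have {H} := H (fun s => integral_sqr_ge0 _ _ _).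
move=> /fine_cvgP[fin cv].
pose X s := \int[m2]_(z in D) (v s z - l z) ^+ 2.
have {}cv : X s @[s --> F] --> 0 by exact: cv.
pose Y := \int[m2]_(z in D) l z ^+ 2; pose C := `|al| + `|be| * L.
have cvX : Num.sqrt (X s) @[s --> F] --> 0.
  by rewrite -[X in _ --> X](@sqrtr0 R); apply: continuous_cvg cv; exact: sqrt_continuous.
have cvH : (C * (X s + 2 * (Num.sqrt (X s) * Num.sqrt Y))) @[s --> F] --> 0.
  rewrite [X in _ --> X](_ : 0 = C * (0 + 2 * (0 * Num.sqrt Y))); last by rewrite mul0r mulr0 addr0 mulr0.
  apply: cvgM; first exact: cvg_cst.
  apply: cvgD => //; apply: cvgM; first exact: cvg_cst.
  by apply: cvgM => //; exact: cvg_cst.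
have bound s : measurable_fun D (v s : RM * RM -> R) ->
    (\int[(mu \x mu)%E]_(z in D) ((v s \- l) z ^+ 2)%:E)%E \is a fin_num ->
    `|\int[m2]_(z in D) (affine_weight al be z * l z ^+ 2) -
      \int[m2]_(z in D) (affine_weight al be z * v s z ^+ 2)| <=
    C * (X s + 2 * (Num.sqrt (X s) * Num.sqrt Y)).
  move=> mvs fs; have Ld : L2 m2 D (fun z => v s z - l z).
    have md : measurable_fun D (fun z : RM * RM => v s z - l z).
      by apply: measurable_funB => //; exact: Ll.1.
    split=> //; apply/integrableP; split.
      by apply/measurable_EFinP; exact: measurable_funX.
    move: fs; rewrite ge0_fin_numE ?integral_sqr_ge0//; apply: le_lt_trans.
    rewrite le_eqVlt; apply/orP; left; apply/eqP; apply: eq_integral => z _ /=.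
    by rewrite ger0_norm ?sqr_ge0.
  have C0 : 0 <= C by rewrite /C addr_ge0// mulr_ge0// ltW.
  have Lv : L2 m2 D (v s).
    apply: (L2_ae mD mvs _ (L2D mD Ld Ll)); apply: aeW => z _; by rewrite subrK.
  have i1 := weighted_integrable al be Ll.2; have i2 := weighted_integrable al be Lv.2.
  have i3 := L2M mD (L2_abs mD Ld) (L2_abs mD Ll).
  have i4 := integrableRD mD Ld.2 (integrableRZ 2 mD i3).
  have CS := cauchy_schwarz mD (L2_abs mD Ld) (L2_abs mD Ll).
  have Q (f : R * R -> R) : \int[m2]_(z in D) `|f z| ^+ 2 = \int[m2]_(z in D) f z ^+ 2.
    by apply: eq_Rintegral => z _; rewrite real_normK// num_real.
  rewrite (Q (fun z => v s z - l z)) Q in CS.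
  have X0 : 0 <= X s by apply: Rintegral_ge0 => z _; exact: sqr_ge0.
  have Y0 : 0 <= Y by apply: Rintegral_ge0 => z _; exact: sqr_ge0.
  have CS' : \int[m2]_(z in D) (`|v s z - l z| * `|l z|) <= Num.sqrt (X s) * Num.sqrt Y.
    rewrite -sqrtrM// -[leLHS]ger0_norm; last by apply: Rintegral_ge0 => z _; rewrite mulr_ge0.
    by rewrite -sqrtr_sqr ler_wsqrtr.
  rewrite -(RintegralB mD i1 i2).
  apply: (le_trans (le_normr_Rintegral mD (integrableRB mD i1 i2))).
  apply: (@le_trans _ _ (\int[m2]_(z in D) (C * ((v s z - l z) ^+ 2 + 2 * (`|v s z - l z| * `|l z|))))).
    apply: (le_ae_Rintegral mD (integrableR_abs mD (integrableRB mD i1 i2)) (integrableRZ C mD i4)).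
    apply: aeW => z zD; rewrite -mulrBr normrM ler_pM ?affine_weight_bounded//.
    have -> : l z ^+ 2 - v s z ^+ 2 = - ((v s z - l z) ^+ 2 + 2 * ((v s z - l z) * l z)) by ring.
    rewrite normrN (le_trans (ler_normD _ _))// lerD// ?normrM ?normrX//.
      by rewrite -normrM -expr2 ger0_norm ?sqr_ge0.
    by rewrite ger0_norm.
  rewrite (RintegralZl _ mD i4) ler_wpM2l// (RintegralD mD Ld.2 (integrableRZ 2 mD i3)).
  by rewrite (RintegralZl _ mD i3) lerD2l ler_wpM2l.
apply/cvgrPdist_lt => eps eps0.
move/cvgrPdist_lt: cvH => /(_ _ eps0) cvH.
near=> s; apply: le_lt_trans (bound s _ _) _.
- by near: s.
- by near: s.
- apply: le_lt_trans (ler_norm _) _; rewrite -normrN -[X in `|X|]add0r.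
  by near: s.
Unshelve. all: by end_near.
Qed.

Let inner_Rintegral (f g h : R * R -> R) : m2.-integrable D (EFin \o h) ->
  (forall z, D z -> f z * g z = h z) -> inner B L f g = (\int[m2]_(z in D) h z)%:E.
Proof.
move=> hi E; rewrite /Rintegral fineK; last exact: integrable_fin_num.
by apply: eq_integral => z; rewrite inE => /E ->.
Qed.

Lemma inner_energy v : L2 m2 D v -> inner B L (fun z => 1 + z.1) (fun z => v z ^+ 2) =
  (\int[m2]_(z in D) (affine_weight 1 1 z * v z ^+ 2))%:E.
Proof.
move=> Lv; apply: inner_Rintegral (weighted_integrable 1 1 Lv.2) _ => z _.
by rewrite /affine_weight mul1r subr0.
Qed.

Lemma inner_square v : L2 m2 D v -> inner B L v v = (\int[m2]_(z in D) v z ^+ 2)%:E.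
Proof. by move=> Lv; apply: inner_Rintegral Lv.2 _ => z _; rewrite expr2. Qed.

(** The weight is at least 1 on the rectangle. Applied to the datum, whose square integrability is
    thus drawn from the smallness hypothesis. *)
Lemma L2_of_inner (v : R * R -> R) : measurable_fun D (v : RM * RM -> R) ->
  (inner B L (fun z => 1 + z.1)%R (fun z => v z ^+ 2)%R < +oo)%E -> L2 m2 D v.
Proof.
move=> mv fin; split=> //.
have mv2 : measurable_fun D (fun z : RM * RM => v z ^+ 2) by exact: measurable_funX.
have w1 z : D z -> 1 <= 1 + z.1 by case=> /=; rewrite in_itv/= => /andP[z0 _] _; rewrite lerDl ltW.
have mw : measurable_fun D (fun z : RM * RM => (1 + z.1) * v z ^+ 2).
  apply: measurable_funM => //; apply: measurable_funD; first exact: measurable_cst.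
  by apply: measurable_funTS; exact: measurable_fst.
apply: (@integrable_domination _ _ _ m2 D _ (fun z => (1 + z.1) * v z ^+ 2)) => //.
  by move=> z /w1 z1; rewrite ger0_norm ?sqr_ge0// ler_peMl ?sqr_ge0.
apply/integrableP; split; first exact/measurable_EFinP.
apply: le_lt_trans fin; rewrite le_eqVlt; apply/orP; left; apply/eqP.
apply: eq_integral => z; rewrite inE => /w1 z1 /=.
by rewrite ger0_norm// mulr_ge0 ?sqr_ge0// (le_trans ler01).
Qed.

Variables (u0 : R * R -> R) (u ut ux uxxx uxyy : R * R * R -> R).
Hypothesis sol : regular_solution_with B L u0 u ut ux uxxx uxyy.

Let energy al be (v : R * R -> R) := \int[m2]_(z in D) (affine_weight al be z * v z ^+ 2).

(** Regularity puts u(s) in L^2 for almost every s only. Continuity at t provides such an s close to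
    t with u(s) - u(t) in L^2, and u(t) is the difference. *)
Lemma solution_L2 t : 0 < t -> L2 m2 D (slice u t).
Proof.
move=> t0; have S0 : 0 < t + 1 by rewrite ltr_wpDr.
have mt s : 0 < s -> measurable_fun D (slice u s : RM * RM -> R).
  move=> s0; apply: (measurable_slice (I := Rpos) (measurable_RM _)); last exact: (rs_meas sol).
  by rewrite /Rpos /= in_itv/= s0.
have Lu := L2_section_time (LpHk_L2 (rs_reg_u sol S0).2).
have := rs_cont sol t0; under eq_fun do rewrite (L2normE _ mD).
move=> /poweR_half_cvg0 H; have {H} := H (fun s => integral_sqr_ge0 _ _ _).
(* Of the convergence only the finiteness of the distance near t is kept. *)
move=> /fine_cvgP[[e /= e0 H] _].
have [s /andP[ts se] Ls] := @ae_itv_exists _ t (Num.min (t + 1) (t + e)) _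
  (ltac:(by rewrite lt_min !ltrDl ltr01)) Lu.
move: se; rewrite lt_min => /andP[s1 se].
have {}Ls : L2 m2 D (slice u s) by apply: Ls; rewrite s1 (lt_trans t0).
have md : measurable_fun D (fun z : RM * RM => slice u s z - slice u t z).
  by apply: measurable_funB; apply: mt => //; exact: lt_trans ts.
have Ld : L2 m2 D (fun z => slice u s z - slice u t z).
  split=> //; apply/integrableP; split.
    by apply/measurable_EFinP; exact: measurable_funX.
  have := H s; rewrite /ball /= distrC ger0_norm ?subr_ge0 ?ltW// ltrBlDl => /(_ se).
  rewrite ge0_fin_numE ?integral_sqr_ge0//; apply: le_lt_trans.
  rewrite le_eqVlt; apply/orP; left; apply/eqP; apply: eq_integral => z _ /=.
  by rewrite ger0_norm ?sqr_ge0.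
apply: (L2_ae mD (mt _ t0) _ (L2B mD Ls Ld)).
by apply: aeW => z _; rewrite subKr.
Qed.

(** The primitive agrees with the energy almost everywhere. Both have right limits, the primitive by
    absolute continuity and the energy by L^2 continuity, so they agree at every time, and at 0 with
    the energy of the datum. *)
Lemma solution_energy_AC S al be : 0 < S -> L2 m2 D u0 -> exists F f, [/\ AC 0 S F f,
  F 0 = energy al be u0, forall t, 0 < t < S -> F t = energy al be (slice u t) &
  forall t, f t = \int[m2]_(z in D) (affine_weight al be z * (2 * (slice u t z * slice ut t z)))].
Proof.
move=> S0 L0'; have Lu := LpHk_L2 (rs_reg_u sol S0).2; have Lut := LpHk_L2 (rs_reg_ut sol S0).2.
have uE := time_deriv_AC S0 (rs_ut sol) Lu Lut.
have [fi [C E]] := energy_time mD S0 Lu Lut (measurable_affine_weight al be)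
  (@affine_weight_bounded al be) uE.
have FA := AC_shift C fi; set F := (fun x => C + _) in FA.
set f := (fun t => \int[m2]_(z in D) _) in fi FA.
exists F, f.
have mt s : 0 < s -> measurable_fun D (slice u s : RM * RM -> R).
  by move=> s0; exact: (solution_L2 s0).1.
have lim t v : 0 <= t < S -> L2 m2 D v -> L2norm D (slice u s \- v) @[s --> t^'+] --> 0%E ->
    F t = energy al be v.
  move=> tS Lv cv; have /andP[t0 tS'] := tS.
  apply: (ae_right_limit_unique tS' _ (AC_right_cvg FA tS)); last first.
    apply: (@weighted_energy_cvg (t^'+) _ al be (slice u) v _ Lv cv).
    by near=> s; apply: mt; rewrite (le_lt_trans t0)//; near: s; exact: nbhs_right_gt.
  move: E; apply: (@ae_imp _ _ _ mu) => s E /=; rewrite in_itv/= => /andP[ts sS].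
  by rewrite /F -E//= in_itv/= sS (le_lt_trans t0 ts).
split=> //.
- by apply: lim => //; [rewrite lexx|exact: (rs_init sol)].
- move=> t /andP[t0 tS]; apply: lim; [by rewrite ltW|exact: solution_L2|].
  by apply: cvg_at_right_filter; exact: (rs_cont sol t0).
Unshelve. all: by end_near.
Qed.

Let rate al be t := \int[m2]_(z in D) (affine_weight al be z * (2 * (slice u t z * slice ut t z))).
(** The quantity 3p + q with p = 1/L^2 and q = 1/(2B)^2; the differences of endpoints are kept to
    match the slice estimates. *)
Let poincare_rate : R := 3 / (L - 0) ^+ 2 + 1 / (B - - B) ^+ 2.
Let threshold : R := 9 / 8 * (poincare_rate ^+ 2 / (1 / (L - 0) ^+ 2 + 1 / (B - - B) ^+ 2)).
Let mass (v : R * R -> R) := \int[m2]_(z in D) v z ^+ 2.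

Let rate_bounds S : 0 < S -> {ae mu, forall t, `]0, S[%classic t -> rate 1 0 t <= 0 /\
  (mass (slice u t) <= threshold -> rate 1 1 t <= - (4 * poincare_rate * mass (slice u t)))}.
Proof.
move=> S0; have Lut := L2_section_time (LpHk_L2 (rs_reg_ut sol S0).2).
have := ae_and Lut (solution_slices B0 L0 sol S0); apply: (@ae_imp _ _ _ mu) => t [h1 h2] tI.
have tS : 0 < t < S by move: tI; rewrite /= in_itv.
have Lt := h1 tS; have [vx [vy [vxy [vxxx [vxyy [ds eqn]]]]]] := h2 tS.
have Lv : L2 m2 D (slice u t) by apply: solution_L2; case/andP: tS.
have rE al be : rate al be t =
    2 * \int[m2]_(z in D) (affine_weight al be z * (slice u t z * slice ut t z)).
  have i := weighted_integrable al be (L2M mD Lv Lt).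
  by rewrite -(RintegralZl _ mD i); apply: eq_Rintegral => z _; rewrite mulrCA.
split=> [|small]; rewrite rE.
  apply: (le_trans (slice_energy L0 nB ds 0 ler01 Lt.1 eqn)).
  by rewrite oppr0 mul0r.
apply: (le_trans (slice_decay L0 nB ds ler01 ler01 Lt.1 eqn small)).
by rewrite mulN1r.
Qed.

Lemma mass_le_energy v : L2 m2 D v -> mass v <= energy 1 1 v.
Proof.
move=> Lv; have i := weighted_integrable 1 1 Lv.2.
apply: (le_ae_Rintegral mD Lv.2 i); apply: aeW => z [/=]; rewrite in_itv/= => /andP[z0 _] _.
by rewrite /affine_weight mul1r subr0 ler_peMl ?sqr_ge0// lerDl ltW.
Qed.

Let energy_le_mass v : L2 m2 D v -> energy 1 1 v <= (1 + L) * mass v.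
Proof.
move=> Lv; have i := weighted_integrable 1 1 Lv.2.
rewrite -(RintegralZl _ mD Lv.2).
apply: (le_ae_Rintegral mD i (integrableRZ (1 + L) mD Lv.2)); apply: aeW => z [/=].
rewrite in_itv/= => /andP[_ zL] _.
by rewrite /affine_weight mul1r subr0 ler_wpM2r ?sqr_ge0// lerD2l ltW.
Qed.

Let energy_mass v : energy 1 0 v = mass v.
Proof. by apply: eq_Rintegral => z _; rewrite /affine_weight mul0r addr0 mul1r. Qed.

Lemma energy_decay t : 0 < t -> L2 m2 D u0 -> energy 1 1 u0 <= threshold ->
  energy 1 1 (slice u t) <= expR (- (4 * poincare_rate / (1 + L)) * t) * energy 1 1 u0.
Proof.
move=> t0 Lu0 small; have S0 : 0 < t + 1 by rewrite ltr_wpDr.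
have rb := rate_bounds S0.
have [F1 [f1 [A1 F10 F1E f1E]]] := solution_energy_AC 1 0 S0 Lu0.
have [F [f [A F0 FE fE]]] := solution_energy_AC 1 1 S0 Lu0.
(* The mass at time s is at most the initial mass, itself at most the initial weighted energy.
   Monotonicity of the mass needs no smallness, so there is no circularity. *)
have small_t s : 0 < s < t + 1 -> mass (slice u s) <= threshold.
  move=> sS; apply: le_trans small; apply: le_trans (mass_le_energy Lu0).
  rewrite -!energy_mass -(F1E s sS) -F10; apply: (AC_nonincreasing A1); last first.
    by case/andP: sS => ? ?; rewrite !ltW.
  move: rb; apply: (@ae_imp _ _ _ mu) => r H rI; rewrite f1E.
  exact: (H rI).1.
have tS : 0 < t < t + 1 by rewrite t0 ltrDl ltr01.
rewrite -(FE t tS) -F0; apply: (AC_exponential_decay A); last by case/andP: tS => ? ?; rewrite !ltW.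
move: rb; apply: (@ae_imp _ _ _ mu) => s H sI; rewrite fE.
have sS : 0 < s < t + 1 by move: sI; rewrite /= in_itv.
have s0 : 0 < s by case/andP: sS.
(* The dissipation controls the mass; the energy being at most (1 + L) times the mass, dividing by 1
   + L gives a rate proportional to the energy. *)
apply: (le_trans ((H sI).2 (small_t s sS))); rewrite (FE s sS) mulNr lerN2.
have L1 : 0 < 1 + L by rewrite addr_gt0.
rewrite mulrAC ler_pdivrMr// -[leRHS]mulrA ler_wpM2l//.
  by rewrite mulr_ge0// addr_ge0// divr_ge0// sqr_ge0.
by rewrite mulrC; exact: (energy_le_mass (solution_L2 s0)).
Qed.

End Decay.

Theorem theorem7p3 (R : realType) (B L : R) (u0 : R * R -> R)
    (u : R * R * R -> R) :
  0 < B -> 0 < L ->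
  (inner B L (fun z => (1 + z.1)%R) (fun z => (u0 z ^+ 2)%R) <
    (9 / 32 * ((12 * B ^+ 2 + L ^+ 2) ^+ 2 /
       (L ^+ 2 * B ^+ 2 * (4 * B ^+ 2 + L ^+ 2))))%:E)%E ->
  regular_solution B L u0 u ->
  let sigma := (12 * B ^+ 2 + L ^+ 2) / (B ^+ 2 * L ^+ 2 * (1 + L)) in
  forall t : R, 0 < t ->
    (inner B L (slice u t) (slice u t) <=
       inner B L (fun z => (1 + z.1)%R) (fun z => (slice u t z ^+ 2)%R))%E /\
    (inner B L (fun z => (1 + z.1)%R) (fun z => (slice u t z ^+ 2)%R) <=
       (expR (- sigma * t))%:E *
       inner B L (fun z => (1 + z.1)%R) (fun z => (u0 z ^+ 2)%R))%E.

Proof.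
move=> B0 L0 small [ut [ux [uxxx [uxyy sol]]]] sigma t t0.
have Lu0 : L2 plane_measure (`]0, L[ `*` `]-B, B[) u0.
  apply: L2_of_inner (rs_meas0 sol) _; apply: lt_trans small _; exact: ltry.
have Lu := solution_L2 sol t0.
have nB : B != 0 by rewrite gt_eqF. have nL : L != 0 by rewrite gt_eqF.
have n1 : 4 * B ^+ 2 + L ^+ 2 != 0 by rewrite gt_eqF// addr_gt0// ?mulr_gt0 ?exprn_gt0.
have n2 : 1 + L != 0 by rewrite gt_eqF// addr_gt0.
rewrite (inner_square Lu) (inner_energy Lu) (inner_energy Lu0) -EFinM !lee_fin; split.
  exact: mass_le_energy Lu.
rewrite (inner_energy Lu0) lte_fin in small.
(* With p = 1/L^2 and q = 1/(4B^2), 4 (3p + q) = (12 B^2 + L^2)/(B^2 L^2). *)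
have -> : - sigma * t = - (4 * (3 / (L - 0) ^+ 2 + 1 / (B - - B) ^+ 2) / (1 + L)) * t.
  congr (- _ * _); rewrite /sigma subr0 opprK; field.
  by rewrite n2 nB nL -mulr2n -mulr_natl mulf_neq0.
apply: (energy_decay B0 L0 sol t0 Lu0).
(* The two thresholds are equal: (3p + q)^2/(p + q) = (12 B^2 + L^2)^2/(4 B^2 L^2 (4 B^2 + L^2)),
   and (9/8)/4 = 9/32. *)
apply: le_trans (ltW small) _; rewrite le_eqVlt; apply/orP; left; apply/eqP.
rewrite subr0 opprK; field.
have -> : (B + B) ^+ 2 + L ^+ 2 = 4 * B ^+ 2 + L ^+ 2 by ring.
by rewrite nB nL n1 -mulr2n -mulr_natl mulf_neq0.
Qed.
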